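(* Let $\Phi=\begin{pmatrix}\Phi_{11}&\Phi_{12}\\ \Phi_{21}&\Phi_{22}\end{pmatrix}$ be a bounded block matrix function on $\mathbb T$ ($\Phi_{11}$ of size $m_1\times n_1$, $\Phi_{22}$ of size $m_2\times n_2$). If $\|\Gamma_\Phi\|_{\rm e}<\|\Gamma_\Phi\|$, then the matrix functions $V_c\in H^\infty(M_{n_1,n_1-1})$ and $W_c\in H^\infty(M_{m_1,m_1-1})$ associated with $\Phi$ as in the context are left invertible in $H^\infty$.
   Context: $\mathbb T$ is the unit circle, $\mathbb D$ the unit disk, $z$ the identity function on $\mathbb T$; $H^2_-=L^2\ominus H^2$; $M_{k,l}$ is the space of $k\times l$ matrices; $\|T\|_{\rm e}$ is the essential norm (distance to the compact operators). A matrix function $F\in H^\infty(M_{k,l})$ is left invertible in $H^\infty$ if there is $G\in H^\infty(M_{l,k})$ with $G(\zeta)F(\zeta)=I$ for all $\zeta\in\mathbb D$. $\Gamma_\Phi:H^2(\mathbb C^{n_1})\oplus L^2(\mathbb C^{n_2})\to H^2_-(\mathbb C^{m_1})\oplus L^2(\mathbb C^{m_2})$ is $\Gamma_\Phi f=\mathbb P^-\Phi f$, with $\mathbb P^-$ the orthogonal projection of $L^2(\mathbb C^{m_1})\oplus L^2(\mathbb C^{m_2})$ onto $H^2_-(\mathbb C^{m_1})\oplus L^2(\mathbb C^{m_2})$. Inner/outer: $\Theta\in H^\infty$ is inner if $\Theta(\zeta)$ is isometric a.e. on $\mathbb T$; $F\in H^\infty(M_{k,l})$ is outer if $FH^2(\mathbb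 C^l)$ is dense in $H^2(\mathbb C^k)$, and co-outer if $F^t$ is outer. Construction of $V_c,W_c$ (when $\|\Gamma_\Phi\|_{\rm e}<\|\Gamma_\Phi\|=:t_0$): fix a maximizing vector $f=f_1\oplus f_2$ of $\Gamma_\Phi$ ($f\ne0$, $\|\Gamma_\Phi f\|=\|\Gamma_\Phi\|\,\|f\|$; it exists), $f_1\in H^2(\mathbb C^{n_1})$, $f_2\in L^2(\mathbb C^{n_2})$, and put $g=g_1\oplus g_2=t_0^{-1}\Gamma_\Phi f$. Then $f_1\neq0$, $g_1\ne0$ and $\|g(\zeta)\|=\|f(\zeta)\|$ a.e. Let $h\in H^2$ be scalar outer with $|h(\zeta)|=\|f(\zeta)\|$ a.e.; let $\vartheta$ be a greatest common inner divisor of the entries of $f_1$ and $\tau$ one of the entries of $\bar z\bar g_1$ (bar = entrywise conjugation). Put $v_1=\bar\vartheta f_1/h\in H^\infty(\mathbb C^{n_1})$, $w_1=\bar z\bar\tau\bar g_1/h\in H^\infty(\mathbb C^{m_1})$. Write $v_1=v_{(o)}v_{(i)}$, $w_1=w_{(o)}w_{(i)}$ with $v_{(o)},w_{(o)}$ scalar outer and $v_{(i)},w_{(i)}$ inner columns. Then $V_c\in H^\infty(M_{n_1,n_1-1})$ and $W_c\in H^\infty(M_{m_1,m_1-1})$ are inner and co-outer matrix functions such that $(v_{(i)}\ \ \overline{V_c})$ and $(w_{(i)}\ \ \overline{W_c})$ are unitary-valued a.e. on $\mathbb T$ (empty if $n_1=1$, resp. $m_1=1$). *)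

(* Defs.v *)
From HB Require Import structures.
From mathcomp Require Import all_boot all_order all_algebra.
From mathcomp Require Import all_classical all_reals all_analysis.
From mathcomp Require Import complex.
Set Implicit Arguments.
Unset Strict Implicit.
Unset Printing Implicit Defensive.
Import Order.TTheory GRing.Theory Num.Theory.
Import numFieldNormedType.Exports.
Local Open Scope classical_set_scope.
Local Open Scope ring_scope.

(* The unit circle is parametrized by t |-> e^(it), t in [0, 2 pi[: a function
   on the circle is a function of the angle t, and only its values on
   [0, 2 pi[ matter.  Elements of L^2, H^2, H^oo are represented by (Borel)
   measurable functions, equality in these spaces being equality a.e.; elements
   of H^2 and H^oo are identified with their boundary values. *)

Section Circle.
Variable R : realType.
Local Notation C := R[i].
Local Notation mu := (@lebesgue_measure R).

Definition circle : set R := [set` `[0, 2 * pi[].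

Definition zfun (t : R) : C := Complex (cos t) (sin t).

Definition ae_circle (P : R -> Prop) : Prop :=
  {ae mu, forall t, circle t -> P t}.

(* Integral with respect to normalized Lebesgue measure on the circle. *)
Definition circle_int (f : R -> C) : C :=
  Complex ((2 * pi)^-1 * \int[mu]_(t in circle) complex.Re (f t))
          ((2 * pi)^-1 * \int[mu]_(t in circle) complex.Im (f t)).

Definition matfun (k l : nat) := R -> 'M[C]_(k, l).

Definition smx (f : R -> C) : matfun 1 1 := fun t => (f t)%:M.

Definition conjmf k l (A : 'M[C]_(k, l)) : 'M[C]_(k, l) := map_mx Num.conj A.

(* Square of the Euclidean norm; for a column this is the norm of C^k. *)
Definition sqnorm k l (A : 'M[C]_(k, l)) : R :=
  \sum_i \sum_j (complex.Re (A i j) ^+ 2 + complex.Im (A i j) ^+ 2).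

Definition enorm k l (A : 'M[C]_(k, l)) : R := Num.sqrt (sqnorm A).

Definition measurable_mf k l (F : matfun k l) : Prop :=
  forall i j, measurable_fun circle (fun t => complex.Re (F t i j)) /\
              measurable_fun circle (fun t => complex.Im (F t i j)).

Definition L2 k l (F : matfun k l) : Prop :=
  measurable_mf F /\ mu.-integrable circle (fun t => (sqnorm (F t))%:E).

Definition Linf k l (F : matfun k l) : Prop :=
  measurable_mf F /\ exists M : R, ae_circle (fun t => enorm (F t) <= M).

Definition l2norm k l (F : matfun k l) : R :=
  Num.sqrt ((2 * pi)^-1 * \int[mu]_(t in circle) sqnorm (F t)).

Definition l2inner k l (F G : matfun k l) : C :=
  circle_int (fun t => \sum_i \sum_j F t i j * Num.conj (G t i j)).

Definition fourier k l (F : matfun k l) (n : int) : 'M[C]_(k, l) :=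
  \matrix_(i, j) circle_int (fun t => F t i j * zfun t ^ (- n)).

Definition H2 k l (F : matfun k l) : Prop :=
  L2 F /\ forall n : int, n < 0 -> fourier F n = 0.

Definition Hinf k l (F : matfun k l) : Prop :=
  Linf F /\ forall n : int, n < 0 -> fourier F n = 0.

Definition H2minus k l (F : matfun k l) : Prop :=
  L2 F /\ forall G : matfun k l, H2 G -> l2inner F G = 0.

(* Value at a point of the open unit disk, by the Poisson integral. *)
Definition disk_value k l (F : matfun k l) (zeta : C) : 'M[C]_(k, l) :=
  \matrix_(i, j) circle_int (fun t =>
    F t i j * ((1 - `|zeta| ^+ 2) / `|zfun t - zeta| ^+ 2)).

Definition left_invertible k l (F : matfun k l) : Prop :=
  exists G : matfun l k, Hinf G /\
    forall zeta : C, `|zeta| < 1 ->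
      disk_value G zeta *m disk_value F zeta = 1%:M.

Definition inner k l (F : matfun k l) : Prop :=
  Hinf F /\ ae_circle (fun t => (conjmf (F t))^T *m F t = 1%:M).

Definition outer k l (F : matfun k l) : Prop :=
  Hinf F /\ forall g : matfun k 1, H2 g -> forall e : R, 0 < e ->
    exists2 f : matfun l 1, H2 f & l2norm (fun t => F t *m f t - g t) < e.

Definition co_outer k l (F : matfun k l) : Prop := outer (fun t => (F t)^T).

(* Scalar outer functions in H^2, which need not be bounded: the analytic
   polynomial multiples of h are dense in H^2. *)
Definition outerH2 (h : R -> C) : Prop :=
  H2 (smx h) /\ forall g : R -> C, H2 (smx g) -> forall e : R, 0 < e ->
    exists p : {poly C}, l2norm (smx (fun t => p.[zfun t] * h t - g t)) < e.

Definition inner_divides (th f : R -> C) : Prop :=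
  exists2 g : R -> C, H2 (smx g) & ae_circle (fun t => f t = th t * g t).

Definition is_gcd_inner k (F : matfun k 1) (th : R -> C) : Prop :=
  [/\ inner (smx th),
      forall i, inner_divides th (fun t => F t i 0) &
      forall th', inner (smx th') ->
        (forall i, inner_divides th' (fun t => F t i 0)) ->
        inner_divides th' th].

(* Operators between subspaces D and E of L^2, acting on representatives. *)
Section Operators.
Variables (n m : nat) (D : set (matfun n 1)) (E : set (matfun m 1)).

Definition linear_op (T : matfun n 1 -> matfun m 1) : Prop :=
  (forall f, D f -> E (T f)) /\
  forall (a : C) f g, D f -> D g ->
    ae_circle (fun t => T (fun s => a *: f s + g s) t = a *: T f t + T g t).

(* The unit ball of D has relatively compact image in E (boundedness and
   compatibility with equality a.e. follow). *)
Definition compact_op (K : matfun n 1 -> matfun m 1) : Prop :=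
  linear_op K /\
  forall u : nat -> matfun n 1, (forall k, D (u k) /\ l2norm (u k) <= 1) ->
    exists (phi : nat -> nat) (g : matfun m 1),
      [/\ forall i j, (i < j)%N -> (phi i < phi j)%N, E g &
          (fun k => l2norm (fun t => K (u (phi k)) t - g t)) @ \oo --> (0 : R)].

Definition opnorm (T : matfun n 1 -> matfun m 1) : \bar R :=
  ereal_sup [set (l2norm (T f))%:E | f in [set f | D f /\ l2norm f <= 1]].

Definition ess_norm (T : matfun n 1 -> matfun m 1) : \bar R :=
  ereal_inf [set opnorm (fun f t => T f t - K f t) | K in compact_op].

End Operators.

(* A representative of the orthogonal projection of p onto E. *)
Definition orth_proj m (E : set (matfun m 1)) (p : matfun m 1) : matfun m 1 :=
  xget (fun=> 0) [set q | E q /\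
    forall r, E r -> l2inner (fun t => p t - q t) r = 0].

Definition H2_L2 n1 n2 : set (matfun (n1 + n2) 1) :=
  [set f | H2 (fun t => usubmx (f t)) /\ L2 (fun t => dsubmx (f t))].

Definition H2minus_L2 m1 m2 : set (matfun (m1 + m2) 1) :=
  [set g | H2minus (fun t => usubmx (g t)) /\ L2 (fun t => dsubmx (g t))].

Section FourBlock.
Variables (m1 m2 n1 n2 : nat) (Phi : matfun (m1 + m2) (n1 + n2)).

Definition Gamma (f : matfun (n1 + n2) 1) : matfun (m1 + m2) 1 :=
  orth_proj (@H2minus_L2 m1 m2) (fun t => Phi t *m f t).

Definition Gamma_norm : \bar R := opnorm (@H2_L2 n1 n2) Gamma.

Definition Gamma_ess_norm : \bar R :=
  ess_norm (@H2_L2 n1 n2) (@H2minus_L2 m1 m2) Gamma.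

Definition maximizing (f : matfun (n1 + n2) 1) : Prop :=
  [/\ H2_L2 f, l2norm f != 0 &
      (l2norm (Gamma f))%:E = (Gamma_norm * (l2norm f)%:E)%E].

(* g = t_0^(-1) Gamma f, where t_0 is the (finite) norm of Gamma. *)
Definition dual_vector (f : matfun (n1 + n2) 1) : matfun (m1 + m2) 1 :=
  fun t => Complex (fine Gamma_norm)^-1 0 *: Gamma f t.

End FourBlock.

(* [Xc] completes the column [x] as V_c (resp. W_c) does for v_1 (resp. w_1):
   x = xo xi is the inner-outer factorization of x. *)
Definition completes k (x : matfun k.+1 1) (Xc : matfun k.+1 k) : Prop :=
  exists (xo : R -> C) (xi : matfun k.+1 1),
    [/\ outer (smx xo), inner xi, ae_circle (fun t => x t = xo t *: xi t),
        inner Xc /\ co_outer Xc &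
        ae_circle (fun t => row_mx (xi t) (conjmf (Xc t)) \is unitarymx)].

Definition associated m1 m2 n1 n2
    (Phi : matfun (m1.+1 + m2) (n1.+1 + n2))
    (Vc : matfun n1.+1 n1) (Wc : matfun m1.+1 m1) : Prop :=
  exists (f : matfun (n1.+1 + n2) 1) (h th tau : R -> C),
    let f1 : matfun n1.+1 1 := fun t => usubmx (f t) in
    let g1 : matfun m1.+1 1 := fun t => usubmx (dual_vector Phi f t) in
    let zg1 : matfun m1.+1 1 :=
      fun t => Num.conj (zfun t) *: conjmf (g1 t) in
    [/\ maximizing Phi f,
        outerH2 h /\ ae_circle (fun t => `|h t| = Complex (enorm (f t)) 0),
        is_gcd_inner f1 th /\ is_gcd_inner zg1 tau,
        completes (fun t => (Num.conj (th t) / h t) *: f1 t) Vc &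
        completes (fun t => (Num.conj (tau t) / h t) *: zg1 t) Wc].

End Circle.

(* Main.v *)
(* Write [t0] for the norm of Gamma and [a(r, s) = <Phi r, s>].  A maximizing
   vector [f] and [g = t0^-1 Gamma f] form a singular pair: [a(r, g) = t0 <r, f>]
   and [a(f, s) = t0 <g, s>], so the analytic part of [Phi f - t0 g] is in [H^2]
   and the other part vanishes.  This relation survives multiplication by
   [conj(theta) phi / h], [phi] in [H^2], and after projection of the second
   vector it yields pairs [r, s] with [|r| = |phi|], [a(r, s) = t0 |s|^2] and
   [|s|^2 = |phi|^2 - sum_i |P_+(conj(x_i) u phi)|^2], where [x = w_1] and
   [u = conj(tau z theta h) / h] is unimodular.
   If the last sum tends to 0 along unit vectors orthogonal to the kernel of the
   Toeplitz operator [T_u], these pairs are almost maximizing, hence precompact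
   because the essential norm is smaller than [t0]; a limit [phi] satisfies
   [P_+(conj(x) T_u phi) = 0], and the maximality of [tau] then forces
   [T_u phi = 0], a contradiction.  As [T_u] has dense range, [P_+ conj(x)] is
   bounded below on [H^2], and a lurking isometry argument (the Toeplitz corona
   theorem) provides a bounded analytic row [b] with [b x = 1].
   If [v] is the inner factor of [x], [b v = 1] after multiplication of [b] by
   the outer factor, and [((I - v b) conj(W_c))^t] is a left inverse of [W_c]; it
   is analytic since [(I - v b) conj(W_c) W_c^t F = (I - v b) F] and [W_c] is
   co-outer.  The flip [F |-> conj(z F)] exchanges the roles of [f] and [g] for
   the transposed symbol, which gives the statement for [V_c]. *)

(* The second vector must be projected because multiplication by [phi / h] can push the first block
   of [g] out of [H^2_-]; the energy lost there is exactly the sum that has to be bounded below. As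
   [conj(x)] is co-analytic, this sum equals [|P_+(conj(x) T_u phi)|^2], so compactness speaks of
   [P_+ conj(x)] on the range of [T_u] only. The bound is therefore proved relative to [|T_u phi|].
   Both sides ignore kernel vectors of [T_u], which allows the choice of unit vectors orthogonal to
   the kernel: a nonzero limit of these cannot lie in the kernel. The range is dense because, for
   [r] orthogonal to it, [conj(u) r] has no analytic part; clearing the denominator of [u] presents
   an [H^1] function as the conjugate of a function of [z H^1], which forces it to be 0. Vectors are
   functions rather than classes, so all forms are semi-inner products. Hardy spaces are handled
   through Fourier coefficients; the disk enters only at the end, through multiplicativity of the
   Poisson integral. *)
Require Import Defs.
From HB Require Import structures.
From mathcomp Require Import all_boot all_order all_algebra.
From mathcomp Require Import all_classical all_reals all_analysis.
From mathcomp Require Import measurable_realfun complex.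
From mathcomp Require Import ring lra zify.
Set Implicit Arguments.
Unset Strict Implicit.
Unset Printing Implicit Defensive.
Import Order.TTheory GRing.Theory Num.Theory.
Import numFieldNormedType.Exports.
Local Open Scope classical_set_scope.
Local Open Scope ring_scope.

(** * Integration on the circle *)
Section CircleIntegral.
Variable R : realType.
Local Notation C := R[i].
Local Notation mu := (@lebesgue_measure R).
Local Notation circle := (@circle R).
Implicit Types (f g h : R -> C) (u v : R -> R).

Lemma measurable_circle : measurable circle.
Proof. by rewrite /Defs.circle. Qed.
Hint Resolve measurable_circle : core.

Lemma measurable_circleR : measurable (circle : set (measurableTypeR R)).
Proof. exact: measurable_circle. Qed.
Hint Resolve measurable_circleR : core.

Lemma pi2_gt0 : 0 < 2 * pi :> R.
Proof. by rewrite mulr_gt0 ?pi_gt0. Qed.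

Lemma mu_circle : mu circle = (2 * pi)%:E.
Proof.
by rewrite /circle lebesgue_measure_itv /= lte_fin pi2_gt0 -EFinB subr0.
Qed.

Lemma aeT (P : R -> Prop) : (forall t, circle t -> P t) -> ae_circle P.
Proof. by move=> h; apply: (@filterE _ _ (ae_filter_ringOfSetsType mu)). Qed.

Lemma aeS (P Q : R -> Prop) :
  (forall t, circle t -> P t -> Q t) -> ae_circle P -> ae_circle Q.
Proof.
move=> h; apply: (@filterS _ _ (ae_filter_ringOfSetsType mu)) => t Pt ct.
exact: h (Pt ct).
Qed.

Lemma aeS2 (P Q S : R -> Prop) :
  (forall t, circle t -> P t -> Q t -> S t) ->
  ae_circle P -> ae_circle Q -> ae_circle S.
Proof.
move=> h.
apply: (@filterS2 _ _ (ae_filter_ringOfSetsType mu)) => t Pt Qt ct.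
exact: h (Pt ct) (Qt ct).
Qed.

Lemma aeS3 (P Q S T : R -> Prop) :
  (forall t, circle t -> P t -> Q t -> S t -> T t) ->
  ae_circle P -> ae_circle Q -> ae_circle S -> ae_circle T.
Proof.
move=> h hP hQ; apply: aeS2 (aeS2 (S := fun t => P t /\ Q t) _ hP hQ) => //.
by move=> t ct [Pt Qt]; apply: h.
Qed.

Lemma ae_all (I : finType) (P : I -> R -> Prop) :
  (forall i, ae_circle (P i)) -> ae_circle (fun t => forall i, P i t).
Proof.
move=> h; suff : ae_circle (fun t => forall i, i \in enum I -> P i t).
  by apply: aeS => t _ H i; apply: H; rewrite mem_enum.
elim: (enum I) => [|a s ih]; first exact: aeT.
by apply: aeS2 (h a) ih => t _ ha hs i; rewrite inE => /predU1P[->//|/hs].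
Qed.

(** The circle has positive measure. This turns incompatible almost everywhere statements into a
    contradiction, and shows that an essential bound of a nonnegative function is nonnegative. *)
Lemma ae_exists (P : R -> Prop) : ae_circle P -> exists t, P t.
Proof.
move=> hP; apply/not_existsP => nP.
have /negligibleP : mu.-negligible circle.
  by case: hP => A [mA A0 sA]; exists A; split => // t ct; apply: sA => /= /(_ ct) /nP.
move=> /(_ measurable_circleR) h.
have [] := etrans (esym h) mu_circle.
by move/eqP; rewrite lt_eqF ?pi2_gt0.
Qed.

Definition rint (u : R -> R) : Prop := mu.-integrable circle (EFin \o u).

Lemma rintD u v : rint u -> rint v -> rint (fun t => u t + v t).
Proof.
move=> hu hv; have := integrableD measurable_circleR hu hv.
by apply: eq_integrable.
Qed.

Lemma rintZ c u : rint u -> rint (fun t => c * u t).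
Proof.
move=> hu; have := integrableZl measurable_circleR c hu.
by apply: eq_integrable.
Qed.

Lemma rintN u : rint u -> rint (fun t => - u t).
Proof.
move=> hu; have := rintZ (-1) hu; apply: eq_integrable => // t _ /=.
by rewrite mulN1r.
Qed.

Lemma rint_cst c : rint (fun=> c).
Proof.
apply/integrableP; split; first exact/measurable_EFinP.
rewrite (eq_integral (fun=> `|c|%:E)) => //; rewrite integral_cst//.
have /= -> := mu_circle; exact: ltry.
Qed.

Lemma rint_meas u : rint u -> measurable_fun circle u.
Proof.
move=> /(measurable_int mu) h.
have {}h : measurable_fun circle (EFin \o u) by exact: h.
exact/measurable_EFinP.
Qed.

Lemma rint_dom u v : measurable_fun circle u -> rint v ->
  ae_circle (fun t => `|u t| <= v t) -> rint u.
Proof.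
move=> mu_ hv uv; apply/integrableP; split; first exact/measurable_EFinP.
case/integrableP : (hv) => mv; apply: le_lt_trans.
apply: ae_ge0_le_integral => //.
- by apply/measurable_EFinP; apply: measurableT_comp.
- by apply/measurable_EFinP; apply: measurableT_comp => //; exact: rint_meas.
- apply: (@filterS _ _ (ae_filter_ringOfSetsType mu)) uv => t h ct; rewrite /= lee_fin (le_trans (h ct))//.
  exact: ler_norm.
Qed.

Local Notation "\I u" := (\int[mu]_(t in circle) u t)%R (at level 10).

Lemma RI_D u v : rint u -> rint v ->
  \int[mu]_(t in circle) (u t + v t) = \I u + \I v.
Proof. by move=> hu hv; rewrite RintegralD. Qed.

Lemma RI_Z c u : rint u -> \int[mu]_(t in circle) (c * u t) = c * \I u.
Proof. by move=> hu; rewrite RintegralZl. Qed.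

Lemma RI_ae u v : measurable_fun circle u -> measurable_fun circle v ->
  ae_circle (fun t => u t = v t) -> \I u = \I v.
Proof.
move=> mu_ mv uv; rewrite /Rintegral; congr fine; apply: ae_eq_integral => //.
- exact/measurable_EFinP.
- exact/measurable_EFinP.
- by apply: (@filterS _ _ (ae_filter_ringOfSetsType mu)) uv => t h ct; rewrite h.
Qed.

Lemma RI_eq0 u : rint u -> (forall t, 0 <= u t) -> \I u = 0 ->
  ae_circle (fun t => u t = 0).
Proof.
move=> hu u0 I0.
have : (\int[mu]_(t in circle) `|(EFin \o u) t|)%E = 0%E.
  rewrite -[LHS]fineK; last first.
    apply: integrable_fin_num => //; exact: integrable_abse.
  congr EFin; rewrite -[RHS]I0; congr fine; apply: eq_integral => t _ /=.
  by rewrite ger0_norm.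
move/ae_eq_integral_abs => /(_ measurable_circleR) h.
have {}h := h (measurable_int mu hu).
by apply: (@filterS _ _ (ae_filter_ringOfSetsType mu)) h => t h ct; have [] := h ct.
Qed.

Definition measc f : Prop :=
  measurable_fun circle (fun t => complex.Re (f t)) /\
  measurable_fun circle (fun t => complex.Im (f t)).

Lemma cReD (x y : C) : complex.Re (x + y) = complex.Re x + complex.Re y.
Proof. by case: x; case: y. Qed.
Lemma cImD (x y : C) : complex.Im (x + y) = complex.Im x + complex.Im y.
Proof. by case: x; case: y. Qed.
Lemma cReN (x : C) : complex.Re (- x) = - complex.Re x.
Proof. by case: x. Qed.
Lemma cImN (x : C) : complex.Im (- x) = - complex.Im x.
Proof. by case: x. Qed.
Lemma cReM (x y : C) : complex.Re (x * y) =
  complex.Re x * complex.Re y - complex.Im x * complex.Im y.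
Proof. by case: x; case: y. Qed.
Lemma cImM (x y : C) : complex.Im (x * y) =
  complex.Re x * complex.Im y + complex.Im x * complex.Re y.
Proof. by case: x => a b; case: y => c d /=; rewrite addrC. Qed.
Lemma cReJ (x : C) : complex.Re (Num.conj x) = complex.Re x.
Proof. by case: x. Qed.
Lemma cImJ (x : C) : complex.Im (Num.conj x) = - complex.Im x.
Proof. by case: x. Qed.
Lemma cReV (x : C) : complex.Re x^-1 =
  complex.Re x / (complex.Re x ^+ 2 + complex.Im x ^+ 2).
Proof. by case: x. Qed.
Lemma cImV (x : C) : complex.Im x^-1 =
  - complex.Im x / (complex.Re x ^+ 2 + complex.Im x ^+ 2).
Proof. by case: x => a b /=; rewrite mulNr. Qed.
Lemma complexP (x y : C) : complex.Re x = complex.Re y ->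
  complex.Im x = complex.Im y -> x = y.
Proof. by case: x => a b; case: y => c d /= -> ->. Qed.

Lemma meas_cst (c : C) : measc (fun=> c).
Proof. by split; exact: measurable_cst. Qed.

Lemma measD f g : measc f -> measc g -> measc (fun t => f t + g t).
Proof.
move=> [f1 f2] [g1 g2]; split.
- under eq_fun do rewrite cReD; exact: measurable_funD.
- under eq_fun do rewrite cImD; exact: measurable_funD.
Qed.

Lemma measM f g : measc f -> measc g -> measc (fun t => f t * g t).
Proof.
move=> [f1 f2] [g1 g2]; split.
- under eq_fun do rewrite cReM.
  by apply: measurable_funB; apply: measurable_funM.
- under eq_fun do rewrite cImM.
  by apply: measurable_funD; apply: measurable_funM.
Qed.

Lemma measJ f : measc f -> measc (fun t => Num.conj (f t)).
Proof.
move=> [f1 f2]; split; first by under eq_fun do rewrite cReJ.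
by under eq_fun do rewrite cImJ; exact: measurableT_comp.
Qed.

Lemma measN f : measc f -> measc (fun t => - f t).
Proof.
move=> hf; have := measM (meas_cst (-1)) hf.
by under eq_fun do rewrite mulN1r.
Qed.

Lemma measB f g : measc f -> measc g -> measc (fun t => f t - g t).
Proof. by move=> hf hg; apply: measD hf (measN hg). Qed.

Lemma measV f : measc f -> measc (fun t => (f t)^-1).
Proof.
move=> [f1 f2].
have md : measurable_fun circle
    (fun t => (complex.Re (f t) ^+ 2 + complex.Im (f t) ^+ 2)^-1).
  (* On nonnegative reals, 0 included, inversion agrees with the real power of exponent -1, which is
     a measurable function. *)
  under eq_fun => t do rewrite -powR_inv1 ?addr_ge0 ?sqr_ge0//.
  apply: (measurableT_comp (f := fun x : R => x `^ (-1))
    (g := fun t => complex.Re (f t) ^+ 2 + complex.Im (f t) ^+ 2)).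
    exact: measurable_powR.
  by apply: measurable_funD; exact: measurable_funX.
split.
- by under eq_fun do rewrite cReV; exact: measurable_funM.
- under eq_fun do rewrite cImV; apply: measurable_funM => //.
  exact: measurableT_comp.
Qed.

Lemma meas_sum (I : Type) (r : seq I) (P : pred I) (F : I -> R -> C) :
  (forall i, measc (F i)) -> measc (fun t => \sum_(i <- r | P i) F i t).
Proof.
move=> h; elim: r => [|a r ih].
  by under eq_fun do rewrite big_nil; exact: meas_cst.
under eq_fun do rewrite big_cons; case: (P a) => //.
exact: measD.
Qed.

Lemma meas_z : measc (@zfun R).
Proof.
split; apply: measurable_funTS; apply: continuous_measurable_fun.
- exact: continuous_cos.
- exact: continuous_sin.
Qed.

Lemma measX f n : measc f -> measc (fun t => f t ^+ n).
Proof.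
move=> hf; elim: n => [|n ih]; first exact: meas_cst.
by under eq_fun do rewrite exprS; exact: measM.
Qed.

Lemma meas_zX (n : int) : measc (fun t => zfun t ^ n).
Proof.
case: n => n; first exact: (measX n meas_z).
exact: (measV (measX n.+1 meas_z)).
Qed.

(** The squared modulus as an element of [R]; the norm of [R[i]] takes its values in [R[i]]
    itself. *)
Definition csq (z : C) : R := complex.Re z ^+ 2 + complex.Im z ^+ 2.

Lemma csq_ge0 z : 0 <= csq z.
Proof. by rewrite addr_ge0 ?sqr_ge0. Qed.

Lemma csqM (x y : C) : csq (x * y) = csq x * csq y.
Proof. rewrite /csq cReM cImM; ring. Qed.

Lemma csqJ (x : C) : csq (Num.conj x) = csq x.
Proof. by rewrite /csq cReJ cImJ sqrrN. Qed.

Lemma csqN (x : C) : csq (- x) = csq x.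
Proof. by rewrite /csq cReN cImN !sqrrN. Qed.

Lemma csq0 : csq 0 = 0. Proof. by rewrite /csq /= expr0n addr0. Qed.
Lemma csq1 : csq 1 = 1. Proof. by rewrite /csq /= expr0n expr1n addr0. Qed.

Lemma csq_eq0 (x : C) : csq x = 0 -> x = 0.
Proof.
move=> h; apply/complexP => /=; apply/eqP; rewrite -sqrf_eq0; apply/eqP;
  move: h; rewrite /csq => /eqP; rewrite paddr_eq0 ?sqr_ge0// => /andP[/eqP + /eqP] => //.
Qed.

Lemma csqD_le (x y : C) : csq (x + y) <= 2 * csq x + 2 * csq y.
Proof.
rewrite /csq cReD cImD.
have := sqr_ge0 (complex.Re x - complex.Re y).
have := sqr_ge0 (complex.Im x - complex.Im y).
nra.
Qed.

Lemma mulJ (x : C) : x * Num.conj x = Complex (csq x) 0.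
Proof. by apply/complexP; rewrite ?cReM ?cImM cReJ cImJ /=; rewrite /csq; ring. Qed.

Lemma csq_z t : csq (zfun t : C) = 1.
Proof. by rewrite /csq /= cos2Dsin2. Qed.

Lemma meas_csq f : measc f -> measurable_fun circle (fun t => csq (f t)).
Proof. by move=> [f1 f2]; apply: measurable_funD; exact: measurable_funX. Qed.

Definition cL1 f : Prop :=
  rint (fun t => complex.Re (f t)) /\ rint (fun t => complex.Im (f t)).
Definition cL2 f : Prop := measc f /\ rint (fun t => csq (f t)).

Lemma cL1_meas f : cL1 f -> measc f.
Proof. by case=> h1 h2; split; exact: rint_meas. Qed.

Lemma cL1D f g : cL1 f -> cL1 g -> cL1 (fun t => f t + g t).
Proof.
move=> [f1 f2] [g1 g2]; split.
- under eq_fun do rewrite cReD; exact: rintD.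
- under eq_fun do rewrite cImD; exact: rintD.
Qed.

Lemma cL1Z (c : C) f : cL1 f -> cL1 (fun t => c * f t).
Proof.
move=> [f1 f2]; split.
- under eq_fun do rewrite cReM; apply: rintD; first exact: rintZ.
  by apply: rintN; exact: rintZ.
- under eq_fun do rewrite cImM; apply: rintD; exact: rintZ.
Qed.

Lemma cL1J f : cL1 f -> cL1 (fun t => Num.conj (f t)).
Proof.
move=> [f1 f2]; split; first by under eq_fun do rewrite cReJ.
under eq_fun do rewrite cImJ; exact: rintN.
Qed.

Lemma cL1_sum (I : Type) (r : seq I) (P : pred I) (F : I -> R -> C) :
  (forall i, cL1 (F i)) -> cL1 (fun t => \sum_(i <- r | P i) F i t).
Proof.
move=> h; elim: r => [|a r ih].
  under eq_fun do rewrite big_nil; split; exact: rint_cst.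
by under eq_fun do rewrite big_cons; case: (P a) => //; exact: cL1D.
Qed.

Lemma cL1_cst (c : C) : cL1 (fun=> c).
Proof. by split; exact: rint_cst. Qed.

Lemma cL1_dom f (v : R -> R) : measc f -> rint v ->
  ae_circle (fun t => csq (f t) <= v t ^+ 2 /\ 0 <= v t) -> cL1 f.
Proof.
move=> [f1 f2] hv h; split; apply: rint_dom hv _ => //.
- apply: aeS h => t _ [h h0]; rewrite -(ler_pXn2r (n:=2)) ?nnegrE//.
  rewrite real_normK ?num_real// (le_trans _ h)// lerDl sqr_ge0//.
- apply: aeS h => t _ [h h0]; rewrite -(ler_pXn2r (n:=2)) ?nnegrE//.
  rewrite real_normK ?num_real// (le_trans _ h)// lerDr sqr_ge0//.
Qed.

Lemma cL2_meas f : cL2 f -> measc f. Proof. by case. Qed.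

Lemma cL1M f g : cL2 f -> cL2 g -> cL1 (fun t => f t * g t).
Proof.
move=> [mf hf] [mg hg]; apply: (@cL1_dom _ (fun t => csq (f t) + csq (g t))).
- exact: measM.
- exact: rintD.
- apply: aeT => t _; rewrite csqM; split; last by rewrite addr_ge0 ?csq_ge0.
  have := csq_ge0 (f t); have := csq_ge0 (g t); nra.
Qed.

Lemma cL1_bnd f b (M : R) : cL1 f -> measc b ->
  ae_circle (fun t => csq (b t) <= M ^+ 2) -> cL1 (fun t => b t * f t).
Proof.
move=> f1 mb hb; have mf := cL1_meas f1; case: f1 => f1 f2.
apply: (@cL1_dom _ (fun t => `|M| * (`|complex.Re (f t)| + `|complex.Im (f t)|))).
- exact: measM.
- by apply: rintZ; apply: rintD; exact: integrable_norm.
- apply: aeS hb => t _ hb; split; last by rewrite mulr_ge0 ?addr_ge0.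
  rewrite csqM exprMn real_normK ?num_real//; apply: ler_pM => //; rewrite ?csq_ge0//.
  rewrite sqrrD /csq !real_normK ?num_real//.
  have : 0 <= `|complex.Re (f t)| * `|complex.Im (f t)| by rewrite mulr_ge0.
  lra.
Qed.

Lemma cL2D f g : cL2 f -> cL2 g -> cL2 (fun t => f t + g t).
Proof.
move=> [mf hf] [mg hg]; split; first exact: measD.
apply: (@rint_dom _ (fun t => 2 * csq (f t) + 2 * csq (g t))).
- by apply: meas_csq; exact: measD.
- by apply: rintD; exact: rintZ.
- by apply: aeT => t _; rewrite ger0_norm ?csq_ge0// csqD_le.
Qed.

Lemma cL2_bnd f b (M : R) : cL2 f -> measc b ->
  ae_circle (fun t => csq (b t) <= M) -> cL2 (fun t => b t * f t).
Proof.
move=> [mf hf] mb hb; split; first exact: measM.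
apply: (@rint_dom _ (fun t => M * csq (f t))).
- by apply: meas_csq; exact: measM.
- exact: rintZ.
- apply: aeS hb => t _ h; rewrite ger0_norm ?csq_ge0// csqM.
  by rewrite ler_wpM2r ?csq_ge0.
Qed.

Lemma cL2_cst (c : C) : cL2 (fun=> c).
Proof. by split; [exact: meas_cst|exact: rint_cst]. Qed.

Lemma cL2Z (c : C) f : cL2 f -> cL2 (fun t => c * f t).
Proof.
move=> hf; apply: (cL2_bnd (b := fun=> c) (M := csq c) hf (meas_cst c)).
exact: aeT.
Qed.

Lemma cL2N f : cL2 f -> cL2 (fun t => - f t).
Proof. by move=> /(cL2Z (-1)); under eq_fun do rewrite mulN1r. Qed.

Lemma cL2B f g : cL2 f -> cL2 g -> cL2 (fun t => f t - g t).
Proof. by move=> hf hg; apply: cL2D hf (cL2N hg). Qed.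

Lemma cL2J f : cL2 f -> cL2 (fun t => Num.conj (f t)).
Proof.
by move=> [mf hf]; split; [exact: measJ|under eq_fun do rewrite csqJ].
Qed.

Lemma cL2_sum (I : Type) (r : seq I) (P : pred I) (F : I -> R -> C) :
  (forall i, cL2 (F i)) -> cL2 (fun t => \sum_(i <- r | P i) F i t).
Proof.
move=> h; elim: r => [|a r ih].
  under eq_fun do rewrite big_nil; exact: cL2_cst.
by under eq_fun do rewrite big_cons; case: (P a) => //; exact: cL2D.
Qed.

Lemma cL2_ae f g : measc g -> ae_circle (fun t => csq (g t) <= csq (f t)) ->
  cL2 f -> cL2 g.
Proof.
move=> mg fg [mf hf]; split => //; apply: rint_dom hf _; first exact: meas_csq.
by apply: aeS fg => t _ h; rewrite ger0_norm ?csq_ge0.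
Qed.

Lemma cL2_ae_bnd g M : measc g -> ae_circle (fun t => csq (g t) <= M) -> cL2 g.
Proof.
move=> mg hM; split => //; apply: rint_dom (rint_cst M) _; first exact: meas_csq.
by apply: aeS hM => t _ h; rewrite ger0_norm ?csq_ge0.
Qed.

Lemma cL2_cL1 f : cL2 f -> cL1 f.
Proof.
move=> hf; have := cL1M hf (cL2_cst 1).
by under eq_fun do rewrite mulr1.
Qed.

Lemma csq_zX n t : csq (zfun t ^ n : C) = 1.
Proof.
have h k : csq (zfun t ^+ k : C) = 1.
  by elim: k => [|k ih]; rewrite ?csq1// exprS csqM csq_z ih mul1r.
case: n => k; first exact: h.
rewrite /= NegzE -exprnN; have := csqM (zfun t ^- k.+1) (zfun t ^+ k.+1 : C).
rewrite mulVf ?csq1 ?h ?mulr1//; apply: contra_eqN (h k.+1) => /eqP ->.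
by rewrite csq0 eq_sym oner_eq0.
Qed.

Lemma zfun_neq0 t : zfun t != 0 :> C.
Proof.
by apply: contra_eqN (csq_z t) => /eqP ->; rewrite csq0 eq_sym oner_eq0.
Qed.

Lemma cL2_zX n : cL2 (fun t => zfun t ^ n).
Proof.
apply: (cL2_ae_bnd (M := 1)); first exact: meas_zX.
by apply: aeT => t _; rewrite csq_zX.
Qed.

Lemma zXJ n t : Num.conj (zfun t ^ n) = zfun t ^ (- n) :> C.
Proof.
have h : Num.conj (zfun t ^ n) * zfun t ^ n = 1 :> C.
  by rewrite mulrC mulJ csq_zX.
have /mulIf := expfz_neq0 n (zfun_neq0 t); apply.
by rewrite h -expfzDr ?zfun_neq0// addNr expr0z.
Qed.

Lemma cintD f g : cL1 f -> cL1 g ->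
  circle_int (fun t => f t + g t) = circle_int f + circle_int g.
Proof.
move=> [f1 f2] [g1 g2]; rewrite /circle_int.
under eq_fun do rewrite cReD.
under [X in Complex _ (_ * Rintegral _ _ X)]eq_fun do rewrite cImD.
by rewrite !RI_D// !mulrDr.
Qed.

Lemma cintZ (c : C) f : cL1 f ->
  circle_int (fun t => c * f t) = c * circle_int f.
Proof.
move=> [f1 f2]; rewrite /circle_int.
under eq_fun do rewrite cReM -mulNr.
under [X in Complex _ (_ * Rintegral _ _ X)]eq_fun do rewrite cImM.
rewrite !RI_D ?RI_Z; try exact: rintZ; try by [].
by apply/complexP; rewrite ?cReM ?cImM /=; ring.
Qed.

Lemma cintN f : cL1 f -> circle_int (fun t => - f t) = - circle_int f.
Proof.
move=> hf; rewrite -mulN1r -cintZ//; congr circle_int.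
by apply/funext => t; rewrite mulN1r.
Qed.

Lemma cL1N f : cL1 f -> cL1 (fun t => - f t).
Proof. by move=> /(cL1Z (-1)); under eq_fun do rewrite mulN1r. Qed.

Lemma cL1B f g : cL1 f -> cL1 g -> cL1 (fun t => f t - g t).
Proof. by move=> hf hg; apply: cL1D hf (cL1N hg). Qed.

Lemma cintB f g : cL1 f -> cL1 g ->
  circle_int (fun t => f t - g t) = circle_int f - circle_int g.
Proof. by move=> hf hg; rewrite cintD// ?cintN//; exact: cL1N. Qed.

Lemma cintJ f : cL1 f -> circle_int (fun t => Num.conj (f t)) =
  Num.conj (circle_int f).
Proof.
move=> [f1 f2]; apply/complexP => /=.
- by under eq_fun do rewrite cReJ.
- under eq_fun do rewrite cImJ -mulN1r.
  by rewrite RI_Z// mulN1r mulrN.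
Qed.

Lemma RI_cst (c : R) : \int[mu]_(t in circle) c = c * (2 * pi).
Proof.
rewrite Rintegral_cst//; congr (_ * _); exact: (congr1 fine mu_circle).
Qed.

Lemma cint_sum (I : Type) (r : seq I) (P : pred I) (F : I -> R -> C) :
  (forall i, cL1 (F i)) ->
  circle_int (fun t => \sum_(i <- r | P i) F i t) =
  \sum_(i <- r | P i) circle_int (F i).
Proof.
move=> h; elim: r => [|a r ih].
  under eq_fun do rewrite big_nil; rewrite big_nil.
  by apply/complexP; rewrite /= RI_cst mul0r mulr0.
rewrite big_cons -ih; under eq_fun do rewrite big_cons.
by case: (P a) => //; rewrite cintD//; exact: cL1_sum.
Qed.

Lemma cint_ae f g : measc f -> measc g -> ae_circle (fun t => f t = g t) ->
  circle_int f = circle_int g.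
Proof.
move=> [f1 f2] [g1 g2] h; apply/complexP => /=; congr (_ * _); apply: RI_ae => //;
  by apply: aeS h => t _ ->.
Qed.

Lemma cint_cst (c : C) : circle_int (fun=> c) = c.
Proof.
have p0 : pi != 0 :> R by rewrite gt_eqF// pi_gt0.
by apply/complexP; rewrite /= RI_cst mulrCA mulVf ?mulr1// mulf_neq0.
Qed.

Lemma zfunX n (t : R) : zfun t ^+ n = zfun (n%:R * t) :> C.
Proof.
elim: n => [|n ih]; first by rewrite mul0r /zfun cos0 sin0.
rewrite exprS ih -natr1 mulrDl mul1r /zfun; apply/complexP.
- by rewrite cReM/= cosD; ring.
- by rewrite cImM/= sinD; ring.
Qed.

Let sin2pin n : sin (n%:R * (2 * pi)) = 0 :> R.
Proof.
elim: n => [|n ih]; first by rewrite mul0r sin0.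
have -> : n.+1%:R * (2 * pi) = n%:R * (2 * pi) + pi *+ 2 :> R.
  by rewrite -natr1 mulr2n; ring.
by rewrite sinD2pi.
Qed.

Let cos2pin n : cos (n%:R * (2 * pi)) = 1 :> R.
Proof.
elim: n => [|n ih]; first by rewrite mul0r cos0.
have -> : n.+1%:R * (2 * pi) = n%:R * (2 * pi) + pi *+ 2 :> R.
  by rewrite -natr1 mulr2n; ring.
by rewrite cosD2pi.
Qed.

Let RI_FTC (u v : R -> R) :
  (forall t : R, is_derive t (1 : R) v (u t)) -> continuous u ->
  \I u = v (2 * pi) - v 0.
Proof.
move=> dv cu; rewrite /Rintegral /circle.
have mu_ : measurable_fun circle (EFin \o u).
  by apply/measurable_EFinP; apply: measurable_funTS; exact: continuous_measurable_fun.
rewrite integral_itv_bndo_bndc//.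
have cv : continuous v.
  move=> t; apply: differentiable_continuous; apply/derivable1_diffP.
  by have [] := dv t.
rewrite (@continuous_FTC2 _ u v) ?pi2_gt0//.
- exact: continuous_subspaceT.
- split.
  + by move=> t _; have [] := dv t.
  + apply: cvg_at_right_filter; exact: cv.
  + apply: cvg_at_left_filter; exact: cv.
- by move=> t _; rewrite derive1E; have [] := dv t.
Qed.

Lemma cint_zXS n : circle_int (fun t => zfun t ^+ n.+1) = 0 :> C.
Proof.
have k0 : n.+1%:R != 0 :> R by rewrite pnatr_eq0.
have clin : continuous (fun t : R => n.+1%:R * t).
  by move=> t; exact: mulrl_continuous.
apply/complexP => /=.
- under eq_fun do rewrite zfunX /=.
  have D (t : R) : is_derive t (1 : R)
      (fun t => n.+1%:R^-1 * sin (n.+1%:R * t)) (cos (n.+1%:R * t)).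
    apply: is_derive_eq.
    by rewrite /GRing.scale /= mulr1; field.
  rewrite (RI_FTC D) ?sin2pin ?mulr0 ?sin0 ?mulr0 ?subrr ?mulr0//.
  by move=> t; apply: continuous_comp; [exact: clin|exact: continuous_cos].
- under eq_fun do rewrite zfunX /=.
  have D (t : R) : is_derive t (1 : R)
      (fun t => - n.+1%:R^-1 * cos (n.+1%:R * t)) (sin (n.+1%:R * t)).
    apply: is_derive_eq.
    by rewrite /GRing.scale /= mulr1; field.
  rewrite (RI_FTC D) ?cos2pin ?mulr0 ?cos0 ?subrr ?mulr0//.
  by move=> t; apply: continuous_comp; [exact: clin|exact: continuous_sin].
Qed.

Lemma cint_zX (n : int) : circle_int (fun t => zfun t ^ n) = (n == 0)%:R :> C.
Proof.
case: n => [[|n]|n].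
- by rewrite eqxx -[RHS]cint_cst; congr circle_int.
- by rewrite /= -[RHS](cint_zXS n).
- have h := congr1 Num.conj (cint_zXS n).
  rewrite -cintJ in h; last exact: (cL2_cL1 (cL2_zX n.+1)).
  rewrite (rmorph0 Num.conj) in h.
  rewrite [RHS](_ : _ = 0)// -[RHS]h; congr circle_int; apply/funext => t.
  exact: esym (zXJ n.+1 t).
Qed.

End CircleIntegral.

(** * Uniqueness of Fourier coefficients *)
Section FourierUniqueness.
Variable R : realType.
Local Notation C := R[i].
Local Notation mu := (@lebesgue_measure R).
Local Notation circle := (@circle R).
Implicit Types (f g h : R -> C) (u v : R -> R).
Hint Resolve measurable_circle measurable_circleR : core.

Lemma rintE u : rint u ->
  (\int[mu]_(t in circle) (u t)%:E)%E = (\int[mu]_(t in circle) u t)%:E.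
Proof. by move=> hu; rewrite /Rintegral fineK//; exact: integrable_fin_num. Qed.

Lemma cvgE (a : nat -> R) (l : R) :
  a @ \oo --> l -> (fun n => (a n)%:E) @ \oo --> l%:E.
Proof. by move=> h; apply: cvg_EFin => //; exact: nearW. Qed.

Lemma RI_dominated (F : nat -> R -> R) u v : (forall n, rint (F n)) ->
  measurable_fun circle u -> rint v ->
  ae_circle (fun t => F^~ t @ \oo --> u t) ->
  (forall n t, circle t -> `|F n t| <= v t) ->
  (fun n => \int[mu]_(t in circle) F n t) @ \oo --> \int[mu]_(t in circle) u t.
Proof.
move=> hF mu_ hg hcv hb.
have [|||||i1 _ i3] := @dominated_convergence _ _ R mu circle (@measurable_circleR R)
  (fun n => EFin \o F n) (EFin \o u) (EFin \o v).
- by move=> n; exact: (measurable_int mu (hF n)).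
- exact/measurable_EFinP.
- apply: (@filterS _ _ (ae_filter_ringOfSetsType mu)) hcv => t h ct.
  exact: cvgE (h ct).
- exact: hg.
- apply: (@filterE _ _ (ae_filter_ringOfSetsType mu)) => t n ct.
  by rewrite /= lee_fin hb.
have {}i3 : (fun n => (\int[mu]_(t in circle) F n t)%:E) @ \oo -->
    (\int[mu]_(t in circle) u t)%:E.
  rewrite -rintE//; apply: cvg_trans i3; apply: near_eq_cvg; apply: nearW => n /=.
  by rewrite -rintE.
by move/fine_cvgP : i3 => [].
Qed.

Lemma exprB_ge (x : R) n : 0 <= x <= 1 -> 1 - n%:R * x <= (1 - x) ^+ n.
Proof.
move=> /andP[x0 x1]; elim: n => [|n ih]; first by rewrite mul0r subr0 expr0.
rewrite exprS; apply: (@le_trans _ _ ((1 - x) * (1 - n%:R * x))); last first.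
  by apply: ler_wpM2l => //; rewrite subr_ge0.
rewrite -natr1; have : 0 <= n%:R * x * x by rewrite !mulr_ge0.
lra.
Qed.

Lemma exprD_ge (x : R) n : 0 <= x -> 1 + n%:R * x <= (1 + x) ^+ n.
Proof.
move=> x0; elim: n => [|n ih]; first by rewrite mul0r addr0 expr0.
rewrite exprS; apply: (@le_trans _ _ ((1 + x) * (1 + n%:R * x))); last first.
  by apply: ler_wpM2l => //; rewrite addr_ge0.
rewrite -natr1; have : 0 <= n%:R * x * x by rewrite !mulr_ge0.
lra.
Qed.

(* The polynomials of Brosowski and Deutsch in their proof of the
   Stone-Weierstrass theorem. *)
Definition pbump n (y : R) : R := (1 - y ^+ n) ^+ (2 ^ n).

Lemma bump_itv n y : 0 <= y <= 1 -> 0 <= pbump n y <= 1.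
Proof.
move=> /andP[y0 y1].
have h : 0 <= 1 - y ^+ n <= 1.
  by rewrite subr_ge0 exprn_ile1//= lerBlDl lerDr exprn_ge0.
by move/andP: h => [h0 h1]; rewrite exprn_ge0//= exprn_ile1.
Qed.

(** Bernoulli's inequality gives [pbump n y >= 1 - (2 y)^n], since the exponent [2 ^ n] multiplies
    [y ^ n]; here [2 y < 1]. *)
Lemma bump_cvg1 y : 0 <= y < 2^-1 -> (fun n => pbump n y) @ \oo --> (1 : R).
Proof.
move=> /andP[y0 y1].
have y1' : y <= 1 by lra.
apply: (@squeeze_cvgr _ _ _ _ (fun n => 1 - (2 * y) ^+ n) (fun=> 1)).
- apply: nearW => n; apply/andP; split; last first.
    by have := @bump_itv n y; rewrite y0 y1' => /(_ isT)/andP[].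
  rewrite /pbump exprMn -natrX; apply: exprB_ge.
  by rewrite exprn_ge0//= exprn_ile1.
- rewrite -[X in _ --> X]subr0; apply: cvgB; first exact: cvg_cst.
  apply: cvg_expr; rewrite ger0_norm ?mulr_ge0//; lra.
- exact: cvg_cst.
Qed.

(** As [(1 - y^n) (1 + y^n) <= 1], the bump is at most the inverse of [(1 + y^n)^(2^n)], which by
    Bernoulli's inequality is at least [(2 y)^n]; here [2 y > 1]. *)
Lemma bump_cvg0 y : 2^-1 < y <= 1 -> (fun n => pbump n y) @ \oo --> (0 : R).
Proof.
move=> /andP[y0 y1].
have y0' : 0 < y by lra.
apply: (@squeeze_cvgr _ _ _ _ (fun=> 0) (fun n => (2 * y)^-1 ^+ n)).
- apply: nearW => n; apply/andP; split.
    by have := @bump_itv n y; rewrite (ltW y0') y1 => /(_ isT)/andP[].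
  have h : pbump n y * (1 + y ^+ n) ^+ (2 ^ n) <= 1.
    rewrite /pbump -exprMn exprn_ile1//.
      by rewrite mulr_ge0// ?subr_ge0 ?exprn_ile1 ?addr_ge0 ?exprn_ge0// ltW.
    by rewrite -subr_sqr expr1n lerBlDl lerDr sqr_ge0.
  have p0 : 0 < (2 * y) ^+ n by rewrite exprn_gt0// mulr_gt0.
  rewrite exprVn -[leRHS]mul1r ler_pdivlMr//; apply: le_trans h.
  apply: ler_wpM2l; first by have := @bump_itv n y; rewrite (ltW y0') y1 => /(_ isT)/andP[].
  rewrite exprMn -natrX; apply: le_trans (@exprD_ge (y ^+ n) (2 ^ n) _).
    by rewrite lerDr.
  by rewrite exprn_ge0// ltW.
- exact: cvg_cst.
- apply: cvg_expr; rewrite ger0_norm ?invr_ge0 ?mulr_ge0 ?(ltW y0')//.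
  by rewrite invf_lt1 ?mulr_gt0//; lra.
Qed.

(** The upper bound on [|t - a|] keeps [t] out of the copies of the arc translated by a full turn.
    Beyond pi the cosine is read at [2 pi - |t - a|], which still lies between [th] and pi. *)
Lemma cos_lt_arc (a th t : R) : 0 <= th <= pi -> th < `|t - a| < 2 * pi - th ->
  cos (t - a) < cos th.
Proof.
move=> /andP[th0 thp] /andP[h1 h2]; rewrite -(cos_norm (t - a)).
have [h|h] := leP `|t - a| pi.
  by rewrite ltr_cos// in_itv /= ?th0// h normr_ge0.
have -> : cos `|t - a| = cos (pi *+ 2 - `|t - a|).
  by rewrite [in RHS]addrC cosD2pi cosN.
by rewrite ltr_cos ?in_itv /= ?th0// mulr2n; lra.
Qed.

Definition nullcoef f := cL1 f /\
  forall n : int, circle_int (fun t => f t * zfun t ^ n) = 0.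
(** These multipliers form an algebra that contains the powers of [z], hence every polynomial in
    [cos (t - a)]. *)
Definition nullmul f := forall g, nullcoef g -> nullcoef (fun t => f t * g t).

Lemma cL1_zX f (n : int) : cL1 f -> cL1 (fun t => f t * zfun t ^ n).
Proof.
move=> hf; under eq_fun do rewrite mulrC.
apply: (cL1_bnd (M := 1)) => //; first exact: meas_zX.
by apply: aeT => t _; rewrite csq_zX expr1n.
Qed.

Lemma nullmul_cst (c : C) : nullmul (fun=> c).
Proof.
move=> g [g1 g0]; split=> [|n]; first exact: cL1Z.
under eq_fun do rewrite -mulrA.
by rewrite cintZ ?g0 ?mulr0//; exact: cL1_zX.
Qed.

Lemma nullmul_zX (n : int) : nullmul (fun t => zfun t ^ n).
Proof.
move=> g [g1 g0]; split=> [|m].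
  by under eq_fun do rewrite mulrC; exact: cL1_zX.
rewrite -[RHS](g0 (n + m)); congr circle_int; apply/funext => t.
by rewrite expfzDr ?zfun_neq0// mulrA [g t * _]mulrC.
Qed.

Lemma nullmulD f g : nullmul f -> nullmul g -> nullmul (fun t => f t + g t).
Proof.
move=> hf hg k hk; have [f1 f0] := hf _ hk; have [g1 g0] := hg _ hk.
under eq_fun do rewrite mulrDl; split=> [|n]; first exact: cL1D.
under eq_fun do rewrite mulrDl.
by rewrite cintD ?f0 ?g0 ?addr0//; exact: cL1_zX.
Qed.

Lemma nullmulM f g : nullmul f -> nullmul g -> nullmul (fun t => f t * g t).
Proof.
by move=> hf hg k hk; under eq_fun do rewrite -mulrA; apply/hf/hg.
Qed.

Lemma nullmulX f n : nullmul f -> nullmul (fun t => f t ^+ n).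
Proof.
move=> hf; elim: n => [|n ih]; first exact: nullmul_cst.
by under eq_fun do rewrite exprS; exact: nullmulM.
Qed.

(** An affine image of [cos (t - a)] inside [[0, 1]]. It crosses 1/2, the threshold of [pbump], at
    the ends of the arc of centre [a] and half-width [th], and is smaller than 1/2 inside this
    arc. *)
Definition arcfun (a th t : R) : R := (1 - (cos (t - a) - cos th) / 2) / 2.

Lemma arcfun_itv a th t : 0 <= arcfun a th t <= 1.
Proof.
rewrite /arcfun; have := cos_geN1 (t - a); have := cos_le1 (t - a).
have := cos_geN1 th; have := cos_le1 th; lra.
Qed.

Lemma nullmul_bump n a th :
  nullmul (fun t => Complex (pbump n (arcfun a th t)) 0).
Proof.
have A t : Complex (arcfun a th t) 0 = Complex (1 / 2 + cos th / 4) 0 +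
      Complex (- (1 / 8)) 0 * (zfun t ^ (1 : int) * zfun (- a) +
                     zfun t ^ (-1 : int) * zfun a) :> C.
  rewrite -[X in X * zfun a]zXJ expr1z /arcfun /zfun cosN sinN cosB.
  by apply/complexP => /=; field.
have E t : Complex (pbump n (arcfun a th t)) 0 =
    (1 + (-1) * Complex (arcfun a th t) 0 ^+ n) ^+ (2 ^ n) :> C.
  rewrite mulN1r -[LHS]/((pbump n (arcfun a th t))%:C)%C /pbump.
  by rewrite rmorphXn rmorphB rmorphXn rmorph1.
under eq_fun do rewrite E A.
apply: nullmulX; apply: nullmulD; first exact: nullmul_cst.
apply: nullmulM; first exact: nullmul_cst.
apply: nullmulX; apply: nullmulD; first exact: nullmul_cst.
apply: nullmulM; first exact: nullmul_cst.
by apply: nullmulD; apply: nullmulM; first [exact: nullmul_cst|exact: nullmul_zX].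
Qed.

Lemma meas_bump n a th : measurable_fun circle (fun t => pbump n (arcfun a th t)).
Proof.
apply: measurable_funX; apply: measurable_funB; first exact: measurable_cst.
apply: measurable_funX; apply: measurable_funM; last exact: measurable_cst.
apply: measurable_funB; first exact: measurable_cst.
apply: measurable_funM; last exact: measurable_cst.
apply: measurable_funB; last exact: measurable_cst.
apply: measurable_funTS; apply: continuous_measurable_fun => t.
apply: continuous_comp; last exact: continuous_cos.
by apply: cvgB; [exact: cvg_id|exact: cvg_cst].
Qed.

Lemma ae_neq (x : R) : ae_circle (fun t => t != x).
Proof.
exists [set x]; split.
- exact: measurable_set1.
- exact: lebesgue_measure_set1.
- by move=> t /= /not_implyP[_ /negP]; rewrite negbK => /eqP.
Qed.

(** For the arc centred at the midpoint of the interval the bumps converge to its indicator except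
    at the two endpoints, and [|u|] dominates all the products. *)
Lemma RI_itv_bump u (p q : R) : rint u ->
  (forall n a th, \int[mu]_(t in circle) (pbump n (arcfun a th t) * u t) = 0) ->
  0 < p -> p < q -> q < 2 * pi -> \int[mu]_(t in `]p, q]) u t = 0.
Proof.
move=> hu h0 p0 pq q2.
pose a := (p + q) / 2; pose th := (q - p) / 2.
have -> : `]p, q]%classic = circle `&` `]p, q]%classic.
  rewrite setIidr//; move=> t; rewrite /Defs.circle /= !in_itv /=; lra.
rewrite Rintegral_mkcondr.
have hcv := @RI_dominated (fun n t => pbump n (arcfun a th t) * u t)
  (u \_ `]p, q]) (fun t => `|u t|).
have hm n : measurable_fun circle (fun t => pbump n (arcfun a th t) * u t).
  by apply: measurable_funM; [exact: meas_bump|exact: rint_meas].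
have hb n t : `|pbump n (arcfun a th t) * u t| <= `|u t|.
  have /(@bump_itv n)/andP[b0 b1] := arcfun_itv a th t.
  by rewrite normrM ger0_norm// ler_piMl.
have hn : rint (fun t => `|u t|) by exact: integrable_norm.
have : (fun n => \int[mu]_(t in circle) (pbump n (arcfun a th t) * u t)) @ \oo
    --> \int[mu]_(t in circle) (u \_ `]p, q]) t.
  apply: hcv => //.
  - by move=> n; apply: rint_dom hn _ => //; apply: aeT => t _; exact: hb.
  - rewrite (_ : u \_ _ = fun t => \1_(`]p, q]%classic) t * u t).
      apply: measurable_funM; last exact: rint_meas.
      exact: measurable_indic.
    apply/funext => t; rewrite patchE indicE.
    by case: (t \in _); rewrite ?mul1r ?mul0r.
  - apply: aeS2 (ae_neq p) (ae_neq q) => t; rewrite /Defs.circle /= in_itv /=.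
    move=> /andP[t0 t2] tp tq; rewrite patchE.
    have [H|H] := pselect (`]p, q]%classic t).
    + rewrite mem_set//; move: H; rewrite /= in_itv /=.
      move=> /andP[pt tq']; rewrite -[X in _ --> X]mul1r.
      apply: cvgM; last exact: cvg_cst.
      apply: bump_cvg1; apply/andP; split.
        by have /andP[] := arcfun_itv a th t.
      suff : cos th < cos (t - a) by rewrite /arcfun; lra.
      have tq2 : t < q by rewrite lt_neqAle tq.
      have hta : `|t - a| < th by rewrite ltr_norml /a /th; apply/andP; split; lra.
      rewrite -(cos_norm (t - a)) ltr_cos ?in_itv /= ?normr_ge0 ?(ltW hta) //=;
        rewrite ?(le_trans (ltW hta)) /th; lra.
    + rewrite memNset//; have {}H : t < p \/ q < t.
        case: (ltP t p) => [|pt]; [by left|right].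
        rewrite ltNge; apply/negP => tq'; apply: H => /=.
        by rewrite in_itv /= lt_neqAle eq_sym tp pt.
      rewrite -[X in _ --> X](mul0r (u t)); apply: cvgM; last exact: cvg_cst.
      apply: bump_cvg0; apply/andP; split; last first.
        by have /andP[] := arcfun_itv a th t.
      suff : cos (t - a) < cos th by rewrite /arcfun; lra.
      apply: cos_lt_arc; first by rewrite /th; lra.
      by case: (ger0P (t - a)); rewrite /th /a; case: H; lra.
under eq_fun do rewrite h0.
by move=> h; have := cvg_unique (@Rhausdorff R) (cvg_cst _) h => <-.
Qed.

(** Lebesgue differentiation: the indefinite integral of [u] is constant on []0, 2 pi[], while its
    derivative is [u] almost everywhere. *)
Lemma ae0_itv u : rint u -> (forall p q, 0 < p -> p < q -> q < 2 * pi ->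
  \int[mu]_(t in `]p, q]) u t = 0) -> ae_circle (fun t => u t = 0).
Proof.
move=> hu h0; pose w := u \_ circle.
have iw : mu.-integrable setT (EFin \o w).
  have := (@integrable_mkcond _ (measurableTypeR R) R mu _ (EFin \o u)
    (@measurable_circleR R)).1 hu.
  by rewrite restrict_EFin.
have lw : locally_integrable [set: R] w.
  exact: integrable_locally (@measurable_circleR R) hu.
have iwS (D : set (measurableTypeR R)) : measurable D ->
    mu.-integrable D (EFin \o w).
  by move=> mD; apply: integrableS iw.
have hF := @FTC1Ny _ w (fun y => iwS _ (measurable_itv `]-oo, y])) lw.
pose F x := \int[mu]_(t in `]-oo, x]) w t.
have hG : ae_circle (fun t => F^`()%classic t = w t).
  by apply: (@filterS _ _ (ae_filter_ringOfSetsType mu)) hF => t [_ ->].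
apply: aeS2 (ae_neq 0) hG => t ct t0 hw.
have -> : u t = w t by rewrite /w patchE mem_set.
rewrite -hw.
have {ct t0} /andP[t0 t2] : 0 < t < 2 * pi.
  move: ct; rewrite /Defs.circle /= in_itv /= => /andP[ge0 ->].
  by rewrite andbT lt_neqAle eq_sym t0.
have FE (p q : R) : 0 < p -> p < q -> q < 2 * pi -> F p = F q.
  move=> p0 pq q2; apply/eqP; rewrite eq_sym -subr_eq0 /F.
  have hq := iwS _ (measurable_itv `]-oo, q]).
  rewrite (@Rintegral_itvB _ w -oo%O (BRight q) p hq) ?bnd_simp//; last exact: ltW.
  rewrite -[X in _ == X](h0 p q)//; apply/eqP.
  apply: eq_Rintegral => x; rewrite inE /= in_itv /= /w patchE => /andP[px xq].
  by rewrite mem_set// /Defs.circle /= in_itv /=; lra.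
rewrite derive1E; rewrite (@near_eq_derive _ _ _ F (cst (F t)))//.
- by rewrite derive_cst.
- have : \forall x \near t, x \in `]0, 2 * pi[ by apply: near_in_itvoo; rewrite in_itv /= t0.
  apply: filterS => x; rewrite in_itv /= => /andP[x0 x2].
  by case: (ltgtP x t) => [xt|xt|->//]; [|apply/esym]; exact: FE.
Qed.

(** The bumps are real trigonometric polynomials. Vanishing coefficients thus make the real and the
    imaginary part of [f] integrate to 0 against each of them, and in the limit over every
    interval. *)
Theorem fourier_unique f : cL1 f ->
  (forall n : int, circle_int (fun t => f t * zfun t ^ n) = 0) ->
  ae_circle (fun t => f t = 0).
Proof.
move=> f1 f0.
have h n a th : circle_int (fun t => Complex (pbump n (arcfun a th t)) 0 * f t) = 0.
  have [_ /(_ 0)] := @nullmul_bump n a th _ (conj f1 f0).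
  by under eq_fun do rewrite expr0z mulr1.
have p0 : (2 * pi)^-1 != 0 :> R by rewrite invr_neq0// gt_eqF// pi2_gt0.
have R0 : ae_circle (fun t => complex.Re (f t) = 0).
  apply: ae0_itv => [|p q]; first exact: f1.1.
  apply: RI_itv_bump => [|n a th]; first exact: f1.1.
  have /(congr1 (@complex.Re R)) /= /eqP := h n a th.
  rewrite mulf_eq0 (negPf p0) /= => /eqP <-; apply: eq_Rintegral => t _.
  by case: (f t) => x y /=; rewrite mul0r subr0.
have I0 : ae_circle (fun t => complex.Im (f t) = 0).
  apply: ae0_itv => [|p q]; first exact: f1.2.
  apply: RI_itv_bump => [|n a th]; first exact: f1.2.
  have /(congr1 (@complex.Im R)) /= /eqP := h n a th.
  rewrite mulf_eq0 (negPf p0) /= => /eqP <-; apply: eq_Rintegral => t _.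
  by case: (f t) => x y /=; rewrite mul0r addr0.
by apply: aeS2 R0 I0 => t _ r0 i0; apply/complexP; rewrite ?r0 ?i0.
Qed.

End FourierUniqueness.

Lemma inv_natS_lt (R : realType) (e : R) : 0 < e ->
  exists N, forall k, (N <= k)%N -> k.+1%:R^-1 < e.
Proof.
by move=> e0; have [N _ hN] := near_infty_natSinv_lt (PosNum e0); exists N.
Qed.

(** * Semi-inner product spaces *)
Section SemiInner.
Variables (R : realType) (V : lmodType R[i]).
Local Notation C := R[i].

(** Semidefinite, because vectors are functions and not classes modulo almost everywhere equality,
    and because forms with a genuine kernel such as [gap] and [toep] have to fit. The form is
    considered on a subset [E], as integrals take default values elsewhere. *)
Record semi_inner (E : set V) (ip : V -> V -> C) : Prop := SemiInner {
  si0 : E 0;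
  siL : forall a x y, E x -> E y -> E (a *: x + y);
  si_lin : forall a x y z, E x -> E y -> E z ->
    ip (a *: x + y) z = a * ip x z + ip y z;
  si_conj : forall x y, E x -> E y -> ip y x = Num.conj (ip x y);
  si_ge0 : forall x, E x -> 0 <= complex.Re (ip x x) }.

Variables (E : set V) (ip : V -> V -> C).
Hypothesis H : semi_inner E ip.

Definition n2 x : R := complex.Re (ip x x).
Definition nrm x : R := Num.sqrt (n2 x).
Definition rip x y : R := complex.Re (ip x y).

Lemma siD x y : E x -> E y -> E (x + y).
Proof. by move=> hx hy; rewrite -[x]scale1r; exact: (siL H). Qed.
Lemma siZ a x : E x -> E (a *: x).
Proof. by move=> hx; rewrite -[_ *: _]addr0; apply: (siL H) => //; exact: (si0 H). Qed.
Lemma siN x : E x -> E (- x).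
Proof. by move=> hx; rewrite -scaleN1r; exact: siZ. Qed.
Lemma siB x y : E x -> E y -> E (x - y).
Proof. by move=> hx hy; apply: siD => //; exact: siN. Qed.

Lemma ipDl x y z : E x -> E y -> E z -> ip (x + y) z = ip x z + ip y z.
Proof. by move=> hx hy hz; rewrite -[x]scale1r (si_lin H)// mul1r scale1r. Qed.
Lemma ip0l z : E z -> ip 0 z = 0.
Proof.
move=> hz; have := ipDl (si0 H) (si0 H) hz; rewrite addr0 => /eqP.
by rewrite -subr_eq0 opprD addrA subrr sub0r oppr_eq0 => /eqP.
Qed.
Lemma ipZl a x z : E x -> E z -> ip (a *: x) z = a * ip x z.
Proof.
move=> hx hz; rewrite -[_ *: _]addr0 (si_lin H) ?(ip0l hz) ?addr0//.
exact: (si0 H).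
Qed.
Lemma ipNl x z : E x -> E z -> ip (- x) z = - ip x z.
Proof. by move=> hx hz; rewrite -scaleN1r ipZl// mulN1r. Qed.
Lemma ipBl x y z : E x -> E y -> E z -> ip (x - y) z = ip x z - ip y z.
Proof. by move=> hx hy hz; rewrite ipDl ?ipNl//; exact: siN. Qed.
Lemma ipDr x y z : E x -> E y -> E z -> ip z (x + y) = ip z x + ip z y.
Proof.
by move=> hx hy hz; rewrite !(si_conj H _ hz) ?ipDl ?rmorphD//; exact: siD.
Qed.
Lemma ipZr a x z : E x -> E z -> ip z (a *: x) = Num.conj a * ip z x.
Proof.
by move=> hx hz; rewrite !(si_conj H _ hz) ?ipZl ?rmorphM//; exact: siZ.
Qed.
Lemma ipNr x z : E x -> E z -> ip z (- x) = - ip z x.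
Proof. by move=> hx hz; rewrite -scaleN1r ipZr// rmorphN1 mulN1r. Qed.
Lemma ip_real x : E x -> ip x x = Complex (n2 x) 0.
Proof.
move=> hx; rewrite /n2; have := si_conj H hx hx.
case: (ip x x) => a b /= [] /eqP; rewrite -subr_eq0 opprK -mulr2n.
by rewrite mulrn_eq0/= => /eqP ->.
Qed.

Lemma ripC x y : E x -> E y -> rip y x = rip x y.
Proof. by move=> hx hy; rewrite /rip (si_conj H hx hy); case: (ip x y). Qed.

Lemma rip_mulr (c : R) x y : E x -> E y -> rip (Complex c 0 *: x) y = c * rip x y.
Proof.
by move=> hx hy; rewrite /rip ipZl//; case: (ip x y) => a b /=; rewrite mul0r subr0.
Qed.

Lemma rip_mull (c : R) x y : E x -> E y -> rip x (Complex c 0 *: y) = c * rip x y.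
Proof.
by move=> hx hy; rewrite (ripC (siZ (Complex c 0) hy) hx) (ripC hy hx) rip_mulr.
Qed.

Lemma n2D x y : E x -> E y -> n2 (x + y) = n2 x + 2 * rip x y + n2 y.
Proof.
move=> hx hy; have hD := siD hx hy.
have -> : n2 (x + y) = n2 x + rip x y + (rip y x + n2 y).
  rewrite /n2 /rip ipDr// ipDl// ipDl//.
  by case: (ip x x); case: (ip y x); case: (ip x y); case: (ip y y) => /= *; ring.
by rewrite (ripC hx hy); ring.
Qed.

Lemma n2Z a x : E x -> n2 (a *: x) =
  (complex.Re a ^+ 2 + complex.Im a ^+ 2) * n2 x.
Proof.
move=> hx; rewrite /n2 ipZr ?ipZl//; last exact: siZ.
by rewrite ip_real//; case: a => a b /=; ring.
Qed.

Lemma n2_ge0 x : E x -> 0 <= n2 x. Proof. exact: (si_ge0 H). Qed.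

Lemma n2N x : E x -> n2 (- x) = n2 x.
Proof. by move=> hx; rewrite -scaleN1r n2Z//= oppr0 sqrrN expr1n expr0n addr0 mul1r. Qed.

Lemma n2B x y : E x -> E y -> n2 (x - y) = n2 x - 2 * rip x y + n2 y.
Proof.
move=> hx hy; rewrite n2D// ?n2N//; last exact: siN.
by rewrite /rip ipNr//; case: (ip x y) => a b /=; ring.
Qed.

(** The discriminant inequality, including the degenerate case [c = 0] that null vectors produce. *)
Lemma quad_ge0 (a b c : R) : 0 <= c ->
  (forall t, 0 <= a + 2 * t * b + t ^+ 2 * c) -> b ^+ 2 <= a * c.
Proof.
rewrite le_eqVlt => /predU1P[<-|c0] h; last first.
  have := h (- (b / c)).
  have -> : a + 2 * - (b / c) * b + (- (b / c)) ^+ 2 * c = a - b ^+ 2 / c.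
    by field; rewrite gt_eqF.
  by rewrite subr_ge0 ler_pdivrMr.
rewrite mulr0; have [->|b0] := eqVneq b 0; first by rewrite expr0n.
(* With [c = 0] the expression is affine in [t], and this value of [t] makes it -1. *)
have := h (- ((a + 1) / (2 * b))).
have -> : a + 2 * - ((a + 1) / (2 * b)) * b +
  (- ((a + 1) / (2 * b))) ^+ 2 * 0 = -1 by field.
by rewrite oppr_ge0 ler10.
Qed.

Lemma rip_CS x y : E x -> E y -> rip x y ^+ 2 <= n2 x * n2 y.
Proof.
move=> hx hy; apply: (quad_ge0 (n2_ge0 hy)) => t.
have hty : E (Complex t 0 *: y) by exact: siZ.
have := n2_ge0 (siD hx hty); rewrite n2D// n2Z//= expr0n addr0.
by rewrite rip_mull//; lra.
Qed.

(** Multiplying [y] by the scalar [ip x y] makes the product with [x] real, equal to the squared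
    modulus; the real inequality [rip_CS] then applies. *)
Lemma ip_CS x y : E x -> E y ->
  complex.Re (ip x y) ^+ 2 + complex.Im (ip x y) ^+ 2 <= n2 x * n2 y.
Proof.
move=> hx hy; set c := _ + _.
have c0 : 0 <= c by rewrite addr_ge0 ?sqr_ge0.
have hcy : E (ip x y *: y) by exact: siZ.
have := rip_CS hx hcy; rewrite n2Z// -/c.
have -> : rip x (ip x y *: y) = c.
  by rewrite /rip ipZr// /c; case: (ip x y) => a b /=; ring.
rewrite le_eqVlt in c0; case/orP: c0 => [/eqP <-|c0].
  by move=> _; rewrite mulr_ge0// n2_ge0.
by rewrite mulrCA expr2 ler_pM2l.
Qed.

(** By Cauchy-Schwarz a null vector is in the kernel of the form. Applied to [gap], this extracts
    linear identities from the extremality of a pair. *)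
Lemma ip_null x y : E x -> E y -> n2 y = 0 -> ip x y = 0.
Proof.
move=> hx hy y0; have := ip_CS hx hy; rewrite y0 mulr0.
case: (ip x y) => a b /= h.
have a0 : a ^+ 2 = 0 by apply/eqP; rewrite eq_le sqr_ge0 andbT (le_trans _ h)// lerDl sqr_ge0.
have b0 : b ^+ 2 = 0 by apply/eqP; rewrite eq_le sqr_ge0 andbT (le_trans _ h)// lerDr sqr_ge0.
by move/eqP : a0; move/eqP : b0; rewrite !sqrf_eq0 => /eqP -> /eqP ->.
Qed.

Lemma nrm_ge0 x : 0 <= nrm x. Proof. exact: sqrtr_ge0. Qed.

Lemma nrm_sqr x : E x -> nrm x ^+ 2 = n2 x.
Proof. by move=> hx; rewrite sqr_sqrtr// n2_ge0. Qed.

Lemma rip_le x y : E x -> E y -> `|rip x y| <= nrm x * nrm y.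
Proof.
move=> hx hy; rewrite -(ler_pXn2r (n := 2)) ?nnegrE ?mulr_ge0 ?nrm_ge0//.
by rewrite real_normK ?num_real// exprMn !nrm_sqr// rip_CS.
Qed.

Lemma nrmD x y : E x -> E y -> nrm (x + y) <= nrm x + nrm y.
Proof.
move=> hx hy; rewrite -(ler_pXn2r (n := 2)) ?nnegrE ?addr_ge0 ?nrm_ge0//.
rewrite nrm_sqr ?n2D ?sqrrD ?nrm_sqr//; last exact: siD.
have := rip_le hx hy; have := ler_norm (rip x y); lra.
Qed.

Lemma nrmN x : E x -> nrm (- x) = nrm x.
Proof. by move=> hx; rewrite /nrm n2N. Qed.

Lemma nrmB x y : E x -> E y -> nrm (x - y) <= nrm x + nrm y.
Proof. by move=> hx hy; rewrite (le_trans (nrmD _ _)) ?nrmN//; exact: siN. Qed.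

Lemma nrm_sub x y : E x -> E y -> nrm (x - y) = nrm (y - x).
Proof. by move=> hx hy; rewrite -nrmN ?opprB//; exact: siB. Qed.

Lemma nrm_tri x y z : E x -> E y -> E z ->
  nrm (x - z) <= nrm (x - y) + nrm (y - z).
Proof.
move=> hx hy hz; rewrite -{1}(subrK y x) -addrA.
by apply: nrmD; exact: siB.
Qed.

Lemma nrm_dist x y : E x -> E y -> `|nrm x - nrm y| <= nrm (x - y).
Proof.
move=> hx hy; rewrite ler_norml; apply/andP; split.
- rewrite lerBrDr addrC lerBlDr addrC -[X in nrm X <= _](subrK x).
  by rewrite (nrm_sub hx hy); apply: nrmD => //; exact: siB.
- rewrite lerBlDr -[X in nrm X <= _](subrK y).
  by apply: nrmD => //; exact: siB.
Qed.

Lemma nrmZ a x : E x -> nrm (a *: x) =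
  Num.sqrt (complex.Re a ^+ 2 + complex.Im a ^+ 2) * nrm x.
Proof. by move=> hx; rewrite /nrm n2Z// sqrtrM// addr_ge0 ?sqr_ge0. Qed.

Definition lim_seq (u : nat -> V) l :=
  forall e, 0 < e -> exists N, forall k, (N <= k)%N -> nrm (u k - l) < e.
Definition cauchy_seq (u : nat -> V) :=
  forall e, 0 < e -> exists N, forall i j, (N <= i)%N -> (N <= j)%N ->
    nrm (u i - u j) < e.
Definition complete_form := forall u, (forall k, E (u k)) -> cauchy_seq u ->
  exists2 l, E l & lim_seq u l.

Lemma lin0 (a b : R) : 0 <= b -> (forall t, 0 <= 2 * t * a + t ^+ 2 * b) -> a = 0.
Proof.
move=> b0 h; have h' t : 0 <= 0 + 2 * t * a + t ^+ 2 * b by rewrite add0r.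
have := quad_ge0 b0 h'; rewrite mul0r => a2.
by apply/eqP; rewrite -sqrf_eq0 eq_le a2 sqr_ge0.
Qed.

(** The representing vector minimizes [n2 x - 2 Re (ell x)]. The parallelogram law makes minimizing
    sequences Cauchy, and the first variation at the limit gives the identity. The functional is
    conjugate linear, like [ip q]. *)
Theorem riesz (ell : V -> C) (M : R) : complete_form ->
  (forall a x y, E x -> E y -> ell (a *: x + y) = Num.conj a * ell x + ell y) ->
  (forall x, E x ->
     complex.Re (ell x) ^+ 2 + complex.Im (ell x) ^+ 2 <= M * n2 x) ->
  exists2 q, E q & forall r, E r -> ip q r = ell r.
Proof.
move=> cE lin bnd.
have ell0 : ell 0 = 0.
  have := lin 1 0 0 (si0 H) (si0 H); rewrite scaler0 addr0 rmorph1 mul1r => /eqP.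
  by rewrite -subr_eq0 opprD addrA subrr sub0r oppr_eq0 => /eqP.
have ellZ a x : E x -> ell (a *: x) = Num.conj a * ell x.
  by move=> hx; rewrite -[_ *: _]addr0 lin ?ell0 ?addr0//; exact: (si0 H).
have ellD x y : E x -> E y -> ell (x + y) = ell x + ell y.
  by move=> hx hy; rewrite -[x]scale1r lin// rmorph1 mul1r scale1r.
pose rl x := complex.Re (ell x).
have rlD x y : E x -> E y -> rl (x + y) = rl x + rl y.
  by move=> hx hy; rewrite /rl ellD//; case: (ell x); case: (ell y).
have rlZ (t : R) x : E x -> rl (Complex t 0 *: x) = t * rl x.
  by move=> hx; rewrite /rl ellZ//; case: (ell x) => a b /=; ring.
pose J x := n2 x - 2 * rl x.
have Jbnd x : E x -> - `|M| <= J x.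
  move=> hx; have := bnd x hx; have := sqr_ge0 (complex.Im (ell x)).
  rewrite -/(rl x) => h1 h2.
  have n0 := n2_ge0 hx; have := ler_norm M; have M0 := normr_ge0 M => hM.
  have : rl x ^+ 2 <= `|M| * n2 x.
    by apply: le_trans (_ : M * n2 x <= _); [lra|exact: ler_wpM2r].
  rewrite /J => h3; have h4 := sqr_ge0 (`|M| - n2 x).
  have : (2 * rl x) ^+ 2 <= (`|M| + n2 x) ^+ 2 by nra.
  have [r0|r0] := leP (2 * rl x) 0; first by lra.
  rewrite ler_pXn2r ?nnegrE ?(ltW r0) ?addr_ge0// => h5; lra.
pose A := [set J x | x in E].
have Ainf : has_inf A.
  split; first by exists (J 0); exists 0 => //; exact: (si0 H).
  by exists (- `|M|) => _ [x hx <-]; exact: Jbnd.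
pose m := inf A.
have mle x : E x -> m <= J x by move=> hx; apply: ge_inf; [exact: Ainf.2|exists x].
have ex k : exists x, E x /\ J x < m + k.+1%:R^-1.
  have [|_ [x hx <-] hJ] := @inf_adherent _ A k.+1%:R^-1 _ Ainf.
    by rewrite invr_gt0.
  by exists x.
pose u k := sval (cid (ex k)).
have uE k : E (u k) by rewrite /u; case: cid => x [].
have uJ k : J (u k) < m + k.+1%:R^-1 by rewrite /u; case: cid => x [].
(* Parallelogram law, with [J] at the midpoint bounded below by [m]: two near minimizers are close
   to each other. *)
have par x y : E x -> E y -> n2 (x - y) <= 2 * (J x + J y - 2 * m).
  move=> hx hy; have hD := siD hx hy.
  have hh : E (Complex 2^-1 0 *: (x + y)) by exact: siZ.
  have := mle _ hh; rewrite /J n2Z//= rlZ// rlD// expr0n addr0.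
  rewrite n2D// n2B//; have -> : (2^-1 : R) ^+ 2 = 4^-1 by field.
  lra.
have uC : cauchy_seq u.
  move=> e e0.
  have e2 : 0 < e ^+ 2 by rewrite exprn_gt0.
  have [|N hN] := @inv_natS_lt R (e ^+ 2 / 4); first by rewrite divr_gt0.
  exists N => i j hi hj.
  rewrite -(ltr_pXn2r (n := 2)) ?nnegrE ?nrm_ge0 ?(ltW e0)// nrm_sqr; last exact: siB.
  have := par _ _ (uE i) (uE j); have := uJ i; have := uJ j.
  have := hN _ hi; have := hN _ hj.
  by set si := i.+1%:R^-1; set sj := j.+1%:R^-1; lra.
have [q hq hlim] := cE u uE uC.
exists q => //.
(* Real parts suffice: the real identity at the multiple of [r] by the imaginary unit is the
   identity of imaginary parts at [r]. *)
suff hre r : E r -> rip q r = rl r.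
  move=> r hr; have h1 := hre r hr.
  have := hre ('i%C *: r) (siZ _ hr).
  rewrite /rip /rl ipZr// ellZ//; move: h1; rewrite /rip /rl.
  by case: (ip q r) => a b; case: (ell r) => c d /= ->; rewrite !(mul0r, mulN1r, opprK, sub0r) => ->.
move=> hr; apply/eqP; rewrite -subr_eq0; apply/eqP.
(* If the first variation were negative for some [t], then [u k + t r] would undercut the infimum
   [m] for large [k]. *)
apply: (lin0 (n2_ge0 hr)) => t; rewrite leNgt; apply/negP => neg.
set d := _ + _ in neg.
pose K := 2 * `|t| * nrm r.
have K0 : 0 <= K by rewrite !mulr_ge0 ?nrm_ge0.
have [|N hN] := hlim (- d / (2 * (K + 1))).
  by rewrite divr_gt0 ?oppr_gt0// mulr_gt0// ltr_wpDl.
have [|N' hN'] := @inv_natS_lt R (- d / 2); first by rewrite divr_gt0 ?oppr_gt0.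
pose k := maxn N N'.
have hk1 := hN k (leq_maxl _ _); have hk2 := hN' k (leq_maxr _ _).
have htr : E (Complex t 0 *: r) by exact: siZ.
have := mle _ (siD (uE k) htr); have := uJ k.
rewrite /J n2D// rlD// rlZ// n2Z//= expr0n addr0.
rewrite rip_mull//.
have hd : rip (u k) r - rip q r = rip (u k - q) r.
  by rewrite /rip ipBl//; case: (ip (u k) r); case: (ip q r).
have := rip_le (siB (uE k) hq) hr; rewrite -hd => h1 h2 h3.
have h4 : `|2 * t * (rip (u k) r - rip q r)| <= - d / 2.
  rewrite !normrM ger0_norm//.
  apply: le_trans (_ : K * nrm (u k - q) <= _).
    by rewrite /K -mulrA -mulrA -mulrA ler_wpM2l// ler_wpM2l// mulrC.
  apply: le_trans (_ : (K + 1) * (- d / (2 * (K + 1))) <= _); last first.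
    by rewrite le_eqVlt; apply/orP; left; apply/eqP; field; rewrite gt_eqF// ltr_wpDl.
  by apply: ler_pM => //; [exact: nrm_ge0|rewrite lerDl|exact: ltW].
have := ler_norm (2 * t * (rip (u k) r - rip q r)).
move: h4 h2 h3 hk2; set sk := k.+1%:R^-1; rewrite /d; lra.
Qed.

End SemiInner.

(** * Closures of subspaces and orthogonal projection *)

Section Closure.
Variables (R : realType) (V : lmodType R[i]) (E : set V) (ip : V -> V -> R[i]).
Hypothesis H : semi_inner E ip.
Hypothesis cE : complete_form E ip.

Lemma semi_inner_sub (S : set V) : S `<=` E -> S 0 ->
  (forall a x y, S x -> S y -> S (a *: x + y)) -> semi_inner S ip.
Proof.
move=> sSE S0 SL; split => //.
- by move=> a x y z /sSE hx /sSE hy /sSE hz; exact: (si_lin H).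
- by move=> x y /sSE hx /sSE hy; exact: (si_conj H).
- by move=> x /sSE; exact: (si_ge0 H).
Qed.

Definition cls (S : set V) : set V :=
  [set x | E x /\ forall e, 0 < e -> exists2 s, S s & nrm ip (x - s) < e].

Variable S : set V.
Hypotheses (sSE : S `<=` E) (S0 : S 0)
  (SL : forall a x y, S x -> S y -> S (a *: x + y)).

Lemma sub_cls : S `<=` cls S.
Proof.
move=> x Sx; split; first exact: sSE.
move=> e e0; exists x => //; rewrite subrr /nrm /n2 (ip0l H); last exact: (si0 H).
by rewrite sqrtr0.
Qed.

Lemma cls_semi_inner : semi_inner (cls S) ip.
Proof.
apply: semi_inner_sub; [by move=> x []|exact: sub_cls|].
move=> a x y [Ex hx] [Ey hy]; split; first exact: (siL H).
move=> e e0; pose c := Num.sqrt (complex.Re a ^+ 2 + complex.Im a ^+ 2).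
have c0 : 0 <= c by exact: sqrtr_ge0.
have [|s Ss hs] := hx (e / (2 * (c + 1))).
  by rewrite divr_gt0// mulr_gt0// ltr_wpDl.
have [|s' Ss' hs'] := hy (e / 2); first by rewrite divr_gt0.
exists (a *: s + s'); first exact: SL.
have -> : a *: x + y - (a *: s + s') = a *: (x - s) + (y - s').
  by rewrite scalerBr opprD addrACA.
have Es := sSE Ss; have Es' := sSE Ss'.
have h1 : E (x - s) by exact: (siB H).
have h2 : E (y - s') by exact: (siB H).
apply: le_lt_trans (nrmD H (siZ H a h1) h2) _; rewrite (nrmZ H)// -/c.
have : c * nrm ip (x - s) <= (c + 1) * (e / (2 * (c + 1))).
  by apply: ler_pM => //; rewrite ?nrm_ge0 ?lerDl// ltW.
have -> : (c + 1) * (e / (2 * (c + 1))) = e / 2 by field; rewrite gt_eqF// ltr_wpDl.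
lra.
Qed.

Lemma cls_complete : complete_form (cls S) ip.
Proof.
move=> u hu cu; have [l El hl] := cE (fun k => (hu k).1) cu.
exists l => //; split => // e e0.
have e2 : 0 < e / 2 by rewrite divr_gt0.
have [N hN] := hl _ e2; have [Eu /(_ _ e2)[s Ss hs]] := hu N.
exists s => //; apply: le_lt_trans (nrm_tri H El Eu (sSE Ss)) _.
rewrite (nrm_sub H El Eu); have := hN _ (leqnn N); lra.
Qed.

(** Riesz representation of [ip p] on the closure of [S], which inherits completeness from [E]. *)
Lemma cls_proj p : E p ->
  exists2 q, cls S q & forall r, cls S r -> ip (p - q) r = 0.
Proof.
move=> Ep.
have [|x hx|q hq h] := @riesz _ _ _ _ cls_semi_inner (ip p) (n2 ip p) cls_complete.
- move=> a x y [Ex _] [Ey _].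
  by rewrite (ipDr H) ?(ipZr H)//; exact: (siZ H).
- exact: (ip_CS H Ep hx.1).
exists q => // r hr; rewrite (ipBl H) ?h ?subrr//; [exact: hq.1|exact: hr.1].
Qed.

End Closure.

(** * Completeness of the space of square integrable functions *)
Section SquareIntegrable.
Variable R : realType.
Local Notation C := R[i].
Local Notation mu := (@lebesgue_measure R).
Local Notation circle := (@circle R).
Implicit Types (f g h : R -> C) (u v : R -> R).
Hint Resolve measurable_circle measurable_circleR : core.

Lemma RI_fatou (F : nat -> R -> R) u (B : R) : (forall n, rint (F n)) ->
  (forall n t, 0 <= F n t) -> measurable_fun circle u -> (forall t, 0 <= u t) ->
  ae_circle (fun t => F^~ t @ \oo --> u t) ->
  (forall n, \int[mu]_(t in circle) F n t <= B) ->
  rint u /\ \int[mu]_(t in circle) u t <= B.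
Proof.
move=> hF F0 mu_ u0 hcv hB.
have mF n : measurable_fun circle (EFin \o F n).
  by apply/measurable_EFinP; exact: rint_meas.
have mlim : measurable_fun circle (fun t => limn_einf (EFin \o F^~ t)).
  rewrite (_ : (fun _ => _) = (fun t => - limn_esup (\- (EFin \o F^~ t)))%E)//.
  apply: measurableT_comp => //.
  apply: (measurable_fun_limn_esup (f := fun n t => (- (F n t)%:E)%E)) => n.
  by apply: measurableT_comp => //; exact: mF.
have E : (\int[mu]_(t in circle) (u t)%:E <= B%:E)%E.
  apply: le_trans (_ : (\int[mu]_(t in circle) limn_einf (EFin \o F^~ t) <= _)%E).
    rewrite le_eqVlt; apply/orP; left; apply/eqP.
    apply: ae_eq_integral => //; first exact/measurable_EFinP.
    apply: (@filterS _ _ (ae_filter_ringOfSetsType mu)) hcv => t ht ct.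
    have := cvg_limn_einf_sup (cvgE (ht ct)).
    by move=> [-> _].
  have := @fatou _ _ R mu circle (@measurable_circleR R) (fun n => EFin \o F n) mF.
  move=> /(_ (fun n t _ => _)) h; apply: le_trans (h _) _.
    by move=> n t; rewrite /= lee_fin.
  apply: le_trans (limn_einf_sup _) _; rewrite limn_esup_lim.
  apply: lime_le; first exact: is_cvg_esups.
  apply: nearW => n; apply: ge_ereal_sup => _ [k _ <-].
  by rewrite rintE// lee_fin.
have hu : rint u.
  apply/integrableP; split; first exact/measurable_EFinP.
  have -> : (\int[mu]_(x in circle) `|(EFin \o u) x| =
             \int[mu]_(x in circle) (u x)%:E)%E.
    by apply: eq_integral => t _; rewrite /= ger0_norm.
  by apply: le_lt_trans E _; exact: ltry.
by split => //; rewrite -lee_fin -rintE.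
Qed.

(** The series of the absolute increments has a finite integral, hence is finite almost everywhere;
    there the telescoping sum converges absolutely. *)
Lemma ae_cvg_series (a : nat -> R -> R) (c : R) : (forall j, rint (a j)) ->
  (forall j, \int[mu]_(t in circle) `|a j.+1 t - a j t| <= c * 2^-1 ^+ j) ->
  exists f : R -> R, measurable_fun circle f /\
    ae_circle (fun t => a^~ t @ \oo --> f t).
Proof.
move=> ha hc; pose D (j : nat) (t : R) : R := `|a j.+1 t - a j t|.
have D0 j t : (0 <= (D j t)%:E)%E by rewrite lee_fin normr_ge0.
have rD j : rint (D j).
  by apply: integrable_norm; apply: rintD => //; exact: rintN.
have mD j : measurable_fun circle (EFin \o D j).
  by apply/measurable_EFinP; exact: rint_meas.
pose S t := (\sum_(j <oo) (D j t)%:E)%E.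
have S0 t : (0 <= S t)%E by apply: nneseries_ge0.
have mS : measurable_fun circle S.
  by apply: ge0_emeasurable_sum => [j t _ _|j _]; [exact: D0|exact: mD].
have c0 : 0 <= c.
  have := hc 0%N; rewrite expr0 mulr1; apply: le_trans.
  by apply: Rintegral_ge0 => t _.
have iS : mu.-integrable circle S.
  apply/integrableP; split => //.
  under eq_integral do rewrite gee0_abs//.
  rewrite /S integral_nneseries//.
  apply: le_lt_trans (_ : ((2 * c)%:E < _)%E); last exact: ltry.
  apply: lime_le.
    by apply: is_cvg_nneseries => n _ _; exact: integral_ge0.
  apply: nearW => n.
  apply: (@le_trans _ _ (\sum_(0 <= j < n) (c * 2^-1 ^+ j)%:E)%E).
    by apply: lee_sum => j _; rewrite rintE// lee_fin; exact: hc.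
  rewrite sumEFin lee_fin.
  have -> : \sum_(0 <= j < n) c * 2^-1 ^+ j = 2 * c * (1 - 2^-1 ^+ n) :> R.
    elim: n => [|n ih]; first by rewrite big_nil expr0 subrr mulr0.
    by rewrite big_nat_recr//= ih exprS; field.
  by rewrite ler_piMr ?mulr_ge0// lerBlDl lerDr exprn_ge0.
have hfin := integrable_ae (@measurable_circleR R) iS.
exists (fun t => fine (limn_esup (fun j => (a j t)%:E))); split.
  apply: (measurableT_comp (@fine_measurable R setT measurableT)).
  apply: (measurable_fun_limn_esup (f := fun n t => (a n t)%:E)) => n.
  by apply/measurable_EFinP; exact: rint_meas.
apply: (@filterS _ _ (ae_filter_ringOfSetsType mu)) hfin => t + ct => /(_ ct) fS.
have cvD : cvgn (series (fun j => D j t)).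
  apply: nondecreasing_is_cvgn.
    by apply/nondecreasing_seqP => n; rewrite !seriesEnat /= big_nat_recr//= lerDl; exact: normr_ge0.
  exists (fine (S t)) => _ [n _ <-].
  rewrite -lee_fin fineK// seriesEnat /= -sumEFin.
  exact: nneseries_lim_ge.
have cv : cvgn (fun j => a j t).
  have := @normed_cvg R R (fun j => a j.+1 t - a j t) cvD.
  move=> h; have -> : (fun j => a j t) =
      (fun j => series (fun j => a j.+1 t - a j t) j + a 0%N t).
    apply/funext => n; rewrite seriesEnat /= telescope_sumr//.
    by rewrite subrK.
  by apply: is_cvgD => //; exact: is_cvg_cst.
have h2 := cvgE cv.
by have [_ ->] := cvg_limn_einf_sup h2.
Qed.

Definition sip f g : C := circle_int (fun t => f t * Num.conj (g t)).
Local Notation snrm := (@nrm R (R -> C^o) sip).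
Local Notation sn2 := (@n2 R (R -> C^o) sip).

Lemma sip_semi_inner : @semi_inner R (R -> C^o) (@cL2 R) sip.
Proof.
split.
- exact: cL2_cst.
- by move=> a x y hx hy; apply: cL2D hy; exact: cL2Z.
- move=> a x y z hx hy hz; rewrite /sip.
  have h1 := cL1M hx (cL2J hz); have h2 := cL1M hy (cL2J hz).
  rewrite -cintZ// -cintD//; last exact: cL1Z.
  by congr circle_int; apply/funext => t; rewrite mulrA -mulrDl.
- move=> x y hx hy; rewrite /sip -cintJ; last exact: cL1M hx (cL2J hy).
  by congr circle_int; apply/funext => t; rewrite rmorphM /= conjCK mulrC.
- move=> x hx; rewrite /sip /= mulr_ge0 ?invr_ge0 ?mulr_ge0 ?pi_ge0//.
  by apply: Rintegral_ge0 => t _; rewrite mulJ csq_ge0.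
Qed.

Lemma sn2E f : sn2 f = (2 * pi)^-1 * \int[mu]_(t in circle) csq (f t).
Proof.
rewrite /n2 /sip /=; congr (_ * _); apply: eq_Rintegral => t _.
by rewrite mulJ.
Qed.

Lemma RI_csq f : \int[mu]_(t in circle) csq (f t) = 2 * pi * sn2 f.
Proof.
have p0 : 2 * pi != 0 :> R by rewrite gt_eqF// pi2_gt0.
by rewrite sn2E mulrA divff// mul1r.
Qed.

Lemma sn2_eq0 f : cL2 f -> sn2 f = 0 -> ae_circle (fun t => f t = 0).
Proof.
move=> [mf hf] h; have := RI_csq f; rewrite h mulr0 => I0.
have := RI_eq0 hf (fun t => csq_ge0 (f t)) I0.
by apply: aeS => t _ /csq_eq0.
Qed.

Lemma sn2_ae f g : measc f -> measc g ->
  ae_circle (fun t => csq (f t) = csq (g t)) -> sn2 f = sn2 g.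
Proof.
by move=> mf mg fg; rewrite !sn2E; congr (_ * _); apply: RI_ae => //; exact: meas_csq.
Qed.

Lemma snrm_ae f g : measc f -> measc g ->
  ae_circle (fun t => csq (f t) = csq (g t)) -> snrm f = snrm g.
Proof. by move=> mf mg fg; rewrite /nrm (sn2_ae mf mg fg). Qed.

Lemma sip_ae f g f' g' : measc f -> measc g -> measc f' -> measc g' ->
  ae_circle (fun t => f t = f' t) -> ae_circle (fun t => g t = g' t) ->
  sip f g = sip f' g'.
Proof.
move=> mf mg mf' mg' ff gg; apply: cint_ae; try by apply: measM => //; exact: measJ.
by apply: aeS2 ff gg => t _ -> ->.
Qed.

(** The pointwise bound [a + b <= e + (a^2 + b^2) / e] plays the role of Hölder's inequality. With
    [e = 2^-j] and a squared norm of at most [4^-j] it yields summable [L^1] distances. *)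
Lemma normR_csq f (e : R) : 0 < e -> cL2 f ->
  \int[mu]_(t in circle) (`|complex.Re (f t)| + `|complex.Im (f t)|) <=
  2 * pi * (e + e^-1 * sn2 f).
Proof.
move=> e0 [mf hf].
have h1 : rint (fun t => `|complex.Re (f t)| + `|complex.Im (f t)|).
  have [f1 f2] := cL2_cL1 (conj mf hf).
  by apply: rintD; exact: integrable_norm.
have h2 : rint (fun t => e + e^-1 * csq (f t)).
  by apply: rintD; [exact: rint_cst|exact: rintZ].
apply: le_trans (_ : \int[mu]_(t in circle) (e + e^-1 * csq (f t)) <= _).
  apply: le_Rintegral => // t _; rewrite /csq.
  rewrite -[X in X ^+ 2 + _]/(complex.Re (f t)) -(real_normK (num_real (complex.Re (f t)))).
  rewrite -(real_normK (num_real (complex.Im (f t)))).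
  set a := `|_|; set b := `|_|.
  rewrite -(ler_pM2l e0) mulrDr mulrDr mulrA divff ?gt_eqF// mul1r.
  have := sqr_ge0 (e - a - b); have := sqr_ge0 (a - b).
  have := sqr_ge0 (e - 2 * a); have := sqr_ge0 (e - 2 * b).
  nra.
rewrite RI_D; [|exact: rint_cst|exact: rintZ].
by rewrite RI_cst RI_Z// RI_csq le_eqVlt; apply/orP; left; apply/eqP; ring.
Qed.

(** A subsequence with geometric increments converges almost everywhere; Fatou's lemma then bounds
    the distance from the limit to every late term of the original sequence. *)
Theorem cL2_complete : @complete_form R (R -> C^o) (@cL2 R) sip.
Proof.
move=> u uE uC.
have H := sip_semi_inner.
have pow0 j : 0 < 2^-1 ^+ j :> R by rewrite exprn_gt0// invr_gt0.
have [N hN] := choice (fun j => uC _ (pow0 j)).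
(* This index exceeds each of [N 0], ..., [N j] and also [j], so later terms of the subsequence
   satisfy every earlier Cauchy estimate. *)
pose M j := (j + \sum_(i < j.+1) N i)%N.
have MN j k : (j <= k)%N -> (N j <= M k)%N.
  move=> jk; rewrite /M (bigD1 (Ordinal (jk : (j < k.+1)%N)))//=.
  by rewrite addnCA leq_addr.
have Mj j : (j <= M j)%N by rewrite leq_addr.
pose v j := u (M j).
have vE j : cL2 (v j) by exact: uE.
have dE j : cL2 (v j.+1 - v j) by apply: (siB H); exact: vE.
have vd j : sn2 (v j.+1 - v j) <= (2^-1 ^+ j) ^+ 2.
  rewrite -(nrm_sqr H (dE j)) ler_pXn2r ?nnegrE ?nrm_ge0 ?(ltW (pow0 j))//.
  by apply/ltW/hN; apply: MN.
have vi j : \int[mu]_(t in circle) (`|complex.Re ((v j.+1 - v j) t)| +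
    `|complex.Im ((v j.+1 - v j) t)|) <= 4 * pi * 2^-1 ^+ j.
  apply: le_trans (normR_csq (pow0 j) (dE j)) _.
  have : (2^-1 ^+ j)^-1 * sn2 (v j.+1 - v j) <= 2^-1 ^+ j.
    rewrite mulrC ler_pdivrMr//; exact: vd.
  have := pi_gt0 R; set x := _ * sn2 _; set y := _ ^+ j; nra.
have rD j : rint (fun t => `|complex.Re ((v j.+1 - v j) t)| +
    `|complex.Im ((v j.+1 - v j) t)|).
  by have [h1 h2] := cL2_cL1 (dE j); apply: rintD; exact: integrable_norm.
have [||fr [mfr hfr]] := @ae_cvg_series (fun j t => complex.Re (v j t)) (4 * pi).
- by move=> j; exact: (cL2_cL1 (vE j)).1.
- move=> j; apply: le_trans (vi j); apply: le_Rintegral => //.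
  + apply: integrable_norm; apply: rintD; first exact: (cL2_cL1 (vE _)).1.
    by apply: rintN; exact: (cL2_cL1 (vE _)).1.
  + exact: rD.
  + by move=> t _; rewrite -[(v j.+1 - v j) t]/(v j.+1 t - v j t) cReD cReN lerDl.
have [||fi [mfi hfi]] := @ae_cvg_series (fun j t => complex.Im (v j t)) (4 * pi).
- by move=> j; exact: (cL2_cL1 (vE j)).2.
- move=> j; apply: le_trans (vi j); apply: le_Rintegral => //.
  + apply: integrable_norm; apply: rintD; first exact: (cL2_cL1 (vE _)).2.
    by apply: rintN; exact: (cL2_cL1 (vE _)).2.
  + exact: rD.
  + by move=> t _; rewrite -[(v j.+1 - v j) t]/(v j.+1 t - v j t) cImD cImN lerDr.
pose l : R -> C^o := fun t => Complex (fr t) (fi t).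
have ml : measc l by split.
have key e : 0 < e -> exists K, forall k, (K <= k)%N ->
    cL2 (l - u k) /\ sn2 (l - u k) <= e ^+ 2.
  move=> e0; have [K hK] := uC e e0; exists K => k hk.
  have mlk : measc (l - u k) by apply: (measB ml); exact: cL2_meas.
  have dk j : cL2 (v (j + K)%N - u k) by apply: (siB H); [exact: vE|exact: uE].
  have [||||||h1 h2] := @RI_fatou (fun j t => csq ((v (j + K)%N - u k) t))
    (fun t => csq ((l - u k) t)) (2 * pi * e ^+ 2).
  - by move=> j; have [] := dk j.
  - by move=> j t; exact: csq_ge0.
  - exact: meas_csq.
  - by move=> t; exact: csq_ge0.
  - apply: aeS2 hfr hfi => t _ hr hi.
    have {}hr : (fun j => complex.Re (v (j + K)%N t)) @ \oo --> fr t.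
      by rewrite (cvg_shiftn K (fun j => complex.Re (v j t))).
    have {}hi : (fun j => complex.Im (v (j + K)%N t)) @ \oo --> fi t.
      by rewrite (cvg_shiftn K (fun j => complex.Im (v j t))).
    have E j : csq ((v (j + K)%N - u k) t) =
        (complex.Re (v (j + K)%N t) - complex.Re (u k t)) *
        (complex.Re (v (j + K)%N t) - complex.Re (u k t)) +
        (complex.Im (v (j + K)%N t) - complex.Im (u k t)) *
        (complex.Im (v (j + K)%N t) - complex.Im (u k t)).
      rewrite -[(v (j + K)%N - u k) t]/(v (j + K)%N t - u k t) /csq.
      by rewrite cReD cReN cImD cImN !expr2.
    under eq_fun do rewrite E.
    have -> : csq ((l - u k) t) =
       (fr t - complex.Re (u k t)) * (fr t - complex.Re (u k t)) +
       (fi t - complex.Im (u k t)) * (fi t - complex.Im (u k t)).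
      by rewrite -[(l - u k) t]/(l t - u k t) /csq cReD cReN cImD cImN !expr2.
    by apply: cvgD; apply: cvgM; apply: cvgB => //; exact: cvg_cst.
  - move=> j; rewrite RI_csq ler_wpM2l ?(ltW (pi2_gt0 R))//.
    rewrite -(nrm_sqr H (dk j)) ler_pXn2r ?nnegrE ?nrm_ge0 ?(ltW e0)//.
    by apply/ltW/hK => //; apply: leq_trans (Mj _); rewrite leq_addl.
  split; first by split.
  by move: h2; rewrite RI_csq ler_pM2l// pi2_gt0.
exists l.
  have [K hK] := key 1 ltr01; have [h _] := hK K (leqnn K).
  by have := siD H h (uE K); rewrite subrK.
move=> e e0; have e2 : 0 < e / 2 by rewrite divr_gt0.
have [K hK] := key _ e2; exists K => k /hK[h1 h2].
rewrite (_ : snrm (u k - l) = snrm (l - u k)); last first.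
  by rewrite -(nrmN H h1) opprB.
apply: le_lt_trans (_ : e / 2 < e); last by lra.
rewrite -(ler_pXn2r (n := 2)) ?nnegrE ?nrm_ge0 ?(ltW e2)//.
by rewrite (nrm_sqr H h1).
Qed.

End SquareIntegrable.

(** * Scalar Hardy spaces *)
Section Hardy.
Variable R : realType.
Local Notation C := R[i].
Implicit Types (f g h : R -> C) (u v : R -> R).
Local Notation snrm := (@nrm R (R -> C^o) (@sip R)).
Local Notation sn2 := (@n2 R (R -> C^o) (@sip R)).
Local Notation L2s := (@cL2 R).
Let H := sip_semi_inner R.

Definition fc f (n : int) : C := circle_int (fun t => f t * zfun t ^ (- n)).
Definition sH2 f : Prop := cL2 f /\ forall n : int, n < 0 -> fc f n = 0.
Definition sHinf f : Prop := [/\ measc f,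
  exists M : R, ae_circle (fun t => csq (f t) <= M) &
  forall n : int, n < 0 -> fc f n = 0].
Definition sH2m f : Prop := cL2 f /\ forall g, sH2 g -> sip f g = 0.

Lemma fcE f n : fc f n = sip f (fun t => zfun t ^ n).
Proof. by congr circle_int; apply/funext => t; rewrite zXJ. Qed.

Lemma sn2_zX n : sn2 (fun t => zfun t ^ n) = 1.
Proof.
have p0 : 2 * pi != 0 :> R by rewrite gt_eqF// pi2_gt0.
rewrite sn2E; under eq_Rintegral do rewrite csq_zX.
by rewrite RI_cst mul1r mulVf.
Qed.

(** Orthogonality to [w] is a closed condition. Many vanishing statements below come from
    approximating one factor by vectors for which the product is explicitly 0. *)
Lemma approx_ip0 (x w : R -> C^o) : L2s x -> L2s w ->
  (forall e, 0 < e -> exists s : R -> C^o,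
     [/\ L2s s, @sip R s w = 0 & snrm (x - s) < e]) -> sip x w = 0.
Proof.
move=> hx hw h.
suff : forall e, 0 < e -> csq (sip x w) <= e.
  move=> h'; apply: csq_eq0; apply/eqP; rewrite eq_le csq_ge0 andbT leNgt.
  by apply/negP => h0; have := h' (csq (sip x w) / 2); rewrite divr_gt0//; lra.
move=> e e0; pose K := sn2 w + 1.
have K0 : 0 < K by rewrite ltr_wpDl// (n2_ge0 H).
have [|s [hs s0 sx]] := h (Num.sqrt (e / K)); first by rewrite sqrtr_gt0 divr_gt0.
have hxs : L2s (x - s) by apply: (siB H).
have -> : sip x w = sip (x - s) w by rewrite (ipBl H)// s0 subr0.
apply: le_trans (ip_CS H hxs hw) _.
apply: le_trans (_ : e / K * K <= _); last by rewrite divfK// gt_eqF.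
have eK : 0 <= e / K by rewrite ltW// divr_gt0.
apply: ler_pM; rewrite ?(n2_ge0 H)//; last by rewrite /K lerDl.
rewrite -(nrm_sqr H hxs) -(sqr_sqrtr eK) ler_pXn2r ?nnegrE ?nrm_ge0 ?sqrtr_ge0//.
exact: ltW.
Qed.

Lemma sH2_cL2 f : sH2 f -> cL2 f. Proof. by case. Qed.
Lemma sH2_meas f : sH2 f -> measc f. Proof. by case=> -[]. Qed.

Lemma sH2_lin (a : C) f g : sH2 f -> sH2 g -> sH2 (fun t => a * f t + g t).
Proof.
move=> [f2 f0] [g2 g0]; split; first by apply: cL2D => //; exact: cL2Z.
move=> n n0; rewrite fcE.
have := @si_lin _ _ _ _ H a f g _ f2 g2 (cL2_zX R n).
by rewrite -!fcE f0// g0// mulr0 addr0.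
Qed.

Lemma sH2_0 : sH2 (fun=> 0).
Proof.
split; first exact: cL2_cst.
by move=> n _; rewrite fcE; exact: (ip0l H (cL2_zX R n)).
Qed.

Lemma sH2D f g : sH2 f -> sH2 g -> sH2 (fun t => f t + g t).
Proof. by move=> hf hg; have := sH2_lin 1 hf hg; under eq_fun do rewrite mul1r. Qed.
Lemma sH2Z a f : sH2 f -> sH2 (fun t => a * f t).
Proof. by move=> hf; have := sH2_lin a hf sH2_0; under eq_fun do rewrite addr0. Qed.
Lemma sH2N f : sH2 f -> sH2 (fun t => - f t).
Proof. by move=> hf; have := sH2Z (-1) hf; under eq_fun do rewrite mulN1r. Qed.
Lemma sH2B f g : sH2 f -> sH2 g -> sH2 (fun t => f t - g t).
Proof. by move=> hf hg; apply: sH2D hf (sH2N hg). Qed.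
Lemma sH2_sum (I : Type) (r : seq I) (P : pred I) (F : I -> R -> C) :
  (forall i, sH2 (F i)) -> sH2 (fun t => \sum_(i <- r | P i) F i t).
Proof.
move=> h; elim: r => [|a r ih].
  by under eq_fun do rewrite big_nil; exact: sH2_0.
by under eq_fun do rewrite big_cons; case: (P a) => //; exact: sH2D.
Qed.

Lemma sH2_ae f g : measc g -> ae_circle (fun t => f t = g t) -> sH2 f -> sH2 g.
Proof.
move=> mg fg [f2 f0]; split.
  by apply: cL2_ae mg _ f2; apply: aeS fg => t _ ->.
move=> n n0; rewrite -(f0 n n0); apply: cint_ae.
- by apply: measM => //; exact: meas_zX.
- by apply: measM; [exact: cL2_meas|exact: meas_zX].
- by apply: aeS fg => t _ ->.
Qed.

Lemma sH2_semi_inner : @semi_inner R (R -> C^o) sH2 (@sip R).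
Proof.
apply: (semi_inner_sub H); [by move=> x []|exact: sH2_0|].
by move=> a x y; exact: sH2_lin.
Qed.

Lemma sH2_approx (x : R -> C^o) : L2s x ->
  (forall e, 0 < e -> exists2 s : R -> C^o, sH2 s & snrm (x - s) < e) -> sH2 x.
Proof.
move=> hx h; split => // n n0; rewrite fcE; apply: approx_ip0 => //.
  exact: cL2_zX.
by move=> e /h[s hs ?]; exists s; split => //; [exact: sH2_cL2|rewrite -fcE hs.2].
Qed.

Lemma sH2_complete : @complete_form R (R -> C^o) sH2 (@sip R).
Proof.
move=> u uE uC; have [l hl lim] := @cL2_complete R u (fun k => (uE k).1) uC.
exists l => //; apply: sH2_approx => // e e0; have [N hN] := lim e e0.
by exists (u N) => //; rewrite (nrm_sub H) ?hN//; exact: (uE N).1.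
Qed.

Lemma sip_zX (m n : int) :
  sip (fun t => zfun t ^ m) (fun t => zfun t ^ n) = (m == n)%:R :> C.
Proof.
rewrite /sip -[RHS]/(((m == n) : bool)%:R) -subr_eq0 -(cint_zX R).
by congr circle_int; apply/funext => t; rewrite zXJ -expfzDr ?zfun_neq0.
Qed.

Lemma sH2_zX (n : nat) : sH2 (fun t => zfun t ^ (n : int)).
Proof.
split; first exact: cL2_zX.
by move=> m m0; rewrite fcE sip_zX eq_sym lt_eqF// (lt_le_trans m0).
Qed.

Lemma sH2_cst (c : C) : sH2 (fun=> c).
Proof. by have := sH2Z c (sH2_zX 0); under eq_fun do rewrite expr0z mulr1. Qed.

Lemma sH2_poly (p : {poly C}) : sH2 (fun t => p.[zfun t]).
Proof.
under eq_fun do rewrite horner_coef.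
apply: (@sH2_sum _ _ xpredT (fun (i : 'I_(size p)) t => p`_i * zfun t ^+ i)) => i.
exact: sH2Z (sH2_zX i).
Qed.

Definition polyset : set (R -> C^o) := [set f | exists p : {poly C},
  f = fun t => p.[zfun t]].

Lemma polysetL (a : C) (x y : R -> C^o) : polyset x -> polyset y -> polyset (a *: x + y).
Proof.
move=> [p ->] [q ->]; exists (a *: p + q); apply/funext => t.
by rewrite hornerD hornerZ.
Qed.

Lemma polyset0 : polyset 0.
Proof. by exists 0; apply/funext => t; rewrite horner0. Qed.

Lemma polyset_cL2 : polyset `<=` L2s.
Proof. by move=> _ [p ->]; exact: sH2_cL2 (sH2_poly p). Qed.

Lemma polyset_zX (n : nat) : polyset (fun t => zfun t ^ (n : int)).
Proof. by exists 'X^n; apply/funext => t; rewrite hornerXn. Qed.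

Lemma coef_unique f : cL2 f -> (forall n, fc f n = 0) ->
  ae_circle (fun t => f t = 0).
Proof.
move=> hf f0; apply: fourier_unique; first exact: cL2_cL1.
by move=> n; rewrite -(f0 (- n)) /fc opprK.
Qed.

(** The difference between [f] and its projection onto the closed span of the polynomials has no
    coefficient at all: the negative ones vanish in [H^2], the others by orthogonality. Uniqueness
    of Fourier coefficients concludes. *)
Theorem poly_dense f : sH2 f -> forall e, 0 < e -> exists p : {poly C},
  snrm (fun t => f t - p.[zfun t]) < e.
Proof.
move=> hf.
have [q [hq1 hq2] ortho] := cls_proj H (@cL2_complete R) polyset_cL2 polyset0
  polysetL (sH2_cL2 hf).
have q2 : sH2 q.
  by apply: sH2_approx => // e /hq2[_ [p ->] hs]; exists (fun t => p.[zfun t]);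
    first exact: sH2_poly.
have d2 : cL2 (fun t => f t - q t) by apply: cL2B => //; exact: sH2_cL2.
have fq : ae_circle (fun t => f t - q t = 0).
  apply: coef_unique => // -[n|n].
    rewrite fcE; apply: ortho; apply: (sub_cls H polyset_cL2); exact: polyset_zX.
  have [_ h0] : sH2 (fun t => f t - q t) by exact: sH2B.
  by rewrite h0.
move=> e /hq2[_ [p ->] hs]; exists p; rewrite (snrm_ae (g := fun t => q t - p.[zfun t]))//.
- by apply: measB; [exact: sH2_meas|exact: sH2_meas (sH2_poly p)].
- by apply: measB; [exact: cL2_meas|exact: sH2_meas (sH2_poly p)].
- by apply: aeS fq => t _ /eqP; rewrite subr_eq0 => /eqP ->.
Qed.

Lemma cint_mul f g : circle_int (fun t => f t * g t) = sip f (fun t => Num.conj (g t)).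
Proof. by congr circle_int; apply/funext => t; rewrite conjCK. Qed.

Lemma cint_approx0 f g : sH2 f -> cL2 g ->
  (forall n : nat, circle_int (fun t => zfun t ^ (n : int) * g t) = 0) ->
  circle_int (fun t => f t * g t) = 0.
Proof.
move=> hf hg h0; rewrite cint_mul; apply: approx_ip0.
- exact: sH2_cL2.
- exact: cL2J.
move=> e e0; have [p hp] := poly_dense hf e0; exists (fun t => p.[zfun t]); split => //.
  exact: sH2_cL2 (sH2_poly p).
rewrite -[LHS]cint_mul.
under eq_fun do rewrite horner_coef mulr_suml.
rewrite (@cint_sum R _ _ xpredT (fun (i : 'I_(size p)) t => p`_i * zfun t ^+ i * g t)).
  apply: big1 => i _; under eq_fun do rewrite -mulrA.
  by rewrite cintZ ?h0 ?mulr0//; exact: cL1M (cL2_zX R i) hg.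
move=> i; apply: cL1M => //; exact: cL2Z (cL2_zX R i).
Qed.

Lemma sH2_zXM f (n : nat) : sH2 f -> sH2 (fun t => zfun t ^ (n : int) * f t).
Proof.
move=> [f2 f0]; split.
  apply: (cL2_bnd (M := 1)) => //; first exact: meas_zX.
  by apply: aeT => t _; rewrite csq_zX.
move=> m m0; rewrite -(f0 (m - n%:Z)); last by rewrite subr_lt0 (lt_le_trans m0).
congr circle_int; apply/funext => t.
by rewrite opprB addrC expfzDr ?zfun_neq0// mulrA mulrC mulrA [_ * f t]mulrC mulrA.
Qed.

Lemma cL2_zXM f (n : int) : cL2 f -> cL2 (fun t => zfun t ^ n * f t).
Proof.
move=> f2; apply: (cL2_bnd (M := 1)) => //; first exact: meas_zX.
by apply: aeT => t _; rewrite csq_zX.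
Qed.

(** Products of two [H^2] functions stand for [H^1]. By density [f] may be replaced by [z^m], and
    the integral becomes the coefficient of [g] at [-(m + n)]. *)
Lemma sH2_mul0 f g (n : int) : sH2 f -> sH2 g -> 0 < n ->
  circle_int (fun t => f t * g t * zfun t ^ n) = 0.
Proof.
case: n => // n hf hg n0; under eq_fun do rewrite -mulrA.
apply: cint_approx0 => //.
  by under eq_fun do rewrite mulrC; apply: cL2_zXM; exact: sH2_cL2.
move=> m; have [_ g0] := hg; rewrite -(g0 (- (m + n)%:Z)).
  congr circle_int; apply/funext => t; rewrite opprK PoszD expfzDr ?zfun_neq0//.
  by rewrite mulrCA mulrA.
by rewrite oppr_lt0 ltz_nat addn_gt0 orbC (_ : (0 < n)%N).
Qed.

(** The product [f g] has no coefficient at negative indices, and the conjugate of a function of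
    [z H^1] has none at nonnegative indices. *)
Lemma H1_conj_zero f g f' g' : sH2 f -> sH2 g -> sH2 f' -> sH2 g' ->
  ae_circle (fun t => f t * g t = Num.conj (zfun t * (f' t * g' t))) ->
  ae_circle (fun t => f t * g t = 0).
Proof.
move=> hf hg hf' hg' E; apply: fourier_unique.
  by apply: cL1M; exact: sH2_cL2.
move=> n; have [n0|n0] := ltP 0 n; first exact: sH2_mul0.
have m1 : measc (fun t => f t * g t) by apply: measM; exact: sH2_meas.
have m2 : measc (fun t => f' t * g' t) by apply: measM; exact: sH2_meas.
transitivity (circle_int (fun t => Num.conj (f' t * g' t * zfun t ^ (1 - n)))).
  apply: cint_ae.
  - by apply: measM => //; exact: meas_zX.
  - by apply: measJ; apply: measM => //; exact: meas_zX.
  - apply: aeS E => t _ ->; rewrite -[in LHS](opprK n) -zXJ -rmorphM; congr Num.conj.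
    by rewrite expfzDr ?zfun_neq0// expr1z; ring.
rewrite cintJ.
  by rewrite sH2_mul0// ?(rmorph0 Num.conj)// subr_gt0 (le_lt_trans n0).
under eq_fun do rewrite -mulrA.
apply: cL1M; first exact: sH2_cL2.
by under eq_fun do rewrite mulrC; apply: cL2_zXM; exact: sH2_cL2.
Qed.

End Hardy.

(** * The Riesz projection and outer functions *)
Section Projection.
Variable R : realType.
Local Notation C := R[i].
Implicit Types (f g h : R -> C) (u v : R -> R).
Local Notation snrm := (@nrm R (R -> C^o) (@sip R)).
Local Notation sn2 := (@n2 R (R -> C^o) (@sip R)).
Local Notation L2s := (@cL2 R).
Let H := sip_semi_inner R.
Let HH := sH2_semi_inner R.

(** Integrability is a premise inside the existential, so that choice gives a total function [Pp].
    As a choice of representatives, [Pp] is additive and compatible with equality only almost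
    everywhere; its properties are obtained by testing against [H^2]. *)
Lemma Pp_exists f : exists q : R -> C, cL2 f ->
  sH2 q /\ forall r, sH2 r -> sip (fun t => f t - q t) r = 0.
Proof.
have [hf|] := pselect (cL2 f); last by exists f.
have [|x hx|q hq h] := @riesz R (R -> C^o) (@sH2 R) (@sip R) HH (@sip R f) (sn2 f)
    (@sH2_complete R).
- move=> a x y hx hy.
  by rewrite (ipDr H) ?(ipZr H)//; try exact: sH2_cL2; apply: (siZ H); exact: sH2_cL2.
- exact: (ip_CS H hf (sH2_cL2 hx)).
exists q => _; split => // r hr.
have := ipBl H hf (sH2_cL2 hq) (sH2_cL2 hr).
by rewrite h// subrr.
Qed.

Definition Pp f : R -> C := sval (cid (Pp_exists f)).

Lemma Pp_H2 f : cL2 f -> sH2 (Pp f).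
Proof. by rewrite /Pp; case: cid => q /= h /h []. Qed.
Lemma Pp_orth f r : cL2 f -> sH2 r -> sip (fun t => f t - Pp f t) r = 0.
Proof. by rewrite /Pp; case: cid => q /= h /h [_]; exact. Qed.
Lemma Pp_sip f r : cL2 f -> sH2 r -> sip (Pp f) r = sip f r.
Proof.
move=> hf hr; have := Pp_orth hf hr; have := ipBl H hf (sH2_cL2 (Pp_H2 hf)) (sH2_cL2 hr).
by move=> -> /eqP; rewrite subr_eq0 => /eqP.
Qed.
Lemma Pp_H2m f : cL2 f -> sH2m (fun t => f t - Pp f t).
Proof.
move=> hf; split; last by move=> r hr; exact: Pp_orth.
by apply: cL2B => //; exact: sH2_cL2 (Pp_H2 hf).
Qed.

Lemma sn2_Pp f : cL2 f -> sn2 f = sn2 (Pp f) + sn2 (fun t => f t - Pp f t).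
Proof.
move=> hf; have hP := Pp_H2 hf; have [hQ hQ0] := Pp_H2m hf.
have := n2D H hQ (sH2_cL2 hP).
rewrite /rip hQ0//= mulr0 addr0 [X in _ = X -> _]addrC => <-; congr sn2.
by apply/funext => t; rewrite -[LHS](subrK (Pp f t)).
Qed.

Lemma sn2_Pp_le f : cL2 f -> sn2 (Pp f) <= sn2 f.
Proof.
by move=> hf; rewrite [leRHS]sn2_Pp// lerDl (n2_ge0 H)//; exact: (Pp_H2m hf).1.
Qed.

Lemma sH2mP f : sH2m f <-> cL2 f /\ forall n : nat, fc f n = 0.
Proof.
split=> [[hf h0]|[hf h0]]; split => //.
  by move=> n; rewrite fcE; apply: h0; exact: sH2_zX.
move=> g hg; have E := si_conj H (sH2_cL2 hg) hf.
rewrite E (_ : sip g f = 0) ?(rmorph0 Num.conj)//.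
apply: approx_ip0 => //; first exact: sH2_cL2.
move=> e /(poly_dense hg)[p hp]; exists (fun t => p.[zfun t]); split => //.
  exact: sH2_cL2 (sH2_poly p).
have hp2 := sH2_cL2 (sH2_poly p).
rewrite (si_conj H hf hp2) (_ : sip f _ = 0) ?(rmorph0 Num.conj)//.
rewrite /sip; under eq_fun do rewrite horner_coef rmorph_sum mulr_sumr.
rewrite (@cint_sum R _ _ xpredT (fun (i : 'I_(size p)) t =>
  f t * Num.conj (p`_i * zfun t ^+ i))).
  apply: big1 => i _; under eq_fun do rewrite rmorphM mulrCA.
  rewrite cintZ; last by exact: cL1M hf (cL2J (cL2_zX R i)).
  by have := h0 i; rewrite fcE /sip => ->; rewrite mulr0.
move=> i; apply: cL1M => //; apply: cL2J; exact: cL2Z (cL2_zX R i).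
Qed.

(* The flip f |-> conj(z) conj(f) exchanges H^2 and its orthogonal complement. *)
Definition flip f : R -> C := fun t => Num.conj (zfun t) * Num.conj (f t).

Lemma flipK f : flip (flip f) = f.
Proof.
apply/funext => t; rewrite /flip rmorphM /= !conjCK mulrA.
by rewrite [_ * zfun t]mulrC mulJ csq_z mul1r.
Qed.

Lemma cL2_flip f : cL2 f -> cL2 (flip f).
Proof.
move=> hf; have := cL2_zXM (-1) (cL2J hf).
by under eq_fun do rewrite -zXJ expr1z.
Qed.

Lemma csq_flip f t : csq (flip f t) = csq (f t).
Proof. by rewrite /flip csqM !csqJ csq_z mul1r. Qed.

Lemma fc_flip f n : cL2 f -> fc (flip f) n = Num.conj (fc f (- n - 1)).
Proof.
move=> hf; rewrite /fc -cintJ.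
  have -> : - (- n - 1) = 1 + n by rewrite opprD !opprK addrC.
  congr circle_int; apply/funext => t.
  rewrite /flip rmorphM /= zXJ opprD expfzDr ?zfun_neq0//.
  by rewrite -[in RHS](zXJ 1) expr1z; ring.
under eq_fun do rewrite mulrC.
by apply: cL2_cL1; exact: cL2_zXM.
Qed.

Lemma flip_sH2 f : sH2 f -> sH2m (flip f).
Proof.
move=> [hf h0]; apply/sH2mP; split=> [|n]; first exact: cL2_flip.
rewrite fc_flip// h0 ?(rmorph0 Num.conj)//.
Qed.

Lemma flip_sH2m f : sH2m f -> sH2 (flip f).
Proof.
move=> /sH2mP[hf h0]; split=> [|n n0]; first exact: cL2_flip.
rewrite fc_flip//; case: n n0 => // n _.
have -> : - Negz n - 1 = n%:Z by rewrite NegzE opprK (intS n) addrAC subrr add0r.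
by rewrite h0 (rmorph0 Num.conj).
Qed.

Lemma sHinf_cL2 f : sHinf f -> cL2 f.
Proof. by move=> [mf [M hM] _]; exact: cL2_ae_bnd hM. Qed.

Lemma sHinf_sH2 f : sHinf f -> sH2 f.
Proof. by move=> hf; split; [exact: sHinf_cL2|case: hf]. Qed.

Lemma sH2_sHinf f M : sH2 f -> ae_circle (fun t => csq (f t) <= M) -> sHinf f.
Proof. by move=> [[mf _] f0] hM; split => //; exists M. Qed.

Lemma sH2_coefM f g : measc f -> measc g -> sH2 f -> sH2 g ->
  forall n : int, n < 0 -> fc (fun t => f t * g t) n = 0.
Proof. by move=> mf mg hf hg n n0; apply: sH2_mul0 => //; rewrite oppr_gt0. Qed.

Lemma sHinf_mulH2 b f : sHinf b -> sH2 f -> sH2 (fun t => b t * f t).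
Proof.
move=> hb hf; have [mb [M hM] _] := hb; split.
  by apply: (cL2_bnd (M := M)) => //; exact: sH2_cL2.
by apply: sH2_coefM => //; [exact: sH2_meas|exact: sHinf_sH2].
Qed.

Lemma sHinfM f g : sHinf f -> sHinf g -> sHinf (fun t => f t * g t).
Proof.
move=> hf hg; have [_ [M hM] _] := hf; have [_ [M' hM'] _] := hg.
apply: (sH2_sHinf (M := M * M')).
  by apply: sHinf_mulH2 => //; exact: sHinf_sH2.
apply: aeS2 hM hM' => t _ h h'; rewrite csqM.
by apply: ler_pM => //; exact: csq_ge0.
Qed.

Lemma sHinfD f g : sHinf f -> sHinf g -> sHinf (fun t => f t + g t).
Proof.
move=> hf hg; have [_ [M hM] _] := hf; have [_ [M' hM'] _] := hg.
apply: (sH2_sHinf (M := 2 * M + 2 * M')).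
  by apply: sH2D; exact: sHinf_sH2.
apply: aeS2 hM hM' => t _ h h'; apply: le_trans (csqD_le _ _) _.
by apply: lerD; rewrite ler_pM2l.
Qed.

Lemma sHinf_cst (c : C) : sHinf (fun=> c).
Proof. by apply: (sH2_sHinf (M := csq c)); [exact: sH2_cst|exact: aeT]. Qed.

Lemma sHinf_sum (I : Type) (r : seq I) (P : pred I) (F : I -> R -> C) :
  (forall i, sHinf (F i)) -> sHinf (fun t => \sum_(i <- r | P i) F i t).
Proof.
move=> h; elim: r => [|a r ih].
  by under eq_fun do rewrite big_nil; exact: sHinf_cst.
by under eq_fun do rewrite big_cons; case: (P a) => //; exact: sHinfD.
Qed.

Lemma sHinf_poly (p : {poly C}) : sHinf (fun t => p.[zfun t]).
Proof.
under eq_fun do rewrite horner_coef.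
apply: (@sHinf_sum _ _ xpredT (fun (i : 'I_(size p)) t => p`_i * zfun t ^+ i)) => i.
apply: sHinfM; first exact: sHinf_cst.
apply: (sH2_sHinf (M := 1)); first exact: sH2_zX.
by apply: aeT => t _; rewrite (csq_zX i).
Qed.

Definition outers h : Prop := sH2 h /\ forall g, sH2 g -> forall e, 0 < e ->
  exists p : {poly C}, snrm (fun t => p.[zfun t] * h t - g t) < e.

(** The indicator of the zero set of [h] is orthogonal to all polynomial multiples of [h], and these
    approximate the constant 1; so the zero set has measure 0. *)
Lemma outers_neq0 h : outers h -> ae_circle (fun t => h t != 0).
Proof.
move=> [hh hd]; pose c : R -> C^o := fun t => if h t == 0 then 1 else 0.
have mc : measc c.
  have m1 : measurable_fun (@circle R) (fun t => if csq (h t) == 0 then 1 else 0 : R).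
    apply: measurable_fun_if => //.
      exact: measurable_circle.
    by apply: measurable_fun_eqr => //; exact: meas_csq (sH2_meas hh).
  split; last by apply: eq_measurable_fun (measurable_cst (0 : R)) => t _; rewrite /c; case: ifP.
  apply: eq_measurable_fun m1 => t _; rewrite /c.
  case: (eqVneq (h t) 0) => [->|h0]; first by rewrite csq0 eqxx.
  by case: eqP => // /csq_eq0 /eqP; rewrite (negPf h0).
have c2 : cL2 c.
  apply: (cL2_ae_bnd (M := 1)) => //; apply: aeT => t _.
  by rewrite /c; case: ifP; rewrite ?csq1 ?csq0.
have c0 : sip (fun=> 1) c = 0.
  apply: approx_ip0 => //; first exact: cL2_cst.
  move=> e e0; have [p hp] := hd _ (sH2_cst 1) e e0.
  have hph : sH2 (fun t => p.[zfun t] * h t) by apply: sHinf_mulH2 => //; exact: sHinf_poly.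
  exists (fun t => p.[zfun t] * h t); split; first exact: sH2_cL2.
    rewrite /sip (_ : (fun t => _) = (fun=> 0)) ?cint_cst//; apply/funext => t.
    rewrite /c; case: eqP => [->|_]; first by rewrite mulr0 mul0r.
    by rewrite (rmorph0 Num.conj) mulr0.
  by rewrite (nrm_sub H)//; [exact: cL2_cst|exact: sH2_cL2].
have : sn2 c = 0.
  have -> : sn2 c = complex.Re (sip c (fun=> 1)).
    rewrite /n2; congr (complex.Re (circle_int _)); apply/funext => t.
    by rewrite /c; case: ifP; rewrite ?mul0r.
  by rewrite (si_conj H (cL2_cst 1) c2) c0 (rmorph0 Num.conj).
move/(sn2_eq0 c2); apply: aeS => t _; rewrite /c; case: eqP => // _ /eqP.
by rewrite oner_eq0.
Qed.

(** When [p h] tends to 1, each negative coefficient of [f] is a limit of the corresponding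
    coefficients of [p h f = p a b], which vanish since [p a] and [b] are in [H^2]. *)
Lemma outer_div h f a b : outers h -> sH2 a -> sH2 b -> cL2 f ->
  ae_circle (fun t => f t * h t = a t * b t) -> sH2 f.
Proof.
move=> [hh hd] ha hb hf E; split => // n n0.
rewrite /fc; have {n0} : 0 < - n by rewrite oppr_gt0.
move: (- n) => {}n n0.
have mz : measc (fun t => zfun t ^ n : C) by exact: meas_zX.
have fz : cL2 (fun t => Num.conj (f t * zfun t ^ n)).
  by apply: cL2J; under eq_fun do rewrite mulrC; exact: cL2_zXM.
suff : sip (fun=> 1) (fun t => Num.conj (f t * zfun t ^ n)) = 0.
  rewrite /sip => h0; rewrite -[RHS]h0; congr circle_int; apply/funext => t.
  by rewrite conjCK mul1r.
apply: approx_ip0 => //; first exact: cL2_cst.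
move=> e e0; have [p hp] := hd _ (sH2_cst 1) e e0.
have hph : sH2 (fun t => p.[zfun t] * h t) by apply: sHinf_mulH2 => //; exact: sHinf_poly.
exists (fun t => p.[zfun t] * h t); split; first exact: sH2_cL2.
- have hpa : sH2 (fun t => p.[zfun t] * a t) by apply: sHinf_mulH2 => //; exact: sHinf_poly.
  rewrite -[RHS](sH2_mul0 hpa hb n0); apply: cint_ae.
  + apply: measM; first exact: sH2_meas.
    by apply: measJ; exact: cL2_meas.
  + by apply: measM => //; apply: measM; exact: sH2_meas.
  + apply: aeS E => t _ e1; rewrite conjCK -[in RHS](mulrA p.[_]) -e1; ring.
- by rewrite (nrm_sub H)//; [exact: cL2_cst|exact: sH2_cL2].
Qed.

End Projection.

(** * Bounded multipliers and Taylor coefficients *)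
Section Multiplier.
Variable R : realType.
Local Notation C := R[i].
Implicit Types (f g h b : R -> C) (u v : R -> R).
Local Notation snrm := (@nrm R (R -> C^o) (@sip R)).
Local Notation sn2 := (@n2 R (R -> C^o) (@sip R)).
Local Notation L2s := (@cL2 R).
Let H := sip_semi_inner R.

Lemma cabs_le (x y : C) :
  Num.sqrt (csq (x + y)) <= Num.sqrt (csq x) + Num.sqrt (csq y).
Proof.
by have := ler_normD x y; rewrite !normc_def -rmorphD /= lecR.
Qed.

Lemma le_addeps (a b k : R) : 0 <= k -> (forall e, 0 < e -> a <= b + e * k) -> a <= b.
Proof.
move=> k0 h; rewrite leNgt; apply/negP => ba.
have := h ((a - b) / (2 * (k + 1))); rewrite divr_gt0 ?subr_gt0 ?mulr_gt0 ?ltr_wpDl//.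
move=> /(_ isT).
have : (a - b) / (2 * (k + 1)) * k <= (a - b) / 2.
  rewrite -[leRHS](_ : (a - b) / (2 * (k + 1)) * (k + 1) = _).
    by rewrite ler_pM2l ?lerDl// divr_gt0 ?subr_gt0 ?mulr_gt0 ?ltr_wpDl.
  by field; rewrite gt_eqF// ltr_wpDl.
lra.
Qed.

(** A bound on a continuous functional passes to the closure. The case [K = 0] is used for
    orthogonality to a closed span. *)
Lemma cls_bound (S : set (R -> C^o)) (K : R) w : S `<=` L2s -> 0 <= K -> cL2 w ->
  (forall s, S s -> csq (@sip R s w) <= K * sn2 s) ->
  forall x, cls L2s (@sip R) S x -> csq (@sip R x w) <= K * sn2 x.
Proof.
move=> SL K0 hw hS x [hx hcl].
have k0 := sqrtr_ge0 K.
have n0 (y : R -> C^o) : 0 <= snrm y := nrm_ge0 _ _.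
suff : Num.sqrt (csq (@sip R x w)) <= Num.sqrt K * snrm x.
  rewrite -(ler_pXn2r (n := 2)) ?nnegrE ?sqrtr_ge0 ?mulr_ge0//.
  by rewrite exprMn (sqr_sqrtr (csq_ge0 _)) (sqr_sqrtr K0) (nrm_sqr H hx).
apply: (@le_addeps _ _ (snrm w + Num.sqrt K)); first by rewrite addr_ge0.
move=> e e0; have [s Ss hs] := hcl e e0; have hs2 := SL _ Ss.
have hxs : L2s (x - s) by apply: (siB H).
have -> : sip x w = sip (x - s) w + sip s w by rewrite (ipBl H)// subrK.
apply: le_trans (cabs_le _ _) _.
have h1 : Num.sqrt (csq (sip (x - s) w)) <= e * snrm w.
  apply: (@le_trans _ _ (snrm (x - s) * snrm w)); last first.
    by rewrite ler_wpM2r ?nrm_ge0// ltW.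
  rewrite -(ler_pXn2r (n := 2)) ?nnegrE ?sqrtr_ge0 ?mulr_ge0//.
  by rewrite exprMn (sqr_sqrtr (csq_ge0 _)) (nrm_sqr H hxs) (nrm_sqr H hw); exact: (ip_CS H).
have h2 : Num.sqrt (csq (sip s w)) <= Num.sqrt K * snrm s.
  rewrite -(ler_pXn2r (n := 2)) ?nnegrE ?sqrtr_ge0 ?mulr_ge0//.
  by rewrite exprMn (sqr_sqrtr (csq_ge0 _)) (sqr_sqrtr K0) (nrm_sqr H hs2); exact: hS.
have h3 : snrm s <= snrm x + e.
  have -> : s = x - (x - s) by rewrite opprB addrC subrK.
  apply: le_trans (nrmB H hx hxs) _; rewrite lerD2l; exact: ltW.
have : Num.sqrt K * snrm s <= Num.sqrt K * (snrm x + e) by rewrite ler_wpM2l.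
lra.
Qed.

(** Trigonometric polynomials, written as a power of [z] times an analytic polynomial: on the circle
    they have the modulus of the latter. *)
Definition trigset : set (R -> C^o) := [set f | exists (N : nat) (p : {poly C}),
  f = fun t => zfun t ^ (- N%:Z) * p.[zfun t]].

Lemma trigset_cL2 : trigset `<=` L2s.
Proof. by move=> _ [N [p ->]]; apply: cL2_zXM; exact: sH2_cL2 (sH2_poly p). Qed.

Lemma trigset0 : trigset 0.
Proof. by exists 0%N, 0; apply/funext => t; rewrite horner0 mulr0. Qed.

Lemma trigsetL (a : C) (x y : R -> C^o) : trigset x -> trigset y -> trigset (a *: x + y).
Proof.
move=> [N [p ->]] [M [q ->]]; exists (N + M)%N, (a *: ('X^M * p) + 'X^N * q).
apply/funext => t; rewrite hornerD hornerZ !hornerM !hornerXn PoszD opprD.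
rewrite -[LHS]/(a * (zfun t ^ (- N%:Z) * p.[zfun t]) + zfun t ^ (- M%:Z) * q.[zfun t]).
have z0 := zfun_neq0 t; have zN k : zfun t ^+ k != 0 :> C by rewrite expf_neq0.
rewrite expfzDr// -!exprnN; field.
by rewrite !zN.
Qed.

Lemma trig_dense x : cL2 x -> cls L2s (@sip R) trigset x.
Proof.
move=> hx; have [q hq ortho] := cls_proj H (@cL2_complete R) trigset_cL2 trigset0
  trigsetL hx.
have d2 : cL2 (fun t => x t - q t) by apply: cL2B => //; exact: hq.1.
have xq : ae_circle (fun t => x t - q t = 0).
  apply: coef_unique => // n; rewrite fcE; apply: ortho.
  apply: (sub_cls H trigset_cL2); case: n => n.
  - exists 0%N, 'X^n; apply/funext => t; rewrite hornerXn.
    by rewrite expr0z mul1r.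
  - by exists n.+1, 1; apply/funext => t; rewrite hornerC mulr1 -NegzE.
split=> // e /hq.2[s Ss hs]; exists s => //.
have ms := cL2_meas (trigset_cL2 Ss).
rewrite (snrm_ae (g := fun t => q t - s t))//.
- by apply: measB => //; exact: cL2_meas.
- by apply: measB => //; exact: cL2_meas hq.1.
- by apply: aeS xq => t _ /eqP; rewrite subr_eq0 => /eqP {1}<-.
Qed.

Lemma trigset_bnd r : trigset r -> exists M, ae_circle (fun t => csq (r t) <= M).
Proof.
move=> [N [p ->]]; have [_ [M hM] _] := sHinf_poly p; exists M.
by apply: aeS hM => t _; rewrite csqM csq_zX mul1r.
Qed.

(** A unimodular power of [z] carries the estimate to trigonometric polynomials, two dualities carry
    it to every bounded [c], and the indicator of the set where [|b|^2 > G] shows that this set is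
    null. *)
Theorem mul_bound b (G : R) : cL2 b -> 0 <= G ->
  (forall p : {poly C}, cL2 (fun t => p.[zfun t] * b t) ->
     sn2 (fun t => p.[zfun t] * b t) <= G * sn2 (fun t => p.[zfun t])) ->
  ae_circle (fun t => csq (b t) <= G).
Proof.
move=> b2 G0 hb; have mb := cL2_meas b2.
have mulb r : trigset r -> cL2 (fun t => r t * b t).
  move=> Tr; have [M hM] := trigset_bnd Tr.
  by apply: cL2_bnd hM => //; exact: cL2_meas (trigset_cL2 Tr).
have s1 r : trigset r -> sn2 (fun t => r t * b t) <= G * sn2 r.
  move=> Tr; have rb2 := mulb _ Tr; have mr := cL2_meas (trigset_cL2 Tr).
  case: Tr mr rb2 => N [p ->] mr rb2.
  have p2 : cL2 (fun t => p.[zfun t]) := sH2_cL2 (sH2_poly p).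
  have pb2 : cL2 (fun t => p.[zfun t] * b t).
    apply: cL2_ae _ _ rb2; first by apply: measM => //; exact: cL2_meas.
    by apply: aeT => t _; rewrite -mulrA !csqM csq_zX mul1r.
  rewrite (@sn2_ae R _ (fun t => p.[zfun t] * b t)).
  - rewrite (@sn2_ae R (fun t => zfun t ^ (- N%:Z) * p.[zfun t]) (fun t => p.[zfun t])).
    + exact: hb.
    + exact: mr.
    + exact: cL2_meas.
    + by apply: aeT => t _; rewrite csqM csq_zX mul1r.
  - exact: cL2_meas.
  - exact: cL2_meas.
  - by apply: aeT => t _; rewrite -mulrA !csqM csq_zX mul1r.
(* Multiplication by [b] is not yet known to be continuous on [L^2], but the pairing with
   [r conj(b)] is, so the bound extends to all [c] by density. In [s3] the other argument is
   extended in the same way. *)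
have s2 r c : trigset r -> cL2 c ->
    csq (sip c (fun t => r t * Num.conj (b t))) <= G * sn2 r * sn2 c.
  move=> Tr hc; have r2 := trigset_cL2 Tr; have [M hM] := trigset_bnd Tr.
  have w2 : cL2 (fun t => r t * Num.conj (b t)).
    by apply: (cL2_bnd _ _ hM); [exact: cL2J|exact: cL2_meas].
  apply: (cls_bound trigset_cL2) (trig_dense hc) => //.
    by rewrite mulr_ge0// (n2_ge0 H).
  move=> s Ts; have s2 := trigset_cL2 Ts.
  have -> : sip s (fun t => r t * Num.conj (b t)) = sip (fun t => s t * b t) r.
    congr circle_int; apply/funext => t; rewrite rmorphM /= conjCK; ring.
  apply: le_trans (ip_CS H (mulb _ Ts) r2) _.
  rewrite [leRHS]mulrAC; apply: ler_wpM2r; first exact: (n2_ge0 H).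
  exact: s1.
have s3 c (M : R) : measc c -> ae_circle (fun t => csq (c t) <= M) ->
    sn2 (fun t => c t * b t) <= G * sn2 c.
  move=> mc hM; have c2 := cL2_ae_bnd mc hM; have cb2 : cL2 (fun t => c t * b t).
    exact: cL2_bnd hM.
  have h r : cL2 r -> csq (sip r (fun t => c t * b t)) <= G * sn2 c * sn2 r.
    move=> r2; apply: (cls_bound trigset_cL2) (trig_dense r2) => //.
      by rewrite mulr_ge0// (n2_ge0 H).
    move=> s Ts; rewrite mulrAC; apply: le_trans (s2 _ _ Ts c2).
    rewrite le_eqVlt -csqJ -cintJ; last first.
      exact: cL1M (trigset_cL2 Ts) (cL2J cb2).
    apply/orP; left; apply/eqP; congr (csq (circle_int _)); apply/funext => t.
    by rewrite !rmorphM /= !conjCK; ring.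
  have := h _ cb2; rewrite (ip_real H cb2) /csq /= expr0n addr0 expr2.
  have [h0|h0] := ltP 0 (sn2 (fun t => c t * b t)); first by rewrite ler_pM2r.
  by move=> _; apply: le_trans h0 _; rewrite mulr_ge0// (n2_ge0 H).
(* On the set where the bound fails [|b|^2 - G] is positive, yet [s3] makes its integral over this
   set nonpositive. *)
pose c : R -> C^o := fun t => if G < csq (b t) then 1 else 0.
have mc : measc c.
  have m1 : measurable_fun (@circle R) (fun t => if G < csq (b t) then 1 else 0 : R).
    apply: measurable_fun_if => //.
      exact: measurable_circle.
    by apply: measurable_fun_ltr => //; exact: meas_csq.
  split; last by apply: eq_measurable_fun (measurable_cst (0 : R)) => t _; rewrite /c; case: ifP.
  by apply: eq_measurable_fun m1 => t _; rewrite /c; case: ifP.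
have c1 : ae_circle (fun t => csq (c t) <= 1).
  by apply: aeT => t _; rewrite /c; case: ifP; rewrite ?csq1 ?csq0.
have c2 := cL2_ae_bnd mc c1.
have cb2 : cL2 (fun t => c t * b t) by exact: cL2_bnd c1.
pose u t := csq (c t * b t) + (- G) * csq (c t).
have ru : rint u.
  by apply: rintD; [exact: cb2.2|apply: rintZ; exact: c2.2].
have u0 t : 0 <= u t.
  rewrite /u /c; case: ifPn => h; first by rewrite mul1r csq1; lra.
  by rewrite mul0r csq0 mulr0 addr0.
have I0 : \int[lebesgue_measure]_(t in @circle R) u t = 0.
  apply/eqP; rewrite eq_le Rintegral_ge0// andbT.
  rewrite RI_D ?RI_Z; [|exact: c2.2|exact: cb2.2|by apply: rintZ; exact: c2.2].
  rewrite !RI_csq; have := s3 _ _ mc c1; set A := sn2 _; set B := sn2 _ => AB.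
  have -> : 2 * pi * A + - G * (2 * pi * B) = 2 * pi * (A - G * B) by ring.
  by rewrite pmulr_rle0 ?pi2_gt0// subr_le0.
have := RI_eq0 ru u0 I0; apply: aeS => t _.
rewrite /u /c; case: ltP => // h; rewrite mul1r csq1; lra.
Qed.

Lemma conjZz (a : C) (t : R) (n : int) :
  Num.conj (a * zfun t ^ n) = Num.conj a * zfun t ^ (- n).
Proof. by rewrite -zXJ -rmorphM. Qed.

Lemma fc_lin (a : C) f g n : cL2 f -> cL2 g ->
  fc (fun t => a * f t + g t) n = a * fc f n + fc g n.
Proof.
by move=> hf hg; rewrite !fcE; exact: (@si_lin _ _ _ _ H a f g _ hf hg (cL2_zX R n)).
Qed.

Lemma fcB f g n : cL2 f -> cL2 g -> fc (fun t => f t - g t) n = fc f n - fc g n.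
Proof. by move=> hf hg; rewrite !fcE; exact: (ipBl H hf hg (cL2_zX R n)). Qed.

Lemma fc_sum (I : Type) (r : seq I) (F : I -> R -> C) n : (forall i, cL2 (F i)) ->
  fc (fun t => \sum_(i <- r) F i t) n = \sum_(i <- r) fc (F i) n.
Proof.
move=> h; rewrite /fc; under eq_fun do rewrite mulr_suml.
rewrite (@cint_sum R _ _ xpredT (fun i t => F i t * zfun t ^ (- n)))// => i.
exact: cL1M (h i) (cL2_zX R _).
Qed.

Lemma fc_zXM f (m n : int) : fc (fun t => zfun t ^ m * f t) n = fc f (n - m).
Proof.
congr circle_int; apply/funext => t.
by rewrite opprB expfzDr ?zfun_neq0//; ring.
Qed.

Definition partial_sum f k : R -> C := fun t => \sum_(l < k) fc f l * zfun t ^ (l : int).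

Lemma sH2_partial f k : sH2 (partial_sum f k).
Proof.
apply: (@sH2_sum R _ _ xpredT (fun (l : 'I_k) t => fc f l * zfun t ^ (l : int))) => l.
exact: sH2Z (sH2_zX R l).
Qed.

Lemma fc_partial f k (n : nat) : fc (partial_sum f k) n = if (n < k)%N then fc f n else 0.
Proof.
rewrite (fc_sum _ (F := fun (l : 'I_k) t => fc f l * zfun t ^ (l : int))); last first.
  by move=> l; exact: cL2Z (cL2_zX R _).
under eq_bigr => l _.
  rewrite /fc; under eq_fun do rewrite -mulrA -expfzDr ?zfun_neq0//.
  rewrite cintZ; last exact: cL2_cL1 (cL2_zX R _).
  rewrite cint_zX subr_eq0 eqz_nat; over.
case: ifPn => hn.
  rewrite (bigD1 (Ordinal hn))//= eqxx mulr1 big1 ?addr0// => l.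
  by rewrite -val_eqE /= => /negPf ->; rewrite mulr0.
apply: big1 => l _; rewrite (_ : (l == n :> nat) = false) ?mulr0//.
by apply: contraNF hn => /eqP <-.
Qed.

Lemma sn2_partial f k : sn2 (partial_sum f k) = \sum_(l < k) csq (fc f l).
Proof.
rewrite /n2 /sip; under eq_fun => t.
  rewrite {2}/partial_sum rmorph_sum mulr_sumr; over.
rewrite (@cint_sum R _ _ xpredT (fun (l : 'I_k) t =>
  partial_sum f k t * Num.conj (fc f l * zfun t ^ (l : int)))); last first.
  move=> l; apply: cL1M; first exact: sH2_cL2 (sH2_partial f k).
  by apply: cL2J; exact: cL2Z (cL2_zX R _).
rewrite (eq_bigr (fun l : 'I_k => Complex (csq (fc f l)) 0)).
  by elim/big_rec2: _ => // l x y _; rewrite cReD => ->.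
move=> l _; under eq_fun do rewrite conjZz mulrCA.
rewrite cintZ; last exact: cL1M (sH2_cL2 (sH2_partial f k)) (cL2_zX R _).
by rewrite -/(fc _ _) fc_partial ltn_ord mulrC mulJ.
Qed.

(** Split [f = s + z^(k+1) r] with [s] the partial sum up to degree [k] and [r] in [H^2]: the second
    term does not contribute to the coefficient [k] of the product. *)
Lemma fc_mul f g (k : nat) : sH2 f -> sH2 g ->
  fc (fun t => f t * g t) k = \sum_(l < k.+1) fc f l * fc g (k%:Z - l%:Z).
Proof.
move=> hf hg; pose s := partial_sum f k.+1.
have hs := sH2_partial f k.+1.
pose r t := zfun t ^ (- k.+1%:Z) * (f t - s t).
have hr : sH2 r.
  have fs2 : sH2 (fun t => f t - s t) by exact: sH2B.
  split; first by apply: cL2_zXM; exact: sH2_cL2.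
  move=> n n0; rewrite fc_zXM opprK.
  have [h0|h0] := ltP (n + k.+1%:Z) 0; first by rewrite fs2.2.
  have [m hm] : exists m : nat, n + k.+1%:Z = m.
    by exists (absz (n + k.+1%:Z)); rewrite gez0_abs.
  rewrite hm.
  rewrite fcB; [|exact: sH2_cL2|exact: sH2_cL2].
  rewrite /s fc_partial (_ : (m < k.+1)%N); last by rewrite -ltz_nat -hm gtrDr.
  by rewrite subrr.
have fE t : f t = s t + zfun t ^ (k.+1%:Z) * r t.
  rewrite /r mulrA -expfzDr ?zfun_neq0// subrr expr0z mul1r.
  by rewrite addrC subrK.
transitivity (circle_int (fun t => s t * g t * zfun t ^ (- k%:Z) + r t * g t * zfun t ^ (1 : int))).
  congr circle_int; apply/funext => t; rewrite {1}fE mulrDl mulrDl; congr (_ + _).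
  rewrite [RHS](_ : _ = r t * g t * zfun t ^ (k.+1%:Z + (- k%:Z))); last first.
    by congr (_ * _ ^ _); rewrite (intS k) addrK.
  by rewrite expfzDr ?zfun_neq0//; ring.
have h1 (a b : R -> C) (n : int) : cL2 a -> cL2 b -> cL1 (fun t => a t * b t * zfun t ^ n).
  by move=> ha hb; apply: cL1_zX; exact: cL1M.
rewrite cintD; [|by apply: h1; exact: sH2_cL2|by apply: h1; exact: sH2_cL2].
rewrite (sH2_mul0 (n := 1) hr hg isT) addr0 /s /partial_sum.
under eq_fun do rewrite mulr_suml mulr_suml.
rewrite (@cint_sum R _ _ xpredT (fun (l : 'I_k.+1) t =>
  fc f l * zfun t ^ (l : int) * g t * zfun t ^ (- k%:Z))); last first.
  by move=> l; apply: h1; [exact: cL2Z (cL2_zX R _)|exact: sH2_cL2].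
apply: eq_bigr => l _; under eq_fun do rewrite -!mulrA.
rewrite cintZ; last first.
  under eq_fun do rewrite mulrA.
  by apply: h1; [exact: cL2_zX|exact: sH2_cL2].
congr (_ * _); congr circle_int; apply/funext => t.
by rewrite opprB expfzDr ?zfun_neq0//; ring.
Qed.

(** Among polynomials of the same degree the partial sum is the closest to [f], so partial sums
    approximate [f] at least as well as the polynomials of [poly_dense]. *)
Lemma sn2_le_coef f (B : R) : sH2 f ->
  (forall k, \sum_(l < k) csq (fc f l) <= B) -> sn2 f <= B.
Proof.
move=> hf hB.
have f2 := sH2_cL2 hf.
have B0 : 0 <= B by have := hB 0%N; rewrite big_ord0.
suff : snrm f <= Num.sqrt B.
  rewrite -(ler_pXn2r (n := 2)) ?nnegrE ?nrm_ge0 ?sqrtr_ge0//.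
  by rewrite (nrm_sqr H)// sqr_sqrtr.
apply: (@le_addeps _ _ 1) => // e e0; rewrite mulr1.
have [p hp] := poly_dense hf e0.
pose k := size p; pose s := partial_sum f k.
have s2 : cL2 s := sH2_cL2 (sH2_partial f k).
have p2 : cL2 (fun t => p.[zfun t]) := sH2_cL2 (sH2_poly p).
have d2 : cL2 (fun t => f t - s t) by exact: cL2B.
have e2 : cL2 (fun t => s t - p.[zfun t]) by exact: cL2B.
have orth : sip (fun t => f t - s t) (fun t => s t - p.[zfun t]) = 0.
  have E t : s t - p.[zfun t] = \sum_(l < k) (fc f l - p`_l) * zfun t ^ (l : int).
    rewrite horner_coef -sumrB; apply: eq_bigr => l _.
    by rewrite mulrBl.
  rewrite /sip; under eq_fun do rewrite E rmorph_sum mulr_sumr.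
  rewrite (@cint_sum R _ _ xpredT (fun (l : 'I_k) t =>
    (f t - s t) * Num.conj ((fc f l - p`_l) * zfun t ^ (l : int)))); last first.
    by move=> l; apply: cL1M d2 _; apply: cL2J; exact: cL2Z (cL2_zX R _).
  apply: big1 => l _; under eq_fun do rewrite conjZz mulrCA.
  rewrite cintZ; last exact: cL1M d2 (cL2_zX R _).
  have := fcB l f2 s2; rewrite fc_partial ltn_ord subrr /fc => E0.
  by rewrite [X in _ * X]E0 mulr0.
have hfs : snrm (fun t => f t - s t) <= e.
  apply: le_trans (_ : snrm (fun t => f t - p.[zfun t]) <= _); last exact: ltW.
  rewrite ler_sqrt//; last by apply: (n2_ge0 H); exact: cL2B.
  have := n2D H d2 e2; rewrite /rip orth /= mulr0 addr0.
  rewrite (_ : (fun t => f t - s t) + (fun t => s t - p.[zfun t]) =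
     (fun t => f t - p.[zfun t]) :> (R -> C^o)).
    by move=> ->; rewrite lerDl (n2_ge0 H).
  apply/funext => t; rewrite -[LHS]/(f t - s t + (s t - p.[zfun t])).
  by rewrite addrA subrK.
have := nrmD H d2 s2.
rewrite (_ : (fun t => f t - s t) + s = f :> (R -> C^o)); last first.
  by apply/funext => t; rewrite -[LHS]/(f t - s t + s t) subrK.
move/le_trans; apply; rewrite addrC lerD//.
by rewrite ler_sqrt// sn2_partial hB.
Qed.

(** The bounded increasing sums of [csq (beta l)] converge, which makes the partial sums a Cauchy
    sequence in [H^2]. *)
Lemma riesz_fischer (beta : nat -> C) (B : R) :
  (forall k, \sum_(l < k) csq (beta l) <= B) ->
  exists2 b, sH2 b & forall k : nat, fc b k = beta k.
Proof.
move=> hB.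
pose s k : R -> C^o := fun t => \sum_(l < k) beta l * zfun t ^ (l : int).
have hs k : sH2 (s k).
  apply: (@sH2_sum R _ _ xpredT (fun (l : 'I_k) t => beta l * zfun t ^ (l : int))) => l.
  exact: sH2Z (sH2_zX R l).
have fs k (n : nat) : fc (s k) n = if (n < k)%N then beta n else 0.
  rewrite (fc_sum _ (F := fun (l : 'I_k) t => beta l * zfun t ^ (l : int))); last first.
    by move=> l; exact: cL2Z (cL2_zX R _).
  under eq_bigr => l _.
    rewrite /fc; under eq_fun do rewrite -mulrA -expfzDr ?zfun_neq0//.
    rewrite cintZ; last exact: cL2_cL1 (cL2_zX R _).
    rewrite cint_zX subr_eq0 eqz_nat; over.
  case: ifPn => hn.
    rewrite (bigD1 (Ordinal hn))//= eqxx mulr1 big1 ?addr0// => l.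
    by rewrite -val_eqE /= => /negPf ->; rewrite mulr0.
  apply: big1 => l _; rewrite (_ : (l == n :> nat) = false) ?mulr0//.
  by apply: contraNF hn => /eqP <-.
pose S k : R := \sum_(l < k) csq (beta l).
have S_mono : nondecreasing_seq S.
  by apply/nondecreasing_seqP => n; rewrite /S big_ord_recr /= lerDl csq_ge0.
have S_cvg : cvgn S by apply: nondecreasing_is_cvgn => //; exists B => _ [k _ <-]; exact: hB.
have sd i j : (j <= i)%N -> sn2 (s i - s j) <= S i - S j.
  move=> ji; apply: sn2_le_coef.
    exact: sH2B.
  have fd (l : nat) : fc (s i - s j) l = if (j <= l < i)%N then beta l else 0.
    have E := fcB l (sH2_cL2 (hs i)) (sH2_cL2 (hs j)).
    rewrite [LHS]E !fs; case: (ltnP l j) => [lj|jl].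
      by rewrite (leq_trans lj ji) subrr.
    by rewrite subr0.
  move=> k; under eq_bigr do rewrite fd.
  (* Up to index [k], only the coefficients from [j] to [i - 1] count; added to [S j] they give [S]
     at [max (k, j)] truncated at [i]. *)
  rewrite lerBrDr; apply: (@le_trans _ _ (S (minn (maxn k j) i))); last first.
    by apply: S_mono; exact: geq_minr.
  elim: k => [|k ih]; first by rewrite big_ord0 add0r max0n (minn_idPl ji).
  rewrite big_ord_recr /=; case: (ltnP k j) => kj.
    rewrite /= csq0 addr0 (maxn_idPr kj).
    by move: ih; rewrite (maxn_idPr (ltnW kj)).
  case: (ltnP k i) => ki /=; last first.
    rewrite csq0 addr0 (le_trans ih)//; apply: S_mono.
    by rewrite (leq_trans (geq_minr _ _))// leq_min leqnn leq_max (leqW ki).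
  move: ih; rewrite (maxn_idPl kj) (maxn_idPl (leqW kj)) (minn_idPl ki).
  have SS : S k.+1 = S k + csq (beta k) by rewrite /S big_ord_recr.
  by rewrite SS (minn_idPl (ltnW ki)) addrAC lerD2r.
have s_cauchy : cauchy_seq (@sip R) s.
  move=> e e0; have e2 : 0 < e ^+ 2 by rewrite exprn_gt0.
  have [N _ hN] : \forall n \near \oo, `|limn S - S n| < e ^+ 2.
    by move/cvgrPdist_lt : (S_cvg : S @ \oo --> limn S); apply.
  have SL n : S n <= limn S by exact: nondecreasing_cvgn_le.
  have key i j : (N <= j)%N -> (j <= i)%N -> snrm (s i - s j) < e.
    move=> Nj ji; have d2 : cL2 (s i - s j) by apply: (siB H); exact: sH2_cL2.
    rewrite -(ltr_pXn2r (n := 2)) ?nnegrE ?nrm_ge0 ?(ltW e0)// (nrm_sqr H d2).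
    apply: le_lt_trans (sd _ _ ji) _; have := hN j Nj.
    by rewrite /= ger0_norm ?subr_ge0//; have := SL i; lra.
  exists N => i j hi hj; case: (leqP j i) => [ji|/ltnW ij]; first exact: key.
  by rewrite (nrm_sub H); [exact: key|exact: sH2_cL2|exact: sH2_cL2].
have [b hb blim] := @sH2_complete R s hs s_cauchy.
exists b => // k; apply/eqP; rewrite -subr_eq0; apply/eqP/csq_eq0/eqP.
rewrite eq_le csq_ge0 andbT leNgt; apply/negP => pos.
set d := csq _ in pos; have [|N hN] := blim (Num.sqrt d); first by rewrite sqrtr_gt0.
pose n := maxn N k.+1.
have d2 : cL2 (s n - b) by apply: (siB H); exact: sH2_cL2.
have := hN n (leq_maxl _ _).
rewrite -(ltr_pXn2r (n := 2)) ?nnegrE ?nrm_ge0 ?sqrtr_ge0// (nrm_sqr H d2) sqr_sqrtr ?csq_ge0//.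
rewrite ltNge => /negP; apply.
have := ip_CS H d2 (cL2_zX R k); rewrite -fcE (sn2_zX R) mulr1; apply: le_trans.
have E := fcB k (sH2_cL2 (hs n)) (sH2_cL2 hb).
by rewrite -/(csq _) [X in csq X]E fs leq_maxr /d -csqN opprB.
Qed.

End Multiplier.

(** * The Toeplitz corona theorem *)
Section ToeplitzCorona.
Variable R : realType.
Local Notation C := R[i].
Local Notation Fn := (R -> C^o).
Implicit Types (f g h : R -> C) (p q : R -> C).
Local Notation sn2 := (@n2 R (R -> C^o) (@sip R)).
Local Notation L2s := (@cL2 R).
Let H := sip_semi_inner R.

Lemma cJ1 : Num.conj (1 : C) = 1. Proof. exact: rmorph1. Qed.
Lemma cJ0 : Num.conj (0 : C) = 0. Proof. exact: rmorph0. Qed.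
Lemma cJM (a b : C) : Num.conj (a * b) = Num.conj a * Num.conj b.
Proof. exact: rmorphM. Qed.
Lemma cJD (a b : C) : Num.conj (a + b) = Num.conj a + Num.conj b.
Proof. exact: rmorphD. Qed.
Lemma cJB (a b : C) : Num.conj (a - b) = Num.conj a - Num.conj b.
Proof. exact: rmorphB. Qed.
Lemma cJK (a : C) : Num.conj (Num.conj a) = a. Proof. exact: conjCK. Qed.
Lemma cJ_sum (I : Type) (s : seq I) (P : pred I) (F : I -> C) :
  Num.conj (\sum_(i <- s | P i) F i) = \sum_(i <- s | P i) Num.conj (F i).
Proof. exact: rmorph_sum. Qed.

Lemma cReZ (a : R) (z : C) : complex.Re (Complex a 0 * z) = a * complex.Re z.
Proof. by rewrite cReM /= mul0r subr0. Qed.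

(** The backward shift, adjoint on [H^2] to multiplication by [z]. *)
Definition back f : R -> C := fun t => zfun t ^ (-1 : int) * (f t - fc f 0).

Lemma sH2_back f : sH2 f -> sH2 (back f).
Proof.
move=> hf; have hc : sH2 (fun=> fc f 0) by exact: sH2_cst.
have hd : sH2 (fun t => f t - fc f 0) by exact: sH2B.
split; first by apply: cL2_zXM; exact: sH2_cL2.
move=> n n0; rewrite fc_zXM opprK; have [h|h] := ltP (n + 1) 0; first by rewrite hd.2.
have -> : n + 1 = 0 by apply/eqP; rewrite eq_le h andbT -ltzD1 ltrD2r.
rewrite fcB; [|exact: sH2_cL2|exact: sH2_cL2].
rewrite [X in _ - X](_ : _ = fc f 0) ?subrr//.
by rewrite /fc; under eq_fun do rewrite oppr0 expr0z mulr1; rewrite cint_cst.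
Qed.

Lemma back_lin (a : C) f g : cL2 f -> cL2 g ->
  back (fun t => a * f t + g t) = fun t => a * back f t + back g t.
Proof. by move=> hf hg; apply/funext => t; rewrite /back fc_lin//; ring. Qed.

Lemma sip_back f g : sH2 f -> sH2 g ->
  sip f g = fc f 0 * Num.conj (fc g 0) + sip (back f) (back g).
Proof.
move=> hf hg; have bf := sH2_back hf; have bg := sH2_back hg.
have zb h : sH2 h -> cL2 (fun t => zfun t ^ (1 : int) * h t).
  by move=> hh; exact: sH2_cL2 (sH2_zXM 1 hh).
have E h t : h t = fc h 0 + zfun t ^ (1 : int) * back h t.
  by rewrite /back mulrA -expfzDr ?zfun_neq0// subrr expr0z mul1r addrC subrK.
have one (h : R -> C) : sH2 h -> sip (fun t => zfun t ^ (1 : int) * h t) (fun=> 1) = 0.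
  move=> hh; have := (sH2_zXM 1 hh).2; move=> _.
  rewrite -[RHS](hh.2 (-1))// /sip /fc; congr circle_int; apply/funext => t.
  by rewrite cJ1 mulr1 mulrC opprK.
have cst (a : C) : (fun=> a) = (a *: (fun=> 1 : C^o)) :> Fn.
  by apply/funext => t; rewrite -[RHS]/(a * 1) mulr1.
have L1 : L2s (fun=> 1) by exact: cL2_cst.
have Ef : f = ((fun=> fc f 0) + (fun t => zfun t ^ (1 : int) * back f t)) :> Fn.
  by apply/funext => t; exact: E.
have Eg : g = ((fun=> fc g 0) + (fun t => zfun t ^ (1 : int) * back g t)) :> Fn.
  by apply/funext => t; exact: E.
have zf := zb _ bf; have zg := zb _ bg.
rewrite [in LHS]Ef [in LHS]Eg (cst (fc f 0)) (cst (fc g 0)).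
have sZ (a : C) : L2s (a *: (fun=> 1 : C^o) : Fn) by exact: (siZ H).
rewrite (ipDl H)//; last by apply: (siD H).
rewrite !(ipDr H)// !(ipZl H)// !(ipZr H)//.
rewrite (si_conj H zg L1) !one// (rmorph0 Num.conj) !mulr0 addr0 add0r.
rewrite (_ : sip (fun=> 1) (fun=> 1) = 1); last first.
  by rewrite /sip; under eq_fun do rewrite mul1r rmorph1; exact: cint_cst.
rewrite mulr1; congr (_ + _); congr circle_int; apply/funext => t.
by rewrite cJM mulrACA (zXJ 1) -expfzDr ?zfun_neq0// subrr expr0z mul1r.
Qed.

Variables (n : nat) (x : 'I_n -> R -> C) (d : R).
Hypothesis hx : forall i, sHinf (x i).
Hypothesis d0 : 0 < d.
Hypothesis hd : forall p, sH2 p ->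
  d * sn2 p <= \sum_i sn2 (Pp (fun t => Num.conj (x i t) * p t)).

Definition Tx i p : R -> C := Pp (fun t => Num.conj (x i t) * p t).

Lemma cL2_xp i p : sH2 p -> cL2 (fun t => Num.conj (x i t) * p t).
Proof.
move=> hp; have [mx [M hM] _] := hx i; apply: (cL2_bnd (M := M)).
- exact: sH2_cL2.
- exact: measJ.
- by apply: aeS hM => t _; rewrite csqJ.
Qed.

Lemma Tx_H2 i p : sH2 p -> sH2 (Tx i p).
Proof. by move=> hp; apply: Pp_H2; exact: cL2_xp. Qed.

Lemma sip_Tx i p r : sH2 p -> sH2 r -> sip (Tx i p) r = sip p (fun t => x i t * r t).
Proof.
move=> hp hr; rewrite Pp_sip//; last exact: cL2_xp.
congr circle_int; apply/funext => t; rewrite cJM; ring.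
Qed.

Lemma sH2_xr i r : sH2 r -> sH2 (fun t => x i t * r t).
Proof. by move=> hr; exact: sHinf_mulH2. Qed.

Lemma fc_Tx i p : sH2 p -> fc (Tx i p) 0 = sip p (x i).
Proof.
move=> hp; rewrite fcE (_ : (fun t => zfun t ^ 0) = (fun=> 1)); last first.
  by apply/funext => t; rewrite expr0z.
rewrite sip_Tx//; last exact: sH2_cst.
by congr circle_int; apply/funext => t; rewrite mulr1.
Qed.

(** Both operators are adjoints of multiplications, by [x i] and by [z], and these commute. *)
Lemma sip_Tx_back i p r : sH2 p -> sH2 r -> sip (Tx i (back p)) r = sip (back (Tx i p)) r.
Proof.
move=> hp hr; have bp := sH2_back hp; have Tp := Tx_H2 i hp.
have zr : sH2 (fun t => zfun t ^ (1 : int) * r t) := sH2_zXM 1 hr.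
have one (s : R -> C) : sH2 s -> sip (fun=> 1) (fun t => zfun t ^ (1 : int) * s t) = 0.
  move=> hs; rewrite (si_conj H (sH2_cL2 (sH2_zXM 1 hs)) (cL2_cst 1)).
  rewrite -[RHS](rmorph0 Num.conj); congr Num.conj.
  rewrite -[RHS](hs.2 (-1))// /sip /fc; congr circle_int; apply/funext => t.
  by rewrite cJ1 mulr1 mulrC opprK.
have sb (s q : R -> C) : sH2 s -> sH2 q ->
    sip (back s) q = sip s (fun t => zfun t ^ (1 : int) * q t).
  move=> hs hq.
  transitivity (sip (fun t => s t - fc s 0) (fun t => zfun t ^ (1 : int) * q t)).
    congr circle_int; apply/funext => t; rewrite /back cJM zXJ; ring.
  have zq := sH2_cL2 (sH2_zXM 1 hq).
  have := ipBl H (sH2_cL2 hs) (cL2_cst (fc s 0)) zq; move=> ->.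
  rewrite (_ : (fun=> fc s 0) = (fc s 0 *: (fun=> 1 : C^o)) :> Fn); last first.
    by apply/funext => t; rewrite -[RHS]/(_ * 1) mulr1.
  by rewrite (ipZl H (fc s 0) (cL2_cst (1 : C)) zq) one// mulr0 subr0.
rewrite sip_Tx// sb//; last exact: sH2_xr.
rewrite sb// sip_Tx//; congr circle_int; apply/funext => t.
by rewrite !cJM; ring.
Qed.

(** With [1 / d] the form [Lf] would be nonnegative; the factor 2 makes it dominate the norm of
    [H^2], which gives completeness of [br]. *)
Let G := 2 / d.

Lemma G_gt0 : 0 < G. Proof. by rewrite divr_gt0. Qed.

(** The form of [G T T' - I], where [T] is the row of multiplications by the [x i] and [T'] its
    adjoint, whose components are the [Tx i]. The form [br] adds the rank one form of evaluation at
    0. *)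
Definition Lf p q : C := Complex G 0 * (\sum_i sip (Tx i p) (Tx i q)) - sip p q.
Definition br p q : C := Lf p q + fc p 0 * Num.conj (fc q 0).

(** Under [back], which commutes with [Tx i], the product [sip] loses the constant terms of [p] and
    [q], and the [i]-th summand loses those of [Tx i p] and [Tx i q]. Moving the negative loss to
    the left leaves a nonnegative form on each side, as the lurking isometry requires. *)
Lemma Lf_back p q : sH2 p -> sH2 q -> br p q =
  Lf (back p) (back q) +
  Complex G 0 * \sum_i sip p (x i) * Num.conj (sip q (x i)).
Proof.
move=> hp hq; rewrite /br /Lf (sip_back hp hq).
have -> : \sum_i sip (Tx i p) (Tx i q) =
    \sum_i sip p (x i) * Num.conj (sip q (x i)) +
    \sum_i sip (Tx i (back p)) (Tx i (back q)).
  rewrite -big_split /=; apply: eq_bigr => i _.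
  have Tp := Tx_H2 i hp; have Tq := Tx_H2 i hq.
  rewrite (sip_back Tp Tq) !fc_Tx//; congr (_ + _).
  have bTp := sH2_back Tp; have bTq := sH2_back Tq.
  have Tbp := Tx_H2 i (sH2_back hp); have Tbq := Tx_H2 i (sH2_back hq).
  rewrite sip_Tx_back//.
  rewrite (si_conj H (sH2_cL2 Tbq) (sH2_cL2 bTp)) sip_Tx_back//.
  by rewrite -(si_conj H (sH2_cL2 bTq) (sH2_cL2 bTp)).
by rewrite mulrDr; ring.
Qed.

Lemma Tx_lin i (a : C) p q r : sH2 p -> sH2 q -> sH2 r ->
  sip (Tx i (fun t => a * p t + q t)) r = a * sip (Tx i p) r + sip (Tx i q) r.
Proof.
move=> hp hq hr; rewrite !sip_Tx//; last exact: sH2_lin.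
exact: (@si_lin _ _ _ _ H a p q _ (sH2_cL2 hp) (sH2_cL2 hq) (sH2_cL2 (sH2_xr i hr))).
Qed.

Lemma Re_sum (I : Type) (s : seq I) (F : I -> C) :
  complex.Re (\sum_(i <- s) F i) = \sum_(i <- s) complex.Re (F i).
Proof. by elim/big_rec2: _ => // i y z _ <-; rewrite cReD. Qed.

Lemma Lf_ge p : sH2 p -> sn2 p <= complex.Re (Lf p p).
Proof.
move=> hp; rewrite /Lf cReD cReN cReZ Re_sum.
have := hd hp; rewrite -(ler_pM2l (x := d^-1)) ?invr_gt0// mulKf ?gt_eqF// => h.
have E : 2 / d = d^-1 + d^-1 by rewrite mulr_natl mulr2n.
move: h; rewrite /n2 /G /Tx E mulrDl; lra.
Qed.

Lemma Lf_semi_inner : @semi_inner R Fn (@sH2 R) Lf.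
Proof.
split.
- exact: sH2_0.
- by move=> a p q; exact: sH2_lin.
- move=> a p q r hp hq hr; rewrite /Lf.
  rewrite (@si_lin _ _ _ _ H a p q r (sH2_cL2 hp) (sH2_cL2 hq) (sH2_cL2 hr)).
  rewrite (eq_bigr (fun i => a * sip (Tx i p) (Tx i r) + sip (Tx i q) (Tx i r))).
    by rewrite big_split /= -mulr_sumr; ring.
  by move=> i _; apply: Tx_lin => //; exact: Tx_H2.
- move=> p q hp hq; rewrite /Lf cJB cJM cJ_sum.
  rewrite -(si_conj H (sH2_cL2 hp) (sH2_cL2 hq)); congr (_ * _ - _).
    by apply/complexP => //=; rewrite oppr0.
  apply: eq_bigr => i _; apply: (si_conj H); apply: sH2_cL2; exact: Tx_H2.
- move=> p hp; apply: le_trans (Lf_ge hp); apply: (n2_ge0 H); exact: sH2_cL2.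
Qed.

Lemma br_semi_inner : @semi_inner R Fn (@sH2 R) br.
Proof.
have HL := Lf_semi_inner; split.
- exact: sH2_0.
- by move=> a p q; exact: sH2_lin.
- move=> a p q r hp hq hr; rewrite /br (@si_lin _ _ _ _ HL a p q r)//.
  by rewrite (fc_lin a 0 (sH2_cL2 hp) (sH2_cL2 hq)); ring.
- move=> p q hp hq; rewrite /br (@si_conj _ _ _ _ HL p q)//.
  by rewrite cJD cJM cJK [in RHS]mulrC.
- move=> p hp; rewrite /br (cReD (Lf _ _)) mulJ /= addr_ge0 ?csq_ge0//; exact: (si_ge0 HL).
Qed.

Let HL := Lf_semi_inner.
Let HB := br_semi_inner.

Lemma br_ge p : sH2 p -> sn2 p <= n2 br p.
Proof.
move=> hp; apply: le_trans (Lf_ge hp) _; rewrite /n2 /br (cReD (Lf _ _)) mulJ /= lerDl.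
exact: csq_ge0.
Qed.

Lemma Lf_le_br p : sH2 p -> n2 Lf p <= n2 br p.
Proof. by move=> hp; rewrite /n2 /br (cReD (Lf _ _)) mulJ /= lerDl csq_ge0. Qed.

Lemma br_bound : exists2 K : R, 0 < K & forall p, sH2 p -> n2 br p <= K * sn2 p.
Proof.
have [M hM] := choice (fun i => let: And3 _ h _ := hx i in h).
exists (G * (\sum_i `|M i|) + 1) => [|p hp].
  by rewrite ltr_wpDl// mulr_ge0 ?(ltW G_gt0)// sumr_ge0.
have p0 : 0 <= sn2 p by apply: (n2_ge0 H); exact: sH2_cL2.
rewrite /n2 /br (cReD (Lf _ _)) mulJ /Lf cReD cReN cReZ Re_sum [complex.Re (Complex _ _)]/=.
have h1 : csq (fc p 0) <= sn2 p.
  have := ip_CS H (sH2_cL2 hp) (cL2_zX R 0).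
  by rewrite -fcE (sn2_zX R) mulr1.
have h2 : \sum_i complex.Re (sip (Tx i p) (Tx i p)) <= (\sum_i `|M i|) * sn2 p.
  rewrite mulr_suml; apply: ler_sum => i _.
  apply: le_trans (sn2_Pp_le (cL2_xp i hp)) _.
  rewrite !sn2E mulrCA ler_pM2l ?invr_gt0 ?pi2_gt0// -RI_Z; last exact: (sH2_cL2 hp).2.
  rewrite /Rintegral; apply: fine_le.
  - by apply: integrable_fin_num; [exact: measurable_circleR|exact: (cL2_xp i hp).2].
  - by apply: integrable_fin_num; [exact: measurable_circleR|apply: rintZ; exact: (sH2_cL2 hp).2].
  apply: ae_ge0_le_integral.
  - exact: measurable_circleR.
  - by move=> t _; rewrite lee_fin csq_ge0.
  - exact: (measurable_int lebesgue_measure (cL2_xp i hp).2).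
  - by move=> t _; rewrite lee_fin mulr_ge0 ?csq_ge0.
  - exact: (measurable_int lebesgue_measure (rintZ `|M i| (sH2_cL2 hp).2)).
  - apply: (@filterS _ _ (ae_filter_ringOfSetsType lebesgue_measure)) (hM i) => t h ct.
    rewrite lee_fin csqM csqJ ler_wpM2r ?csq_ge0// (le_trans (h ct))//; exact: ler_norm.
have : G * \sum_i complex.Re (sip (Tx i p) (Tx i p)) <= G * ((\sum_i `|M i|) * sn2 p).
  by rewrite ler_pM2l ?G_gt0.
rewrite mulrDl mul1r -mulrA; move: h1; rewrite /n2; lra.
Qed.

(** The form [br] lies between the squared norm of [H^2] and a multiple of it, so both have the same
    Cauchy sequences and limits. *)
Lemma br_complete : @complete_form R Fn (@sH2 R) br.
Proof.
have HH := sH2_semi_inner R.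
have [K K0 hK] := br_bound.
move=> u uE uC.
have [|l hl lim] := @sH2_complete R u uE.
  move=> e e0; have [N hN] := uC e e0; exists N => i j hi hj.
  apply: le_lt_trans (hN i j hi hj); rewrite /nrm ler_sqrt; last first.
    by apply: (n2_ge0 HB); apply: (siB HB).
  by apply: br_ge; apply: (siB HB).
exists l => // e e0; have [|N hN] := lim (e / Num.sqrt K).
  by rewrite divr_gt0 ?sqrtr_gt0.
exists N => k /hN h; have hd2 : sH2 (u k - l) by apply: (siB HB).
have sK : 0 < Num.sqrt K by rewrite sqrtr_gt0.
apply: le_lt_trans (_ : Num.sqrt K * nrm (@sip R) (u k - l) < _).
  by rewrite /nrm -sqrtrM ?(ltW K0)// ler_sqrt ?hK// mulr_ge0 ?(ltW K0) ?(n2_ge0 HH).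
by rewrite mulrC -ltr_pdivlMr.
Qed.

Definition inpair (v : Fn * 'rV[C]_n) (w : Fn * 'rV[C]_n) : C :=
  Lf v.1 w.1 + Complex G 0 * \sum_i v.2 0 i * Num.conj (w.2 0 i).

Lemma inpair_semi_inner :
  @semi_inner R (Fn * 'rV[C]_n)%type [set v | sH2 v.1] inpair.
Proof.
split.
- exact: sH2_0.
- by move=> a p q; exact: sH2_lin.
- move=> a [p c] [q e] [r s] /= hp hq hr; rewrite /inpair /=.
  rewrite (@si_lin _ _ _ _ HL a p q r)//.
  rewrite (eq_bigr (fun i => a * (c 0 i * Num.conj (s 0 i)) + e 0 i * Num.conj (s 0 i))).
    by rewrite big_split /= -mulr_sumr; ring.
  by move=> i _; rewrite !mxE; ring.
- move=> [p c] [q e] /= hp hq; rewrite /inpair /= (@si_conj _ _ _ _ HL p q)//.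
  rewrite cJD cJM cJ_sum; congr (_ + _ * _).
    by apply/complexP => //=; rewrite oppr0.
  by apply: eq_bigr => i _; rewrite cJM cJK mulrC.
- move=> [p c] /= hp; rewrite /inpair /= (cReD (Lf _ _)) addr_ge0 ?(si_ge0 HL)//.
  rewrite cReZ mulr_ge0 ?(ltW G_gt0)// Re_sum sumr_ge0// => i _.
  by rewrite mulJ csq_ge0.
Qed.

Let HP := inpair_semi_inner.

(* The lurking isometry, from [br] to [inpair]. *)
Definition lurk p : Fn * 'rV[C]_n := (back p : Fn, \row_i sip p (x i)).

Lemma br_lurk p q : sH2 p -> sH2 q -> br p q = inpair (lurk p) (lurk q).
Proof.
move=> hp hq; rewrite Lf_back// /inpair /=; congr (_ + _ * _).
by apply: eq_bigr => i _; rewrite !mxE.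
Qed.

Lemma lurk_lin (a : C) p q : sH2 p -> sH2 q ->
  lurk (fun t => a * p t + q t) = a *: lurk p + lurk q.
Proof.
move=> hp hq; rewrite /lurk back_lin; [|exact: sH2_cL2|exact: sH2_cL2].
congr pair; apply/rowP => i; rewrite !mxE.
exact: (@si_lin _ _ _ _ H a p q _ (sH2_cL2 hp) (sH2_cL2 hq) (sHinf_cL2 (hx i))).
Qed.

(** The adjoint of [lurk] applied to [v], provided by Riesz representation in the complete form
    [br]. *)
Lemma step_exists (v : Fn * 'rV[C]_n) : sH2 v.1 ->
  exists2 w, sH2 w & forall q, sH2 q -> br w q = inpair v (lurk q).
Proof.
move=> hv.
have lurkE q : sH2 q -> [set v | sH2 v.1] (lurk q) by move=> hq; exact: sH2_back.
apply: (@riesz R Fn (@sH2 R) br HB (fun q => inpair v (lurk q)) (n2 inpair v) br_complete).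
- move=> a p q hp hq; rewrite (lurk_lin a hp hq).
  rewrite (ipDr HP) ?(ipZr HP)//; try exact: lurkE.
  by apply: (siZ HP); exact: lurkE.
- move=> q hq; have := ip_CS HP hv (lurkE _ hq).
  by rewrite {2}/n2 -(br_lurk hq hq).
Qed.

Lemma step_total (v : Fn * 'rV[C]_n) : exists w : Fn, sH2 v.1 -> sH2 w /\
  forall q, sH2 q -> br w q = inpair v (lurk q).
Proof.
have [hv|] := pselect (sH2 v.1); last by exists (fun=> 0).
by have [w hw1 hw2] := step_exists hv; exists w.
Qed.

(** The adjoint of an isometry is a contraction: [br w w] equals the pairing of [v] with [lurk w],
    whose norm is that of [w]. *)
Lemma step_le v w : sH2 v.1 -> sH2 w ->
  (forall q, sH2 q -> br w q = inpair v (lurk q)) -> n2 br w <= n2 inpair v.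
Proof.
move=> hv hw E; have hlw : [set v | sH2 v.1] (lurk w) by exact: sH2_back.
have := rip_CS HP hv hlw; rewrite /rip -E// -/(n2 br w).
rewrite [X in _ <= _ * X](_ : _ = n2 br w); last by rewrite /n2 (br_lurk hw hw).
have [w0|w0] := ltP 0 (n2 br w); first by rewrite expr2 ler_pM2r.
by move=> _; apply: le_trans w0 _; exact: (n2_ge0 HP).
Qed.

Lemma eval_exists : exists2 e, sH2 e & forall p, sH2 p -> br p e = fc p 0.
Proof.
have [|p hp|e he hE] := @riesz R Fn (@sH2 R) br HB (fun p => Num.conj (fc p 0)) 1
  br_complete.
- move=> a p q hp hq.
  by rewrite (fc_lin a 0 (sH2_cL2 hp) (sH2_cL2 hq)) cJD cJM.
- rewrite mul1r -/(csq _) csqJ; apply: le_trans (br_ge hp).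
  have := ip_CS H (sH2_cL2 hp) (cL2_zX R 0).
  by rewrite -fcE (sn2_zX R) mulr1.
exists e => // p hp; rewrite (@si_conj _ _ _ _ HB e p)// hE//.
by rewrite cJK.
Qed.

Lemma next_exists f : exists e, sH2 f ->
  sH2 e /\ forall p, sH2 p -> br p e = Lf p (back f).
Proof.
have [hf|] := pselect (sH2 f); last by exists f.
have bf := sH2_back hf.
have [|p hp|e he hE] := @riesz R Fn (@sH2 R) br HB (Lf (back f)) (n2 Lf (back f))
  br_complete.
- move=> a p q hp hq.
  by rewrite (ipDr HL) ?(ipZr HL)//; apply: (siZ HL).
- apply: le_trans (ip_CS HL bf hp) _.
  apply: ler_wpM2l; first exact: (n2_ge0 HL).
  exact: Lf_le_br.
exists e => _; split => // p hp; rewrite (@si_conj _ _ _ _ HB e p)// hE//.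
by rewrite -(@si_conj _ _ _ _ HL (back f) p).
Qed.

(** The output functional pulled back in time: pairing a state with [e j.+1] is the same as pairing
    with [e j] the state that follows it under zero input. *)
Lemma eval_seq_exists : exists e : nat -> R -> C, [/\ forall j, sH2 (e j),
  forall p, sH2 p -> br p (e 0%N) = fc p 0 &
  forall j p, sH2 p -> br p (e j.+1) = Lf p (back (e j))].
Proof.
have [e0 he0 e0E] := eval_exists.
have [nx nxP] := choice next_exists.
pose e j := iter j nx e0.
have he j : sH2 (e j) by elim: j => [|j ih] //=; exact: (nxP _ ih).1.
by exists e; split => // j p hp; exact: (nxP _ (he j)).2.
Qed.

(* The adjoint of [lurk] is a contraction; [traj] runs it as a linear system
   with inputs [c k], states [xs k] and outputs [fc (xs k.+1) 0]. *)
Definition traj (c : nat -> 'rV[C]_n) (xs : nat -> R -> C) : Prop :=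
  [/\ xs 0%N = (fun=> 0), forall k, sH2 (xs k) &
      forall k q, sH2 q -> br (xs k.+1) q = inpair (xs k : Fn, c k) (lurk q)].

Lemma traj_exists c : exists xs, traj c xs.
Proof.
have [st stP] := choice step_total.
pose xs := fix xs k : Fn := if k is k'.+1 then st (xs k', c k') else fun=> 0.
exists xs.
have hxs k : sH2 (xs k).
  by elim: k => [|k ih] /=; [exact: sH2_0|exact: (stP (xs k, c k) ih).1].
by split => // k q hq; exact: (stP (xs k, c k) (hxs k)).2.
Qed.

(** The contraction inequalities of the steps add up. The induction keeps track of the stored energy
    [n2 Lf (xs k)]: the [br] norm of a new state is its output energy plus its stored energy. *)
Lemma energy c xs : traj c xs -> forall k,
  \sum_(l < k) csq (fc (xs l.+1) 0) <= G * \sum_(l < k) \sum_i csq (c l 0 i).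
Proof.
move=> [xs0 hxs xsE] k.
suff : \sum_(l < k) csq (fc (xs l.+1) 0) + n2 Lf (xs k) <=
    G * \sum_(l < k) \sum_i csq (c l 0 i).
  by apply: le_trans; rewrite lerDl; exact: (n2_ge0 HL).
elim: k => [|k ih].
  by rewrite !big_ord0 mulr0 add0r xs0 /n2 (ip0l HL (sH2_0 R)).
rewrite !big_ord_recr /= mulrDr.
have := step_le (v := (xs k : Fn, c k)) (hxs k) (hxs k.+1) (xsE k).
rewrite {1}/n2 /br (cReD (Lf _ _)) mulJ /= -/(n2 Lf _) /n2 /inpair (cReD (Lf _ _)) cReZ Re_sum.
have E : \sum_i complex.Re ((xs k : Fn, c k).2 0 i * Num.conj ((xs k : Fn, c k).2 0 i)) =
    \sum_i csq (c k 0 i) by apply: eq_bigr => i _; rewrite mulJ.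
rewrite E.
move: ih; rewrite /n2; lra.
Qed.

Section Impulse.
Variable e : nat -> R -> C.
Hypothesis he : forall j, sH2 (e j).
Hypothesis e0E : forall p, sH2 p -> br p (e 0%N) = fc p 0.
Hypothesis eE : forall j p, sH2 p -> br p (e j.+1) = Lf p (back (e j)).

(** The impulse response of the system: the output after [j] further steps to a unit input in
    channel [i]. *)
Definition beta j i : C := Complex G 0 * Num.conj (sip (e j) (x i)).

(** Unrolls the recursion: every step trades [e j] for [e j.+1] on the previous state and leaves the
    term of the current input. The truncated [k.-1] matters only when the sum is not empty. *)
Lemma traj_out c xs : traj c xs -> forall k j, br (xs k) (e j) =
  \sum_(l < k) \sum_i beta (j + l)%N i * c (k.-1 - l)%N 0 i.
Proof.
move=> [xs0 hxs xsE]; elim=> [|k ih] j.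
  by rewrite big_ord0 xs0; exact: (ip0l HB (he j)).
rewrite xsE// /inpair /= -eE// ih big_ord_recl /= addn0 subn0 addrC; congr (_ + _).
  rewrite mulr_sumr; apply: eq_bigr => i _; rewrite !mxE /beta; ring.
apply: eq_bigr => l _; apply: eq_bigr => i _.
rewrite addSnnS; congr (_ * c _ _ _); rewrite /bump /= add1n.
by case: k l {ih} => [[]//|k l] /=; rewrite subSS.
Qed.

Lemma traj_fc0 c xs : traj c xs -> forall k, fc (xs k.+1) 0 =
  \sum_(l < k.+1) \sum_i beta l i * c (k - l)%N 0 i.
Proof.
move=> T k; have [_ hxs _] := T; rewrite -e0E//.
exact: (traj_out T k.+1 0%N).
Qed.

(** Convolution with the impulse response is bounded on square summable sequences. A unit impulse as
    input will give square summability of [beta], and the coefficients of a polynomial will give a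
    multiplier bound. *)
Lemma impulse_energy (a : nat -> C) i k :
  \sum_(l < k) csq (\sum_(m < l.+1) beta m i * a (l - m)%N) <=
  G * \sum_(l < k) csq (a l).
Proof.
pose c l : 'rV[C]_n := a l *: delta_mx 0 i.
have [xs T] := traj_exists c; have := energy T k.
have cE l : \sum_j csq (c l 0 j) = csq (a l).
  rewrite (bigD1 i)//= /c !mxE !eqxx mulr1 big1 ?addr0// => j ji.
  by rewrite !mxE (negPf ji) mulr0 csq0.
under eq_bigr do rewrite (traj_fc0 T).
under [in X in _ <= _ * X]eq_bigr do rewrite cE.
apply: le_trans; rewrite le_eqVlt; apply/orP; left; apply/eqP.
apply: eq_bigr => l _; congr csq; apply: eq_bigr => m _.
rewrite (bigD1 i)//= /c !mxE !eqxx mulr1 big1 ?addr0// => j ji.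
by rewrite !mxE (negPf ji) mulr0 mulr0.
Qed.

(** Conjugates are taken because the inputs of the shift trajectory are the conjugate coefficients
    of the [x i]. *)
Lemma impulse_exists i : exists b, sH2 b /\ forall k : nat, fc b k = Num.conj (beta k i).
Proof.
suff [b h1 h2] : exists2 b, sH2 b & forall k : nat, fc b k = Num.conj (beta k i).
  by exists b.
apply: (@riesz_fischer R _ G) => k.
apply: le_trans (_ : G * \sum_(l < k) csq ((l == 0%N :> nat)%:R : C) <= _).
  apply: le_trans (impulse_energy (fun l => (l == 0%N)%:R) i k).
  apply: ler_sum => l _; rewrite csqJ big_ord_recr /= subnn mulr1 big1 ?add0r// => m _.
  by rewrite subn_eq0 leqNgt ltn_ord mulr0.
case: k => [|k]; first by rewrite big_ord0 mulr0 ltW// G_gt0.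
by rewrite big_ord_recl big1 /= ?addr0 ?csq1 ?mulr1// => l _; rewrite csq0.
Qed.

Lemma bessel (f : R -> C) k : sH2 f -> \sum_(l < k) csq (fc f l) <= sn2 f.
Proof.
move=> hf; rewrite -sn2_partial; have hs := sH2_partial f k.
have hd2 : sH2 (fun t => f t - partial_sum f k t) by exact: sH2B.
have := n2B H (sH2_cL2 hf) (sH2_cL2 hs).
have -> : rip (@sip R) f (partial_sum f k) = sn2 (partial_sum f k).
  rewrite /rip {1}/sip /partial_sum; under eq_fun do rewrite cJ_sum mulr_sumr.
  rewrite (@cint_sum R _ _ xpredT (fun (l : 'I_k) t =>
    f t * Num.conj (fc f l * zfun t ^ (l : int)))); last first.
    move=> l; apply: cL1M; first exact: sH2_cL2.
    by apply: cL2J; exact: cL2Z (cL2_zX R _).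
  rewrite -/(partial_sum f k) sn2_partial Re_sum; apply: eq_bigr => l _.
  under eq_fun do rewrite conjZz mulrCA.
  rewrite cintZ; last exact: cL1M (sH2_cL2 hf) (cL2_zX R _).
  by rewrite -/(fc f l) mulrC mulJ.
have h3 := n2_ge0 H (sH2_cL2 hd2) => h2.
move: h3; rewrite [X in 0 <= X](h2 : _ = _); lra.
Qed.

Lemma fc_impulse (b : R -> C) i (f : R -> C) (k : nat) : sH2 b ->
  (forall k : nat, fc b k = Num.conj (beta k i)) -> sH2 f ->
  fc (fun t => b t * f t) k = \sum_(l < k.+1) Num.conj (beta l i) * fc f (k - l)%N.
Proof.
move=> hb bE hf; rewrite (fc_mul k hb hf); apply: eq_bigr => l _.
by rewrite bE subzn// -ltnS ltn_ord.
Qed.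

(** The energy bound, fed with the conjugate coefficients of a polynomial, is the hypothesis of
    [mul_bound]. *)
Lemma impulse_sHinf (b : R -> C) i : sH2 b ->
  (forall k : nat, fc b k = Num.conj (beta k i)) -> sHinf b.
Proof.
move=> hb bE; apply: (sH2_sHinf hb).
apply: (mul_bound (sH2_cL2 hb) (ltW G_gt0)) => p _.
have hp : sH2 (fun t => p.[zfun t]) := sH2_poly p.
have bp : sH2 (fun t => p.[zfun t] * b t) by apply: sHinf_mulH2 => //; exact: sHinf_poly.
apply: sn2_le_coef => // k.
apply: le_trans (_ : G * \sum_(l < k) csq (Num.conj (fc (fun t => p.[zfun t]) l)) <= _); last first.
  rewrite ler_pM2l ?G_gt0//; under eq_bigr do rewrite csqJ.
  exact: bessel.
apply: le_trans (impulse_energy (fun l => Num.conj (fc (fun t => p.[zfun t]) l)) i k).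
apply: ler_sum => l _; rewrite -csqJ.
rewrite (_ : (fun t => p.[zfun t] * b t) = (fun t => b t * p.[zfun t])); last first.
  by apply/funext => t; rewrite mulrC.
rewrite (fc_impulse _ hb bE)// cJ_sum le_eqVlt; apply/orP; left; apply/eqP; congr csq.
by apply: eq_bigr => m _; rewrite cJM cJK.
Qed.

Lemma back_zX (k : nat) : back (fun t => zfun t ^ (k : int)) =
  if k is k'.+1 then fun t => zfun t ^ (k' : int) else fun=> 0.
Proof.
apply/funext => t; rewrite /back fcE sip_zX.
case: k => [|k]; first by rewrite eqxx expr0z subrr mulr0.
by rewrite subr0 -expfzDr ?zfun_neq0//; congr (_ ^ _); rewrite (intS k) addKr.
Qed.

(* The shifts [z^k] form a trajectory whose outputs are [1, 0, 0, ...]. *)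
Lemma shift_traj : traj (fun k => \row_i sip (fun t => zfun t ^ (k : int)) (x i))
  (fun k => if k is k'.+1 then fun t => zfun t ^ (k' : int) else fun=> 0).
Proof.
split => //.
  by case=> [|k]; [exact: sH2_0|exact: sH2_zX].
move=> k q hq; rewrite br_lurk//; last exact: sH2_zX.
by rewrite {1}/lurk back_zX.
Qed.

(** The outputs of the shift trajectory are computed twice: as the constant terms of the powers of
    [z], and as the convolution of [beta] with the conjugate coefficients of [x]. *)
Lemma impulse_inverse (b : 'I_n -> R -> C) : (forall i, sH2 (b i)) ->
  (forall i (k : nat), fc (b i) k = Num.conj (beta k i)) ->
  forall k : nat, \sum_i fc (fun t => b i t * x i t) k = (k == 0%N)%:R.
Proof.
move=> hb bE k; have := traj_fc0 shift_traj k; rewrite fcE sip_zX => E.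
rewrite -[RHS](conjC_nat C (k == 0%N)) (_ : (k == 0%N)%:R = ((k : int) == 0)%:R :> C)// E.
rewrite cJ_sum; under eq_bigr => i _ do
  rewrite (fc_impulse k (hb i) (bE i) (sHinf_sH2 (hx i))).
rewrite exchange_big /=; apply: eq_bigr => l _; rewrite cJ_sum; apply: eq_bigr => i _.
rewrite cJM !mxE; congr (_ * _).
by rewrite fcE (si_conj H (cL2_zX R _) (sHinf_cL2 (hx i))).
Qed.

End Impulse.

Theorem toeplitz_corona : exists b : 'I_n -> R -> C,
  (forall i, sHinf (b i)) /\
  ae_circle (fun t => \sum_i b i t * x i t = 1).
Proof.
have [e [he e0E eE]] := eval_seq_exists.
have [b hb] := choice (impulse_exists he e0E eE).
have binf i : sHinf (b i) := impulse_sHinf he e0E eE (hb i).1 (hb i).2.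
exists b; split => //.
have bx2 i : sH2 (fun t => b i t * x i t).
  by apply: sHinf_mulH2 => //; exact: sHinf_sH2.
have S2 : sH2 (fun t => \sum_i b i t * x i t).
  exact: (@sH2_sum R _ _ xpredT (fun i t => b i t * x i t)).
have D2 : sH2 (fun t => \sum_i b i t * x i t - 1) by apply: sH2B => //; exact: sH2_cst.
have := coef_unique (sH2_cL2 D2).
have D0 m : fc (fun t => \sum_i b i t * x i t - 1) m = 0.
  case: m => [m|m]; last by rewrite D2.2.
  rewrite fcB; [|exact: sH2_cL2|exact: cL2_cst].
  rewrite (fc_sum _ (F := fun i t => b i t * x i t)); last by move=> i; exact: sH2_cL2.
  rewrite (impulse_inverse he e0E eE (fun i => (hb i).1) (fun i => (hb i).2)).
  rewrite [X in _ - X](_ : _ = (m == 0%N)%:R) ?subrr//.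
  have := sip_zX R 0 m; rewrite /sip /fc => E; rewrite eq_sym -[RHS]E.
  by congr circle_int; apply/funext => t; rewrite expr0z zXJ mul1r.
by move=> /(_ D0); apply: aeS => t _ /eqP; rewrite subr_eq0 => /eqP.
Qed.

End ToeplitzCorona.

(** * Matrix functions *)
Section MatrixFunctions.
Variable R : realType.
Local Notation C := R[i].
Local Notation snrm := (@nrm R (R -> C^o) (@sip R)).
Local Notation sn2 := (@n2 R (R -> C^o) (@sip R)).
Local Notation mu := (@lebesgue_measure R).

Definition entry k l (F : matfun R k l) i j : R -> C := fun t => F t i j.

Lemma rint_sum (I : Type) (r : seq I) (F : I -> R -> R) :
  (forall i, rint (F i)) -> rint (fun t => \sum_(i <- r) F i t).
Proof.
move=> h; elim: r => [|a r ih].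
  under eq_fun do rewrite big_nil; exact: rint_cst.
by under eq_fun do rewrite big_cons; exact: rintD.
Qed.

Lemma sqnormE k l (A : 'M[C]_(k, l)) : sqnorm A = \sum_i \sum_j csq (A i j).
Proof. by []. Qed.

Lemma csq_sqnorm k l (A : 'M[C]_(k, l)) i j : csq (A i j) <= sqnorm A.
Proof.
rewrite sqnormE (bigD1 i)//= (bigD1 j)//= -addrA lerDl addr_ge0//.
  by rewrite sumr_ge0// => *; exact: csq_ge0.
by rewrite sumr_ge0// => *; rewrite sumr_ge0// => *; exact: csq_ge0.
Qed.

Lemma sqnorm_ge0 k l (A : 'M[C]_(k, l)) : 0 <= sqnorm A.
Proof. by rewrite sqnormE sumr_ge0// => *; rewrite sumr_ge0// => *; exact: csq_ge0. Qed.

Lemma L2P k l (F : matfun R k l) : L2 F <-> forall i j, cL2 (entry F i j).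
Proof.
split=> [[mF iF] i j|h].
  have [m1 m2] := mF i j; split; first by split.
  apply: rint_dom iF _; first exact: meas_csq.
  by apply: aeT => t _; rewrite ger0_norm ?csq_ge0// csq_sqnorm.
split; first by move=> i j; have [] := h i j.
have : rint (fun t => \sum_i \sum_j csq (entry F i j t)).
  by apply: rint_sum => i; apply: rint_sum => j; have [] := h i j.
by [].
Qed.

Lemma H2P k l (F : matfun R k l) : H2 F <-> forall i j, sH2 (entry F i j).
Proof.
split=> [[/L2P hF F0] i j|h].
  by split => // n /F0 /matrixP /(_ i j); rewrite !mxE.
split; first by apply/L2P => i j; have [] := h i j.
move=> n n0; apply/matrixP => i j; rewrite !mxE; exact: (h i j).2.
Qed.

Lemma LinfP k l (F : matfun R k l) : Linf F <-> forall i j,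
  measc (entry F i j) /\ exists M, ae_circle (fun t => csq (F t i j) <= M).
Proof.
split=> [[mF [M hM]] i j|h].
  split; first by have [] := mF i j.
  exists (M ^+ 2); apply: aeS hM => t _ h; apply: le_trans (csq_sqnorm _ i j) _.
  rewrite -[leLHS]sqr_sqrtr ?sqnorm_ge0// ler_pXn2r// nnegrE ?sqrtr_ge0//.
  by apply: le_trans h; exact: sqrtr_ge0.
split; first by move=> i j; have [] := h i j.
have [M hM] := choice (fun ij : 'I_k * 'I_l => (h ij.1 ij.2).2).
exists (Num.sqrt (\sum_i \sum_j M (i, j))).
apply: aeS (ae_all hM) => t _ H; rewrite ler_wsqrtr// sqnormE.
by apply: ler_sum => i _; apply: ler_sum => j _; exact: (H (i, j)).
Qed.

Lemma HinfP k l (F : matfun R k l) : Hinf F <-> forall i j, sHinf (entry F i j).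
Proof.
split=> [[/LinfP hF F0] i j|h].
  have [m1 m2] := hF i j; split => // n /F0 /matrixP /(_ i j); by rewrite !mxE.
split; first by apply/LinfP => i j; have [] := h i j.
move=> n n0; apply/matrixP => i j; rewrite !mxE; by have [_ _ /(_ n n0)] := h i j.
Qed.

Lemma l2norm_nrm k l (F : matfun R k l) : l2norm F = nrm (@l2inner R k l) F.
Proof.
rewrite /l2norm /nrm /n2 /l2inner /=; congr (Num.sqrt (_ * _)).
apply: eq_Rintegral => t _; rewrite Re_sum sqnormE; apply: eq_bigr => i _.
by rewrite Re_sum; apply: eq_bigr => j _; rewrite mulJ.
Qed.

Lemma l2innerE k l (F G : matfun R k l) : L2 F -> L2 G ->
  l2inner F G = \sum_i \sum_j sip (entry F i j) (entry G i j).
Proof.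
move=> /L2P hF /L2P hG; rewrite /l2inner cint_sum; last first.
  move=> i; apply: cL1_sum => j.
  by apply: (@cL1M _ (entry F i j)) => //; apply: (@cL2J _ (entry G i j)).
apply: eq_bigr => i _; rewrite cint_sum// => j.
by apply: (@cL1M _ (entry F i j)) => //; apply: (@cL2J _ (entry G i j)).
Qed.

Lemma L2_lin k l (a : C) (F G : matfun R k l) : L2 F -> L2 G ->
  L2 (fun t => a *: F t + G t).
Proof.
move=> /L2P hF /L2P hG; apply/L2P => i j.
rewrite (_ : entry _ i j = fun t => a * entry F i j t + entry G i j t).
  by apply: cL2D => //; exact: cL2Z.
by apply/funext => t; rewrite /entry !mxE.
Qed.

Lemma L2_semi_inner k l : @semi_inner R (matfun R k l) (@L2 R k l) (@l2inner R k l).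
Proof.
have H := sip_semi_inner R.
split.
- by apply/L2P => i j; rewrite (_ : entry _ i j = fun=> 0) ?mxE; [exact: cL2_cst|
    apply/funext => t; rewrite /entry mxE].
- by move=> a F G; exact: L2_lin.
- move=> a F G K hF hG hK; rewrite !l2innerE//; last exact: L2_lin.
  rewrite mulr_sumr -big_split /=; apply: eq_bigr => i _.
  rewrite mulr_sumr -big_split /=; apply: eq_bigr => j _.
  have := @si_lin _ _ _ _ H a (entry F i j) (entry G i j) (entry K i j)
    ((L2P _).1 hF i j) ((L2P _).1 hG i j) ((L2P _).1 hK i j).
  move=> <-; congr circle_int; apply/funext => t; congr (_ * _).
  by rewrite /entry [in LHS]mxE [in LHS]mxE.
- move=> F G hF hG; rewrite !l2innerE// cJ_sum; apply: eq_bigr => i _.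
  rewrite cJ_sum; apply: eq_bigr => j _.
  exact: (si_conj H ((L2P _).1 hF i j) ((L2P _).1 hG i j)).
- move=> F hF; rewrite l2innerE// Re_sum sumr_ge0// => i _.
  rewrite Re_sum sumr_ge0// => j _; exact: (si_ge0 H ((L2P _).1 hF i j)).
Qed.

Lemma n2_l2 k l (F : matfun R k l) : L2 F ->
  n2 (@l2inner R k l) F = \sum_i \sum_j sn2 (entry F i j).
Proof.
move=> hF; rewrite /n2 l2innerE// Re_sum; apply: eq_bigr => i _.
by rewrite Re_sum.
Qed.

Lemma snrm_entry k l (F : matfun R k l) i j : L2 F -> snrm (entry F i j) <= l2norm F.
Proof.
move=> hF; have H := sip_semi_inner R.
have p a b : 0 <= sn2 (entry F a b) by exact: (n2_ge0 H ((L2P _).1 hF a b)).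
rewrite l2norm_nrm /nrm ler_wsqrtr// n2_l2//.
rewrite (bigD1 i)//= (bigD1 j)//= -addrA lerDl addr_ge0//.
  by rewrite sumr_ge0.
by rewrite sumr_ge0// => *; rewrite sumr_ge0.
Qed.

Lemma entry_smx (f : R -> C) i j : entry (smx f) i j = f.
Proof. by apply/funext => t; rewrite /entry /smx mxE !ord1 eqxx. Qed.

Lemma H2_smx (f : R -> C) : H2 (smx f) <-> sH2 f.
Proof.
split=> [/H2P /(_ 0 0)|h]; first by rewrite entry_smx.
by apply/H2P => i j; rewrite entry_smx.
Qed.

Lemma Hinf_smx (f : R -> C) : Hinf (smx f) <-> sHinf f.
Proof.
split=> [/HinfP /(_ 0 0)|h]; first by rewrite entry_smx.
by apply/HinfP => i j; rewrite entry_smx.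
Qed.

Lemma l2norm_smx (f : R -> C) : l2norm (smx f) = snrm f.
Proof.
rewrite l2norm_nrm /nrm /n2; congr (Num.sqrt (complex.Re (circle_int _))).
by apply/funext => t; rewrite !big_ord1 /smx mxE.
Qed.

Lemma outerH2_outers (h : R -> C) : outerH2 h -> outers h.
Proof.
move=> [/H2_smx h2 d]; split => // g /H2_smx hg e /(d _ hg)[p hp].
by exists p; rewrite -l2norm_smx.
Qed.

Lemma inner_smx (th : R -> C) : inner (smx th) <->
  sHinf th /\ ae_circle (fun t => csq (th t) = 1).
Proof.
have E t : (conjmf (smx th t))^T *m smx th t = (Complex (csq (th t)) 0)%:M.
  apply/matrixP => i j; rewrite !ord1 !mxE big_ord1 !mxE eqxx !mulr1n mulrC.
  exact: mulJ.
split=> -[h1 h2]; split; [exact/Hinf_smx| |exact/Hinf_smx|].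
  by apply: aeS h2 => t _; rewrite E => /matrixP /(_ 0 0); rewrite !mxE => -[].
by apply: aeS h2 => t _ h; rewrite E h.
Qed.

Lemma H2minusP m (F : matfun R m 1) : H2minus F <-> forall i, sH2m (entry F i 0).
Proof.
split=> [[hF F0] i|h].
  have /L2P eF := hF; split => // g hg.
  pose G : matfun R m 1 := fun t => \col_a (if a == i then g t else 0).
  have eG a b : entry G a b = if a == i then g else fun=> 0.
    by apply/funext => t; rewrite /entry mxE; case: eqP.
  have hG : H2 G by apply/H2P => a b; rewrite eG; case: eqP => // _; exact: sH2_0.
  have := F0 _ hG; rewrite l2innerE//; last by case: hG.
  rewrite (bigD1 i)//= big_ord1 eG eqxx big1 ?addr0// => a ai.
  rewrite big_ord1 eG (negPf ai) /sip; under eq_fun do rewrite cJ0 mulr0.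
  exact: cint_cst.
have hF : L2 F by apply/L2P => i j; rewrite !ord1; have [] := h i.
split => // G hG; rewrite l2innerE//; last by case: hG.
rewrite big1// => i _; rewrite big_ord1; apply: (h i).2; exact: ((H2P _).1 hG).
Qed.

End MatrixFunctions.

(** * Values in the disk *)
Section Poisson.
Variable R : realType.
Local Notation C := R[i].
Local Notation snrm := (@nrm R (R -> C^o) (@sip R)).
Variables (zeta : C) (hz : `|zeta| < 1).

Lemma norm_csq (z : C) : `|z| ^+ 2 = Complex (csq z) 0.
Proof. by rewrite normCK mulJ. Qed.

Lemma csq_lt1 : csq zeta < 1.
Proof.
have : `|zeta| ^+ 2 < 1 by rewrite exprn_ilt1.
by rewrite norm_csq ltcE /= => /andP[].
Qed.

(** The Szegő kernel at [zeta], which is in [H^2] as a geometric series. *)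
Definition cauchy_ker (t : R) : C := (1 - Num.conj zeta * zfun t)^-1.

Lemma csq_sub_ge (w : C) : csq w < 1 -> (1 - Num.sqrt (csq w)) ^+ 2 <= csq (1 - w).
Proof.
move=> w1; have := cabs_le (1 - w) w; rewrite subrK csq1 sqrtr1 -lerBlDr => h.
rewrite -[leRHS]sqr_sqrtr ?csq_ge0// ler_pXn2r ?nnegrE ?sqrtr_ge0// subr_ge0.
by rewrite -sqrtr1 ler_wsqrtr// ltW.
Qed.

Lemma csq_w t : csq (Num.conj zeta * zfun t) = csq zeta.
Proof. by rewrite csqM csqJ csq_z mulr1. Qed.

Lemma sqrt_csq_lt1 : Num.sqrt (csq zeta) < 1.
Proof. by rewrite -[ltRHS]sqrtr1 ltr_sqrt// csq_lt1. Qed.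

Lemma den_neq0 t : 1 - Num.conj zeta * zfun t != 0.
Proof.
have := @csq_sub_ge (Num.conj zeta * zfun t); rewrite csq_w => /(_ csq_lt1).
apply: contraTneq => ->; rewrite csq0 -ltNge exprn_gt0// subr_gt0.
exact: sqrt_csq_lt1.
Qed.

Lemma csqV (z : C) : z != 0 -> csq z^-1 = (csq z)^-1.
Proof.
move=> z0; have := csqM z z^-1; rewrite divff// csq1 => E.
have c0 : csq z != 0 by apply: contra_neq z0; exact: csq_eq0.
by apply: (mulfI c0); rewrite -E divff.
Qed.

Lemma cauchy_ker_bnd : exists M, forall t, csq (cauchy_ker t) <= M.
Proof.
exists ((1 - Num.sqrt (csq zeta)) ^- 2) => t.
rewrite /cauchy_ker csqV ?den_neq0// lef_pV2 ?posrE.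
- by have := @csq_sub_ge (Num.conj zeta * zfun t); rewrite csq_w; apply; exact: csq_lt1.
- rewrite lt_neqAle csq_ge0 andbT eq_sym; apply: contra_neq (den_neq0 t); exact: csq_eq0.
- by rewrite exprn_gt0// subr_gt0 sqrt_csq_lt1.
Qed.

Lemma meas_cauchy_ker : measc cauchy_ker.
Proof.
apply: measV; apply: measB; first exact: meas_cst.
by apply: measM; [exact: meas_cst|exact: meas_z].
Qed.

Lemma cL2_cauchy_ker : cL2 cauchy_ker.
Proof.
have [M hM] := cauchy_ker_bnd.
apply: (cL2_ae_bnd (M := M)); first exact: meas_cauchy_ker.
by apply: aeT => t _.
Qed.

Lemma geom_tail m t : cauchy_ker t -
    (\sum_(l < m) (Num.conj zeta ^+ l) *: 'X^l).[zfun t] =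
  (Num.conj zeta * zfun t) ^+ m * cauchy_ker t.
Proof.
have d := den_neq0 t.
rewrite /cauchy_ker; apply: (mulIf d); rewrite mulrBl mulVf// mulfVK//.
rewrite horner_sum.
have -> : \sum_(l < m) (Num.conj zeta ^+ l *: 'X^l).[zfun t] =
    \sum_(l < m) (Num.conj zeta * zfun t) ^+ l.
  by apply: eq_bigr => l _; rewrite hornerZ hornerXn exprMn.
have := subrX1 (Num.conj zeta * zfun t) m => E.
move: E; set s := \sum_(i < m) _; set w := _ * zfun t => E.
by rewrite -[RHS](subrK 1) E; ring.
Qed.

Lemma sH2_cauchy_ker : sH2 cauchy_ker.
Proof.
have H := sip_semi_inner R.
apply: sH2_approx; first exact: cL2_cauchy_ker.
move=> e e0.
have c0 : 0 <= snrm cauchy_ker by exact: nrm_ge0.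
have r0 : 0 <= Num.sqrt (csq zeta) by exact: sqrtr_ge0.
have [m hm] : exists m, Num.sqrt (csq zeta) ^+ m * snrm cauchy_ker < e.
  have : (fun m => Num.sqrt (csq zeta) ^+ m * snrm cauchy_ker) @ \oo --> (0 : R).
    rewrite -[X in _ --> X](mul0r (snrm cauchy_ker)); apply: cvgM; last exact: cvg_cst.
    by apply: cvg_expr; rewrite ger0_norm// sqrt_csq_lt1.
  move/cvgrPdist_lt => /(_ e e0) [m _ /(_ m (leqnn m))] h; exists m.
  by move: h; rewrite /= sub0r normrN ger0_norm// mulr_ge0// exprn_ge0.
exists (fun t => (\sum_(l < m) (Num.conj zeta ^+ l) *: 'X^l).[zfun t]); first exact: sH2_poly.
apply: le_lt_trans hm.
rewrite (_ : _ - _ = fun t => (Num.conj zeta * zfun t) ^+ m * cauchy_ker t); last first.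
  by apply/funext => t; exact: geom_tail.
have Ec t : csq ((Num.conj zeta * zfun t) ^+ m) = csq zeta ^+ m.
  by elim: m => [|m ih]; rewrite ?csq1// !exprS csqM ih csq_w.
rewrite le_eqVlt; apply/orP; left; apply/eqP.
rewrite {1}/nrm sn2E.
rewrite (_ : (fun t => csq _) = (fun t => csq zeta ^+ m * csq (cauchy_ker t))); last first.
  by apply/funext => t; rewrite csqM Ec.
rewrite RI_Z; last by have [] := cL2_cauchy_ker.
rewrite mulrCA -sn2E sqrtrM ?exprn_ge0 ?csq_ge0//; congr (_ * _).
rewrite -[X in Num.sqrt (X ^+ _)](sqr_sqrtr (csq_ge0 zeta)) -exprM mulnC exprM.
by rewrite sqrtr_sqr ger0_norm// exprn_ge0.
Qed.

Definition poisson_ker (t : R) : C := (1 - `|zeta| ^+ 2) / `|zfun t - zeta| ^+ 2.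

Lemma zJ t : Num.conj (zfun t) * zfun t = 1 :> C.
Proof. by rewrite mulrC mulJ csq_z. Qed.

Lemma poisson_kerE t : poisson_ker t =
  (1 - `|zeta| ^+ 2) * (cauchy_ker t * Num.conj (cauchy_ker t)).
Proof.
rewrite /poisson_ker; congr (_ * _); rewrite mulJ /cauchy_ker csqV ?den_neq0// norm_csq.
have -> : csq (zfun t - zeta) = csq (1 - Num.conj zeta * zfun t).
  rewrite -[in RHS]csqJ cJB cJ1 cJM cJK -[LHS]mulr1 -(csq_z t) -[X in _ * X]csqJ -csqM.
  by rewrite mulrBl [X in X - _]mulrC zJ.
set c := csq _; have c0 : c != 0.
  apply: contra_neq (den_neq0 t); exact: csq_eq0.
have q0 : Complex c 0 != 0 :> C by apply: contra_neq c0 => -[].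
apply: (mulfI q0); rewrite divff//; apply/complexP; rewrite ?cReM ?cImM /=.
  by rewrite divff// mulr0 subr0.
by rewrite mulr0 mul0r addr0.
Qed.

Lemma cauchy_ker_rec t : cauchy_ker t = 1 + Num.conj zeta * zfun t * cauchy_ker t.
Proof.
by rewrite -[X in X + _](divff (den_neq0 t)) -/(cauchy_ker t) -mulrDl subrK mul1r.
Qed.

Lemma poisson_ker_sum t : poisson_ker t = cauchy_ker t + Num.conj (cauchy_ker t) - 1.
Proof.
have d := den_neq0 t; have d' : Num.conj (1 - Num.conj zeta * zfun t) != 0.
  by apply: contra_neq d => h; rewrite -[LHS]cJK h cJ0.
rewrite poisson_kerE /cauchy_ker fmorphV.
have E : Num.conj (Num.conj zeta * zfun t) * (Num.conj zeta * zfun t) = `|zeta| ^+ 2.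
  by rewrite mulrC mulJ csq_w norm_csq.
move: d d' E; rewrite cJB cJ1; set w := _ * zfun t; set w' := Num.conj w => d d' <-.
by field; rewrite d d'.
Qed.

Lemma poisson_ker_bnd : exists M, forall t, csq (poisson_ker t) <= M.
Proof.
have [M hM] := cauchy_ker_bnd; exists (csq (1 - `|zeta| ^+ 2) * (M * M)) => t.
rewrite poisson_kerE !csqM csqJ ler_wpM2l ?csq_ge0//.
by apply: ler_pM => //; exact: csq_ge0.
Qed.

Lemma meas_poisson_ker : measc poisson_ker.
Proof.
rewrite (_ : poisson_ker = fun t => cauchy_ker t + Num.conj (cauchy_ker t) - 1); last first.
  by apply/funext => t; exact: poisson_ker_sum.
apply: measB; last exact: meas_cst.
by apply: measD; [|apply: measJ]; exact: meas_cauchy_ker.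
Qed.

Definition pval (f : R -> C) : C := circle_int (fun t => f t * poisson_ker t).

Lemma cL2_poisson f : cL2 f -> cL2 (fun t => f t * poisson_ker t).
Proof.
move=> hf; have [M hM] := poisson_ker_bnd; under eq_fun do rewrite mulrC.
apply: (cL2_bnd (M := M) hf meas_poisson_ker); exact: aeT.
Qed.

Lemma pval1 : pval (fun=> 1) = 1.
Proof.
have hc := cL2_cL1 cL2_cauchy_ker; have hJ := cL1J hc.
have c1 : circle_int cauchy_ker = 1.
  rewrite (_ : cauchy_ker = fun t => Num.conj zeta * (zfun t ^ (1 : int) * cauchy_ker t) + 1).
    rewrite cintD; [|apply: cL1Z|exact: cL1_cst]; last first.
      by apply: cL2_cL1; apply: cL2_zXM; exact: cL2_cauchy_ker.
    rewrite cintZ; last by apply: cL2_cL1; apply: cL2_zXM; exact: cL2_cauchy_ker.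
    rewrite cint_cst (_ : circle_int _ = 0) ?mulr0 ?add0r//.
    rewrite -(sH2_cauchy_ker.2 (-1))//; congr circle_int; apply/funext => t.
    by rewrite mulrC opprK.
  by apply/funext => t; rewrite {1}cauchy_ker_rec addrC mulrA.
rewrite /pval; under eq_fun do rewrite mul1r poisson_ker_sum.
rewrite cintB; [|exact: cL1D|exact: cL1_cst].
by rewrite cintD// cintJ// c1 cint_cst cJ1 addrK.
Qed.

(** On the circle [(z - zeta)] times the conjugate of the Szegő kernel is [z]. So [(z - zeta)] times
    the Poisson kernel is a multiple of [z] times the Szegő kernel, and integrates to 0 against
    [H^2]. *)
Lemma pval_z g : sH2 g -> pval (fun t => zfun t * g t) = zeta * pval g.
Proof.
move=> hg; have hP := cL2_poisson (sH2_cL2 hg).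
rewrite /pval -cintZ; last exact: cL2_cL1.
apply/eqP; rewrite -subr_eq0 -cintB.
- rewrite (_ : (fun t => _) = fun t => (1 - `|zeta| ^+ 2) *
      (g t * cauchy_ker t * zfun t ^ (1 : int))); last first.
    apply/funext => t; rewrite poisson_kerE -[zfun t ^ 1]/(zfun t).
    have d' : Num.conj (1 - Num.conj zeta * zfun t) != 0.
      by apply: contra_neq (den_neq0 t) => h; rewrite -[LHS]cJK h cJ0.
    have E : (zfun t - zeta) * Num.conj (cauchy_ker t) = zfun t.
      apply: (mulIf d'); rewrite /cauchy_ker fmorphV mulfVK//.
      by rewrite cJB cJ1 cJM cJK mulrBr mulr1 mulrCA [zfun t * _]mulrC zJ mulr1.
    rewrite -[in RHS]E; ring.
  rewrite cintZ; last first.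
    rewrite (_ : (fun t => _) = fun t => g t * (zfun t ^ (1 : int) * cauchy_ker t)).
      exact: cL1M (sH2_cL2 hg) (cL2_zXM 1 cL2_cauchy_ker).
    by apply/funext => t; rewrite mulrA mulrAC.
  by rewrite (sH2_mul0 hg sH2_cauchy_ker)// mulr0.
- apply: cL2_cL1; under eq_fun do rewrite -mulrA.
  by have := cL2_zXM 1 hP.
- by apply: cL1Z; exact: cL2_cL1.
Qed.

Lemma pval_zX g (n : nat) : sH2 g -> pval (fun t => zfun t ^ (n : int) * g t) = zeta ^+ n * pval g.
Proof.
move=> hg; elim: n => [|n ih].
  by rewrite mul1r; congr pval; apply/funext => t; rewrite expr0z mul1r.
rewrite exprS -mulrA -ih -pval_z; last exact: sH2_zXM.
by congr pval; apply/funext => t; rewrite mulrA -[_ ^ n.+1]/(_ ^+ _.+1) exprS.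
Qed.

(** The function [w], the Poisson kernel times [g] minus its value at [zeta], integrates to 0
    against every [z^n], hence by density against [f]. *)
Lemma pvalM f g : sHinf f -> sHinf g -> pval (fun t => f t * g t) = pval f * pval g.
Proof.
move=> hf hg.
have P1 := cL2_poisson (cL2_cst (1 : C)).
have Pg := cL2_poisson (sHinf_cL2 hg).
pose w t := (g t - pval g) * poisson_ker t.
have hw : cL2 w.
  by apply: cL2_poisson; apply: cL2B; [exact: sHinf_cL2|exact: cL2_cst].
have gz (n : nat) : circle_int (fun t => zfun t ^ (n : int) * w t) = 0.
  have h1 : cL1 (fun t => zfun t ^ (n : int) * (g t * poisson_ker t)).
    by apply: cL2_cL1; exact: cL2_zXM.
  have h2 : cL1 (fun t => zfun t ^ (n : int) * (1 * poisson_ker t)).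
    by apply: cL2_cL1; exact: cL2_zXM.
  rewrite (_ : (fun t => _) = fun t => zfun t ^ (n : int) * (g t * poisson_ker t) -
      pval g * (zfun t ^ (n : int) * (1 * poisson_ker t))); last first.
    by apply/funext => t; rewrite /w; ring.
  rewrite cintB//; last exact: cL1Z.
  rewrite cintZ//.
  have E u : circle_int (fun t => zfun t ^ (n : int) * (u t * poisson_ker t)) =
      pval (fun t => zfun t ^ (n : int) * u t).
    by congr circle_int; apply/funext => t; rewrite mulrA.
  rewrite (E g) (E (fun=> 1)) !pval_zX; [|exact: sH2_cst|exact: sHinf_sH2].
  by rewrite pval1 mulr1 mulrC subrr.
have := cint_approx0 (sHinf_sH2 hf) hw gz.
have hfP := cL2_poisson (sHinf_cL2 hf); have hfg := sHinf_sH2 (sHinfM hf hg).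
have hfgP := cL2_poisson (sH2_cL2 hfg).
rewrite (_ : (fun t => f t * w t) = fun t => f t * g t * poisson_ker t -
  pval g * (f t * poisson_ker t)); last by apply/funext => t; rewrite /w; ring.
rewrite cintB; [|exact: cL2_cL1|apply: cL1Z; exact: cL2_cL1].
rewrite cintZ; last exact: cL2_cL1.
by move=> /eqP; rewrite subr_eq0 => /eqP E; rewrite [RHS]mulrC; exact: E.
Qed.

(** Left invertibility is tested inside the disk, while inverses are found on the circle;
    multiplicativity of the Poisson integral on [H^oo] connects the two. *)
Lemma disk_value_inverse k l (G : matfun R l k) (F : matfun R k l) :
  Hinf G -> Hinf F -> ae_circle (fun t => G t *m F t = 1%:M) ->
  disk_value G zeta *m disk_value F zeta = 1%:M.
Proof.
move=> /HinfP hG /HinfP hF GF; apply/matrixP => i j; rewrite !mxE.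
under eq_bigr => a _ do rewrite !mxE -/(pval (entry G i a)) -/(pval (entry F a j)) -pvalM//.
rewrite /pval -cint_sum; last first.
  move=> a; apply: cL2_cL1; apply: cL2_poisson; apply: sHinf_cL2; exact: sHinfM.
rewrite (@cint_ae _ _ (fun t => (i == j)%:R * (1 * poisson_ker t))).
- rewrite cintZ ?pval1; last by apply: cL2_cL1; apply: cL2_poisson; exact: cL2_cst.
  by have := pval1; rewrite /pval => ->; rewrite mulr1.
- apply: meas_sum => a; apply: measM; last exact: meas_poisson_ker.
  by have [] := sHinfM (hG i a) (hF a j).
- by apply: measM; [exact: meas_cst|apply: measM; [exact: meas_cst|exact: meas_poisson_ker]].
apply: aeS GF => t _ /matrixP /(_ i j); rewrite !mxE => <-.
by rewrite mul1r mulr_suml.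
Qed.

End Poisson.
(** * Left inverses of co-outer complements *)
Section LeftInverse.
Variable R : realType.
Local Notation C := R[i].
Local Notation snrm := (@nrm R (R -> C^o) (@sip R)).
Local Notation sn2 := (@n2 R (R -> C^o) (@sip R)).
Local Notation L2s := (@cL2 R).

Definition sbnd (f : R -> C) : Prop :=
  measc f /\ exists M, ae_circle (fun t => csq (f t) <= M).

Lemma sHinf_bnd (f : R -> C) : sHinf f -> sbnd f.
Proof. by case. Qed.

Lemma sbndD (f g : R -> C) : sbnd f -> sbnd g -> sbnd (fun t => f t + g t).
Proof.
move=> [mf [M hM]] [mg [N hN]]; split; first exact: measD.
exists (2 * M + 2 * N); apply: aeS2 hM hN => t _ h1 h2.
by apply: le_trans (csqD_le _ _) _; rewrite lerD// ler_pM2l.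
Qed.

Lemma sbndM (f g : R -> C) : sbnd f -> sbnd g -> sbnd (fun t => f t * g t).
Proof.
move=> [mf [M hM]] [mg [N hN]]; split; first exact: measM.
exists (M * N); apply: aeS2 hM hN => t _ h1 h2.
by rewrite csqM ler_pM// csq_ge0.
Qed.

Lemma sbnd_cst (c : C) : sbnd (fun=> c).
Proof. by split; [exact: meas_cst|exists (csq c); exact: aeT]. Qed.

Lemma sbndB (f g : R -> C) : sbnd f -> sbnd g -> sbnd (fun t => f t - g t).
Proof.
move=> hf hg; have := sbndD hf (sbndM (sbnd_cst (-1)) hg).
by under eq_fun do rewrite mulN1r.
Qed.

Lemma sbndJ (f : R -> C) : sbnd f -> sbnd (fun t => Num.conj (f t)).
Proof.
move=> [mf [M hM]]; split; first exact: measJ.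
by exists M; apply: aeS hM => t _; rewrite csqJ.
Qed.

Lemma sbnd_sum (I : Type) (r : seq I) (F : I -> R -> C) :
  (forall i, sbnd (F i)) -> sbnd (fun t => \sum_(i <- r) F i t).
Proof.
move=> h; elim: r => [|a r ih].
  under eq_fun do rewrite big_nil; exact: sbnd_cst.
by under eq_fun do rewrite big_cons; exact: sbndD.
Qed.

Lemma sbnd_mulL2 (b f : R -> C) : sbnd b -> cL2 f -> cL2 (fun t => b t * f t).
Proof. by move=> [mb [M hM]] hf; exact: (cL2_bnd (M := M)). Qed.

Lemma sn2_mul_le (b f : R -> C) M : measc b -> ae_circle (fun t => csq (b t) <= M) ->
  cL2 f -> sn2 (fun t => b t * f t) <= M * sn2 f.
Proof.
move=> mb hM hf; have bf := cL2_bnd hf mb hM.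
rewrite !sn2E mulrCA ler_pM2l ?invr_gt0 ?pi2_gt0// -RI_Z; last exact: hf.2.
rewrite /Rintegral; apply: fine_le.
- by apply: integrable_fin_num; [exact: measurable_circleR|exact: bf.2].
- by apply: integrable_fin_num; [exact: measurable_circleR|apply: rintZ; exact: hf.2].
apply: ae_ge0_le_integral.
- exact: measurable_circleR.
- by move=> t _; rewrite lee_fin csq_ge0.
- exact: (measurable_int lebesgue_measure bf.2).
- move=> t _; rewrite lee_fin mulr_ge0 ?csq_ge0//.
  by have [s] := ae_exists hM; apply: le_trans; exact: csq_ge0.
- exact: (measurable_int lebesgue_measure (rintZ M hf.2)).
- apply: (@filterS _ _ (ae_filter_ringOfSetsType lebesgue_measure)) hM => t h ct.
  by rewrite lee_fin csqM ler_wpM2r ?csq_ge0// (h ct).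
Qed.

Lemma snrm_mul_le (b f : R -> C) M : measc b -> ae_circle (fun t => csq (b t) <= M) ->
  cL2 f -> snrm (fun t => b t * f t) <= Num.sqrt M * snrm f.
Proof.
move=> mb hM hf; have M0 : 0 <= M.
  by have [t] := ae_exists hM; apply: le_trans; exact: csq_ge0.
by rewrite /nrm -sqrtrM// ler_wsqrtr// sn2_mul_le.
Qed.

Lemma snrm_sum (I : Type) (r : seq I) (F : I -> R -> C) : (forall i, cL2 (F i)) ->
  snrm (fun t => \sum_(i <- r) F i t) <= \sum_(i <- r) snrm (F i).
Proof.
have H := sip_semi_inner R.
move=> h; elim: r => [|a r ih].
  rewrite big_nil /nrm sn2E; under eq_fun do rewrite big_nil csq0.
  by rewrite RI_cst mul0r mulr0 sqrtr0.
rewrite big_cons; under eq_fun do rewrite big_cons.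
apply: le_trans (lerD (lexx _) ih).
exact: (nrmD H (h a) (cL2_sum r xpredT h)).
Qed.

Variables (k : nat) (xi : matfun R k.+1 1) (Xc : matfun R k.+1 k) (b : 'I_k.+1 -> R -> C).
Hypothesis hxi : Hinf xi.
Hypothesis hXc : Hinf Xc.
Hypothesis oXc : co_outer Xc.
Hypothesis hU : ae_circle (fun t => row_mx (xi t) (conjmf (Xc t)) \is unitarymx).
Hypothesis hb : forall i, sHinf (b i).
Hypothesis bxi : ae_circle (fun t => \sum_i b i t * xi t i 0 = 1).

(** The adjoint matrix stacks the adjoint of [v] on the transpose of [F]. Its product with the
    unitary matrix in one order gives the first identity, in the other order the remaining two. *)
Lemma unitary_row (v : 'M[C]_(k.+1, 1)) (F : 'M[C]_(k.+1, k)) :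
  row_mx v (conjmf F) \is unitarymx ->
  [/\ v *m (conjmf v)^T + conjmf F *m F^T = 1%:M, F^T *m v = 0 & F^T *m conjmf F = 1%:M].
Proof.
move=> /unitarymxP hu.
have E : (row_mx v (conjmf F) ^t*)%sesqui = col_mx (conjmf v)^T F^T.
  rewrite tr_row_mx map_col_mx; congr col_mx; apply/matrixP => i j; rewrite !mxE//.
  exact: cJK.
rewrite E in hu.
have h : col_mx (conjmf v)^T F^T *m row_mx v (conjmf F) = (1%:M : 'M[C]_(1 + k)).
  exact: (mulmx1C hu).
rewrite mul_col_row [1%:M](@scalar_mx_block _ 1 k) in h.
split; first by rewrite -mul_row_col.
  move/eq_block_mx: h => [_ _ + _]; exact.
by move/eq_block_mx: h => [_ _ _ +].
Qed.

Let brow t : 'rV[C]_k.+1 := \row_i b i t.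
Let M t : 'M[C]_(k.+1, k) := (1%:M - xi t *m brow t) *m conjmf (Xc t).

(** Unitarity turns [conj(F) F^T] into [I] minus a multiple [v v'] of the column [v], and [I - v B]
    annihilates [v] because [B v = 1]. *)
Lemma compl_mul (v : 'M[C]_(k.+1, 1)) (F : 'M[C]_(k.+1, k)) (B : 'rV[C]_k.+1) :
  row_mx v (conjmf F) \is unitarymx -> B *m v = 1%:M ->
  forall f : 'cV[C]_k.+1, (1%:M - v *m B) *m conjmf F *m (F^T *m f) = (1%:M - v *m B) *m f.
Proof.
move=> /unitary_row[h1 _ _] Bv f.
have -> : (1%:M - v *m B) *m conjmf F *m (F^T *m f) =
    (1%:M - v *m B) *m (conjmf F *m F^T) *m f by rewrite !mulmxA.
have -> : conjmf F *m F^T = 1%:M - v *m (conjmf v)^T by rewrite -h1 addrC addKr.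
congr (_ *m _); rewrite mulmxBr mulmx1 mulmxA mulmxBl mul1mx -(mulmxA v B v) Bv mulmx1.
by rewrite subrr mul0mx subr0.
Qed.

Lemma ae_brow : ae_circle (fun t => brow t *m xi t = 1%:M).
Proof.
apply: aeS bxi => t _ h; apply/matrixP => i j; rewrite !ord1 !mxE eqxx -[RHS]h.
by apply: eq_bigr => a _; rewrite mxE.
Qed.

Lemma entry_M a l : entry M a l = fun t => Num.conj (Xc t a l) -
  xi t a 0 * \sum_c b c t * Num.conj (Xc t c l).
Proof.
apply/funext => t; rewrite /entry /M mulmxBl mul1mx -mulmxA !mxE big_ord1; congr (_ - _ * _).
by rewrite !mxE; apply: eq_bigr => c _; rewrite !mxE.
Qed.

Lemma M_bnd a l : sbnd (entry M a l).
Proof.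
have hx := (HinfP _).1 hxi; have hX := (HinfP _).1 hXc.
rewrite entry_M; apply: sbndB; first by apply: sbndJ; exact: sHinf_bnd (hX a l).
apply: sbndM; first exact: sHinf_bnd (hx a 0).
apply: sbnd_sum => c; apply: sbndM; first exact: sHinf_bnd.
by apply: sbndJ; exact: sHinf_bnd (hX c l).
Qed.

Lemma sbnd_cL2 (f : R -> C) : sbnd f -> cL2 f.
Proof. by move=> [mf [N hN]]; exact: (cL2_ae_bnd (M := N)). Qed.

(* [M e_l] is approximated by [M Xc^T f = (I - xi b) f], with [Xc^T f] close
   to [e_l]. *)
Lemma M_H2 a l : sH2 (entry M a l).
Proof.
have hx := (HinfP _).1 hxi; have hX := (HinfP _).1 hXc.
have MB a' l' := M_bnd a' l'.
have [K hK] := choice (fun l' : 'I_k => (MB a l').2).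
apply: sH2_approx; first exact: sbnd_cL2.
move=> e e0; pose S := \sum_l' Num.sqrt (K l').
have S0 : 0 <= S by rewrite sumr_ge0// => *; exact: sqrtr_ge0.
have S1 : 0 < S + 1 by rewrite ltr_wpDl.
have eS : 0 < e / (S + 1) by rewrite divr_gt0.
have hg : H2 (fun=> delta_mx l 0 : 'cV[C]_k).
  apply/H2P => i j; rewrite (_ : entry _ i j = fun=> ((i == l) && (j == 0))%:R); last first.
    by apply/funext => t; rewrite /entry mxE.
  exact: sH2_cst.
have [f hf fe] := oXc.2 _ hg _ eS; have hfe := (H2P _).1 hf.
pose r : matfun R k 1 := fun t => (Xc t)^T *m f t - delta_mx l 0.
have rE l' : entry r l' 0 = fun t => \sum_c Xc t c l' * f t c 0 - ((l' == l) && true)%:R.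
  by apply/funext => t; rewrite /entry /r !mxE; congr (_ - _); apply: eq_bigr => c _; rewrite mxE.
have r2 : L2 r.
  apply/L2P => i j; rewrite ord1 rE; apply: cL2B; last exact: cL2_cst.
  apply: cL2_sum => c; apply: sbnd_mulL2; first exact: sHinf_bnd (hX c i).
  exact: sH2_cL2 (hfe c 0).
pose s t := f t a 0 - xi t a 0 * \sum_c b c t * f t c 0.
have hs : sH2 s.
  apply: sH2B; first exact: (hfe a 0).
  apply: (sHinf_mulH2 (hx a 0)); apply: sH2_sum => c; exact: sHinf_mulH2 (hfe c 0).
exists s => //.
pose d t := \sum_l' entry M a l' t * entry r l' 0 t.
have E : ae_circle (fun t => entry M a l t - s t = - d t).
  apply: aeS2 hU ae_brow => t _ hu hB.
  have h1 : M t *m r t = (1%:M - xi t *m brow t) *m f t - M t *m delta_mx l 0.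
    by rewrite /r mulmxBr /M compl_mul.
  have h2 : (M t *m r t) a 0 = d t by rewrite mxE.
  have sub (A B : 'cV[C]_k.+1) : (A - B) a 0 = A a 0 - B a 0 by rewrite !mxE.
  have colM (A : 'M[C]_(k.+1, k)) : (A *m delta_mx l 0) a 0 = A a l.
    rewrite mxE (bigD1 l)//= mxE !eqxx mulr1 big1 ?addr0// => c cl.
    by rewrite mxE (negPf cl) mulr0.
  have h3 : ((1%:M - xi t *m brow t) *m f t) a 0 = s t.
    rewrite mulmxBl mul1mx -mulmxA sub [X in _ - X]mxE big_ord1 /s; congr (_ - _ * _).
    by rewrite mxE; apply: eq_bigr => c _; rewrite mxE.
  have -> : d t = s t - M t a l by rewrite -h2 h1 sub h3 colM.
  by rewrite [RHS]opprB.
have d2 : cL2 d.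
  apply: cL2_sum => l'; apply: sbnd_mulL2; first exact: MB.
  exact: ((L2P _).1 r2).
have -> : snrm (entry M a l - s) = snrm d.
  apply: snrm_ae.
  - by apply: measB; [exact: (MB a l).1|exact: sH2_meas].
  - by case: d2.
  - by apply: aeS E => t _ h; rewrite [X in csq X](h : _ = _) csqN.
apply: le_lt_trans (_ : S * (e / (S + 1)) < e); last first.
  by rewrite mulrCA gtr_pMr// ltr_pdivrMr// mul1r ltrDl.
apply: le_trans (snrm_sum _ (F := fun l' t => entry M a l' t * entry r l' 0 t) _) _.
  by move=> l'; apply: sbnd_mulL2; [exact: MB|exact: ((L2P _).1 r2)].
rewrite mulr_suml; apply: ler_sum => l' _.
apply: le_trans (snrm_mul_le (MB a l').1 (hK l') ((L2P _).1 r2 l' 0)) _.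
apply: ler_wpM2l; first exact: sqrtr_ge0.
exact: le_trans (snrm_entry l' 0 r2) (ltW fe).
Qed.

Theorem complement_left_invertible : left_invertible Xc.
Proof.
exists (fun t => (M t)^T).
have hG : Hinf (fun t => (M t)^T).
  apply/HinfP => l a; have [m [N hN]] := M_bnd a l.
  rewrite (_ : entry _ l a = entry M a l); first exact: sH2_sHinf (M_H2 a l) hN.
  by apply/funext => t; rewrite /entry mxE.
split => // zeta hz; apply: disk_value_inverse => //.
apply: aeS hU => t _ /unitary_row[_ h2 h3].
apply: trmx_inj; rewrite trmx_mul trmxK trmx1 /M mulmxA mulmxBr mulmx1 mulmxA h2 mul0mx subr0.
exact: h3.
Qed.

End LeftInverse.

(** * Greatest common inner divisors *)
Section GreatestCommonInner.
Variable R : realType.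
Local Notation C := R[i].
Local Notation Fn := (R -> C^o).
Local Notation snrm := (@nrm R (R -> C^o) (@sip R)).
Local Notation sn2 := (@n2 R (R -> C^o) (@sip R)).
Local Notation L2s := (@cL2 R).
Let H := sip_semi_inner R.
Let HH := sH2_semi_inner R.

Definition sinner (th : R -> C) : Prop :=
  sHinf th /\ ae_circle (fun t => csq (th t) = 1).

Definition sdiv (th f : R -> C) : Prop :=
  exists2 g, sH2 g & ae_circle (fun t => f t = th t * g t).

Variable m : nat.
Implicit Types (y : 'I_m -> R -> C).

Definition sgcd y (tau : R -> C) : Prop :=
  [/\ sinner tau, forall i, sdiv tau (y i) &
      forall e, sinner e -> (forall i, sdiv e (y i)) -> sdiv e tau].

Definition polyspan y : set Fn :=
  [set f | exists p : 'I_m -> {poly C}, f = fun t => \sum_i (p i).[zfun t] * y i t].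

Lemma polyspan0 y : polyspan y 0.
Proof.
exists (fun=> 0); apply/funext => t.
by rewrite big1// => i _; rewrite horner0 mul0r.
Qed.

Lemma polyspanL y (a : C) (f g : Fn) : polyspan y f -> polyspan y g -> polyspan y (a *: f + g).
Proof.
move=> [p ->] [q ->]; exists (fun i => a *: p i + q i); apply/funext => t.
rewrite -[LHS]/(a * _ + _) mulr_sumr -big_split /=; apply: eq_bigr => i _.
by rewrite hornerD hornerZ mulrDl mulrA.
Qed.

Lemma polyspan_H2 y : (forall i, sH2 (y i)) -> polyspan y `<=` @sH2 R.
Proof.
move=> hy f [p ->]; apply: sH2_sum => i; apply: sHinf_mulH2 => //; exact: sHinf_poly.
Qed.

Lemma polyspan_gen y i : polyspan y (y i).
Proof.
exists (fun j => (j == i)%:R); apply/funext => t.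
rewrite (bigD1 i)//= eqxx hornerC mul1r big1 ?addr0// => j ji.
by rewrite (negPf ji) horner0 mul0r.
Qed.

Lemma polyspanX y (n : nat) f : polyspan y f ->
  polyspan y (fun t => zfun t ^ (n : int) * f t).
Proof.
move=> [p ->]; exists (fun i => 'X^n * p i); apply/funext => t.
rewrite mulr_sumr; apply: eq_bigr => i _.
by rewrite hornerM hornerXn mulrA.
Qed.

Lemma sn2_zXM (n : int) (f : R -> C) : sn2 (fun t => zfun t ^ n * f t) = sn2 f.
Proof. by rewrite !sn2E; under eq_fun do rewrite csqM csq_zX mul1r. Qed.

Lemma cls_zX (E : set Fn) y (n : nat) x :
  (forall f : Fn, E f -> E (fun t => zfun t ^ (n : int) * f t)) ->
  cls E (@sip R) (polyspan y) x ->
  cls E (@sip R) (polyspan y) (fun t => zfun t ^ (n : int) * x t).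
Proof.
move=> hE [Ex h]; split; first exact: hE.
move=> e /h [s hs xs]; exists (fun t => zfun t ^ (n : int) * s t); first exact: polyspanX.
rewrite (_ : _ - _ = fun t => zfun t ^ (n : int) * (x - s) t); last first.
  by apply/funext => t; rewrite -[RHS]/(_ * (_ - _)) mulrBr.
by rewrite /nrm sn2_zXM.
Qed.

(* Beurling: a unit vector of [M] orthogonal to [zM], with [M] the invariant
   subspace generated by the [y i]. *)
Lemma beurling y : (forall i, sH2 (y i)) ->
  (exists i, ~ ae_circle (fun t => y i t = 0)) ->
  exists e, [/\ sinner e, cls L2s (@sip R) (polyspan y) e & forall i, sdiv e (y i)].
Proof.
move=> hy [i1 y1].
pose zy i t := zfun t ^ (1 : int) * y i t.
have hzy i : sH2 (zy i) by exact: (sH2_zXM 1 (hy i)).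
pose S0 := polyspan zy.
have S0H : S0 `<=` @sH2 R by exact: polyspan_H2.
have S0S : S0 `<=` polyspan y.
  move=> f [p ->]; exists (fun i => 'X * p i); apply/funext => t; apply: eq_bigr => i _.
  by rewrite /zy hornerM hornerX mulrA [(p i).[_] * _]mulrC.
have S0z (n : nat) f : (0 < n)%N -> polyspan y f -> S0 (fun t => zfun t ^ (n : int) * f t).
  case: n => // n _ [p ->]; exists (fun i => 'X^n * p i); apply/funext => t.
  rewrite mulr_sumr; apply: eq_bigr => i _; rewrite /zy hornerM hornerXn.
  rewrite -[zfun t ^ n.+1]/(zfun t ^+ n.+1) -[zfun t ^ 1]/(zfun t) exprS; ring.
have HE := cls_semi_inner HH S0H (polyspan0 zy) (@polyspanL zy).
(* The least order of vanishing [n] among the [y i], attained at [i0]. Elements of [zM] have a zero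
   coefficient at [n], so [y i0] minus its projection onto [zM] keeps a nonzero one. *)
have exn : exists n : nat, [exists i, fc (y i) n != 0].
  apply/not_existsP => h; apply: y1; apply: (coef_unique (sH2_cL2 (hy i1))) => -[n|n].
    have /negP := h n; rewrite negb_exists => /forallP /(_ i1); rewrite negbK => /eqP //.
  exact: (hy i1).2.
case: (ex_minnP exn) => n /existsP[i0 ni0] nmin.
have [q clq qorth] := cls_proj HH (@sH2_complete R) S0H (polyspan0 zy) (@polyspanL zy) (hy i0).
have hq : sH2 q by case: clq.
pose e0 t := y i0 t - q t.
have he0 : sH2 e0 by exact: sH2B.
have clsL x : cls (@sH2 R) (@sip R) S0 x -> cls L2s (@sip R) (polyspan y) x.
  move=> [xE h]; split; first exact: sH2_cL2.
  by move=> e /h[s /S0S]; exists s.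
have SL : polyspan y `<=` L2s by move=> f hf; apply: sH2_cL2; exact: (polyspan_H2 hy hf).
have HL := cls_semi_inner H SL (polyspan0 y) (@polyspanL y).
have e0M : cls L2s (@sip R) (polyspan y) e0.
  apply: (siB HL); last exact: clsL.
  exact: (sub_cls H SL (polyspan_gen y i0)).
have e0n : fc e0 n != 0.
  rewrite fcB; [|exact: sH2_cL2 (hy i0)|exact: sH2_cL2 hq].
  suff -> : fc q n = 0 by rewrite subr0.
  have := @cls_bound R S0 0 (fun t => zfun t ^ (n : int)) _ (lexx 0) (cL2_zX R n) _ q.
  rewrite -fcE mul0r => h; apply: csq_eq0; apply/eqP; rewrite eq_le csq_ge0 andbT; apply: h.
  - by move=> f /S0H; exact: sH2_cL2.
  - move=> f [p ->]; rewrite mul0r -fcE (_ : fc _ n = 0) ?csq0//.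
    rewrite fc_sum; last first.
      by move=> i; apply: sH2_cL2; apply: sHinf_mulH2 => //; exact: sHinf_poly.
    rewrite big1// => i _.
    pose pi := fun t : R => (p i).[zfun t].
    have hpi : sH2 pi by exact: sH2_poly.
    rewrite (fc_mul n hpi (hzy i)) big1// => l _.
    rewrite [X in _ * X](_ : _ = 0) ?mulr0//.
    rewrite fc_zXM; set k := (_ - _ - _).
    have [k0|k0] := ltP k 0; first exact: (hy i).2.
    rewrite -(gez0_abs k0); apply/eqP/negPn/negP => hk.
    have /nmin : [exists i, fc (y i) `|k|%N != 0] by apply/existsP; exists i.
    have : (`|k|%N : int) < n by rewrite gez0_abs// /k; have := ltn_ord l; lia.
    by rewrite ltz_nat => h1 h2; have := leq_trans h1 h2; rewrite ltnn.
  - by case: clq => /sH2_cL2 ? h; split.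
have orth r : S0 r -> sip e0 r = 0 by move=> h; apply: qorth; exact: sub_cls.
have e0z (k : nat) : (0 < k)%N -> sip e0 (fun t => zfun t ^ (k : int) * e0 t) = 0.
  move=> k0; apply: qorth; rewrite (_ : (fun t => _) =
      (fun t => zfun t ^ (k : int) * y i0 t : C^o) - (fun t => zfun t ^ (k : int) * q t)); last first.
    by apply/funext => t; rewrite -[RHS]/(_ - _) -mulrBr.
  apply: (siB HE).
    by apply: sub_cls => //; apply: S0z => //; exact: polyspan_gen.
  by apply: cls_zX => // f hf; exact: sH2_zXM.
pose c := sn2 e0.
have c0 : 0 < c.
  rewrite lt_neqAle (n2_ge0 H (sH2_cL2 he0)) andbT eq_sym; apply: contra_neq e0n => c0.
  by rewrite fcE (si_conj H (cL2_zX R n) (sH2_cL2 he0)) (ip_null H) ?cJ0//; [exact: cL2_zX|exact: sH2_cL2].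
(* Orthogonality of [e0] to [z^k e0] for [k > 0], together with conjugation, says that [|e0|^2] has
   no coefficient except the one at 0. *)
have e0c : ae_circle (fun t => csq (e0 t) = c).
  pose w t : C := Complex (csq (e0 t)) 0 - Complex c 0.
  have w0 : cL1 (fun t => Complex (csq (e0 t)) 0).
    by split => /=; [exact: (sH2_cL2 he0).2|exact: rint_cst].
  have ww : cL1 w by apply: cL1B => //; exact: cL1_cst.
  have : ae_circle (fun t => w t = 0).
    apply: fourier_unique => // k.
    rewrite (_ : (fun t => _) = fun t => Complex (csq (e0 t)) 0 * zfun t ^ k -
        Complex c 0 * zfun t ^ k); last by apply/funext => t; rewrite mulrBl.
    rewrite cintB; [|exact: cL1_zX|by apply: cL1_zX; exact: cL1_cst].
    rewrite cintZ; last by apply: cL2_cL1; exact: cL2_zX.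
    have E (j : int) : sip e0 (fun t => zfun t ^ j * e0 t) =
        circle_int (fun t => Complex (csq (e0 t)) 0 * zfun t ^ (- j)).
      by congr circle_int; apply/funext => t; rewrite cJM zXJ -mulJ; ring.
    rewrite cint_zX; case: eqP => [->|/eqP k0].
      rewrite mulr1; apply/eqP; rewrite subr_eq0 -(ip_real H (sH2_cL2 he0)); apply/eqP.
      by congr circle_int; apply/funext => t; rewrite expr0z mulr1 mulJ.
    rewrite mulr0 subr0.
    have [kp|kn] := ltP 0 k; last first.
      have kn' : (0 < `|k|)%N by rewrite absz_gt0.
      by rewrite -(e0z _ kn') E; congr circle_int; apply/funext => t; congr (_ * _ ^ _); lia.
    have kn' : (0 < `|k|)%N by rewrite absz_gt0.
    rewrite -[RHS]cJ0 -(e0z _ kn') E -cintJ; last by apply: cL1_zX.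
    congr circle_int; apply/funext => t; rewrite cJM zXJ opprK gtz0_abs//.
    by congr (_ * _); apply/complexP; rewrite ?cReJ ?cImJ//= oppr0.
  by apply: aeS => t _ /eqP; rewrite subr_eq0 => /eqP[].
pose a : C := Complex (Num.sqrt c)^-1 0.
have ac : csq a = c^-1.
  by rewrite /csq /= expr0n addr0 exprVn sqr_sqrtr// ltW.
pose e t := a * e0 t.
have he : sH2 e by exact: sH2Z.
have ee : ae_circle (fun t => csq (e t) = 1).
  by apply: aeS e0c => t _ h; rewrite csqM h ac mulVf// gt_eqF.
exists e; split.
- split => //; apply: (sH2_sHinf (M := 1)) => //; by apply: aeS ee => t _ ->.
- exact: (siZ HL).
(* The quotient is analytic: its coefficient at [j < 0] is, up to conjugation, the product of [e]
   with [z^|j| y i], which lies in [zM]. *)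
move=> i; exists (fun t => Num.conj (e t) * y i t); last first.
  by apply: aeS ee => t _ h; rewrite mulrA mulJ h mul1r.
split.
  apply: (cL2_bnd (M := 1)); first exact: sH2_cL2.
    by apply: measJ; exact: sH2_meas.
  by apply: aeS ee => t _; rewrite csqJ => ->.
move=> j j0.
have hzj : sH2 (fun t => zfun t ^ (`|j|%N : int) * y i t) by exact: sH2_zXM.
transitivity (Num.conj (sip e (fun t => zfun t ^ (`|j|%N : int) * y i t))).
  rewrite -(si_conj H (sH2_cL2 he) (sH2_cL2 hzj)); congr circle_int; apply/funext => t.
  rewrite ltz0_abs//; ring.
rewrite (@ipZl _ _ _ _ H a e0 _ (sH2_cL2 he0) (sH2_cL2 hzj)) orth ?mulr0 ?cJ0//.
by apply: S0z; [rewrite absz_gt0 lt_eqF|exact: polyspan_gen].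
Qed.

(** If all entries vanished, every power of [z] would be a common inner divisor and would divide
    [tau], whose coefficients would then all be 0. *)
Lemma sgcd_neq0 y tau : sgcd y tau -> exists i, ~ ae_circle (fun t => y i t = 0).
Proof.
move=> [[htau t1] _ hmax]; apply: contrapT => h.
have y0 i : ae_circle (fun t => y i t = 0).
  by apply: contrapT => hi; apply: h; exists i.
have t0 : ae_circle (fun t => tau t = 0).
  apply: (coef_unique (sHinf_cL2 htau)) => -[n|n]; last by have [_ _ ->] := htau.
  have hz : sHinf (fun t => zfun t ^ (n.+1 : int) : C).
    apply: (sH2_sHinf (M := 1)); first exact: sH2_zX.
    by apply: aeT => t _; rewrite csq_zX.
  have [||g hg tg] := hmax (fun t => zfun t ^ (n.+1 : int)).
  - by split => //; apply: aeT => t _; rewrite csq_zX.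
  - by move=> i; exists (fun=> 0); [exact: sH2_0|apply: aeS (y0 i) => t _ ->; rewrite mulr0].
  have zg := sH2_zXM n.+1 hg.
  rewrite /fc (@cint_ae _ _ (fun t => (zfun t ^ (n.+1 : int) * g t) * zfun t ^ (- n%:Z))).
  - rewrite -/(fc _ _) fc_zXM hg.2//; lia.
  - by apply: measM; [by have [] := htau|exact: meas_zX].
  - by apply: measM; [exact: sH2_meas|exact: meas_zX].
  - by apply: aeS tg => t _ ->.
have ae_false : ae_circle (fun _ : R => False).
  apply: aeS2 t1 t0 => t _ h1 h2.
  by move: h1; rewrite h2 csq0 => /eqP; rewrite eq_sym oner_eq0.
by have [t] := ae_exists ae_false.
Qed.

(** Since [x i h = conj(tau) y i], the hypothesis on [psi] makes each [psi tau conj(z^n)] orthogonal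
    to the polynomial span of the [y i], hence to its inner generator [e]. Writing [tau = e g] by
    maximality, this says that every coefficient of [g psi] vanishes, and [g] is unimodular. *)
Lemma sgcd_injective y tau h x psi : (forall i, sH2 (y i)) -> sgcd y tau ->
  sH2 h -> (forall i, sHinf (x i)) ->
  (forall i, ae_circle (fun t => x i t * h t = Num.conj (tau t) * y i t)) ->
  sH2 psi -> (forall i p, sH2 p -> sip psi (fun t => x i t * p t) = 0) ->
  ae_circle (fun t => psi t = 0).
Proof.
move=> hy hg hh hx xh hpsi porth.
have [e [[he e1] eM ediv]] := beurling hy (sgcd_neq0 hg).
have [[htau t1] _ hmax] := hg.
have [g hg2 tg] := hmax e (conj he e1) ediv.
have g1 : ae_circle (fun t => csq (g t) = 1).
  apply: aeS3 e1 t1 tg => t _ h1 h2 h3.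
  by move: h2; rewrite h3 csqM h1 mul1r.
have gH : sHinf g by apply: (sH2_sHinf (M := 1)) => //; apply: aeS g1 => t _ ->.
have mt : measc tau by have [] := htau.
have gp : sH2 (fun t => g t * psi t) by exact: sHinf_mulH2.
have : ae_circle (fun t => g t * psi t = 0).
  apply: (coef_unique (sH2_cL2 gp)) => -[n|n]; last exact: gp.2.
  pose w t := psi t * tau t * zfun t ^ (- n%:Z).
  have hw : cL2 w.
    rewrite (_ : w = fun t => (tau t * zfun t ^ (- n%:Z)) * psi t).
      apply: (cL2_bnd (M := 1)); [exact: sH2_cL2|by apply: measM => //; exact: meas_zX|].
      by apply: aeS t1 => t _ h1; rewrite csqM h1 csq_zX mulr1.
    by apply/funext => t; rewrite /w; ring.
  have we : sip e w = 0.
    apply: csq_eq0; apply/eqP; rewrite eq_le csq_ge0 andbT -(mul0r (sn2 e)).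
    apply: (@cls_bound R (polyspan y) 0 w _ (lexx 0) hw _ e eM).
      by move=> f /(polyspan_H2 hy); exact: sH2_cL2.
    move=> f [p ->]; rewrite mul0r (_ : sip _ w = 0) ?csq0//.
    have hpy i : sH2 (fun t => (p i).[zfun t] * y i t).
      by apply: sHinf_mulH2 => //; exact: sHinf_poly.
    transitivity (\sum_i sip (fun t => (p i).[zfun t] * y i t) w).
      rewrite /sip -cint_sum; last by move=> i; apply: cL1M; [exact: sH2_cL2|exact: cL2J].
      by congr circle_int; apply/funext => t; rewrite mulr_suml.
    rewrite big1// => i _.
    have hq : sH2 (fun t => (p i).[zfun t] * (zfun t ^ (n : int) * h t)).
      apply: sHinf_mulH2; first exact: sHinf_poly.
      exact: sH2_zXM.
    have := porth i _ hq => /(congr1 Num.conj); rewrite cJ0 => <-.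
    rewrite -(si_conj H (sH2_cL2 hpsi)); last by apply: sH2_cL2; exact: sHinf_mulH2.
    apply: cint_ae.
    - by apply: measM; [exact: sH2_meas|apply: measJ; case: hw].
    - by apply: measM; [by apply: sH2_meas; exact: sHinf_mulH2|apply: measJ; exact: sH2_meas].
    apply: aeS (xh i) => t _ E.
    rewrite /w !cJM zXJ opprK.
    have -> : x i t * ((p i).[zfun t] * (zfun t ^ n * h t)) =
      (x i t * h t) * ((p i).[zfun t] * zfun t ^ n) by ring.
    rewrite E; ring.
  have := congr1 Num.conj we; rewrite cJ0 -(si_conj H (sHinf_cL2 he) hw) => <-.
  apply: cint_ae.
  - by apply: measM; [exact: sH2_meas|exact: meas_zX].
  - by apply: measM; [by case: hw|apply: measJ; case: he].
  apply: aeS2 e1 tg => t _ h1 h2; rewrite /w h2.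
  have := mulJ (e t); rewrite h1 => E.
  have -> : psi t * (e t * g t) * zfun t ^ (- n%:Z) * Num.conj (e t) =
    psi t * g t * zfun t ^ (- n%:Z) * (e t * Num.conj (e t)) by ring.
  by rewrite E -[Complex 1 0]/(1 : C) mulr1 [psi t * _]mulrC.
move=> gp0; apply: aeS2 g1 gp0 => t _ h1 /eqP; rewrite mulf_eq0 => /orP[/eqP h2|/eqP//].
by move: h1; rewrite h2 csq0 => /eqP; rewrite eq_sym oner_eq0.
Qed.

End GreatestCommonInner.

(** * Singular pairs of the four block operator *)
Section ColumnFunctions.
Variable R : realType.
Local Notation C := R[i].
Local Notation snrm := (@nrm R (R -> C^o) (@sip R)).
Local Notation sn2 := (@n2 R (R -> C^o) (@sip R)).
Local Notation l2i k := (@l2inner R k 1).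
Let H := sip_semi_inner R.

Lemma n2_sqnorm k (F : matfun R k 1) : n2 (l2i k) F =
  (2 * pi)^-1 * \int[@lebesgue_measure R]_(t in @circle R) sqnorm (F t).
Proof.
rewrite /n2 /l2inner /=; congr (_ * _).
apply: eq_Rintegral => t _; rewrite Re_sum sqnormE; apply: eq_bigr => i _.
by rewrite Re_sum; apply: eq_bigr => j _; rewrite mulJ.
Qed.

Lemma l2i_sip k (F G : matfun R k 1) : L2 F -> L2 G ->
  l2i k F G = \sum_i sip (entry F i 0) (entry G i 0).
Proof. by move=> hF hG; rewrite l2innerE//; apply: eq_bigr => i _; rewrite big_ord1. Qed.

Lemma n2_col k (F : matfun R k 1) : L2 F ->
  n2 (l2i k) F = \sum_i sn2 (entry F i 0).
Proof. by move=> hF; rewrite n2_l2//; apply: eq_bigr => i _; rewrite big_ord1. Qed.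

Lemma L2_col k (F : matfun R k 1) : L2 F <-> forall i, cL2 (entry F i 0).
Proof.
split=> [/L2P h i //|h]; apply/L2P => i j; rewrite ord1; exact: h.
Qed.

Lemma Linf_bnd k l (F : matfun R k l) : Linf F <-> forall i j, sbnd (entry F i j).
Proof. exact: LinfP. Qed.

Lemma L2_mul k l (F : matfun R k l) (f : matfun R l 1) : Linf F -> L2 f ->
  L2 (fun t => F t *m f t).
Proof.
move=> /Linf_bnd hF /L2_col hf; apply/L2_col => i.
rewrite (_ : entry _ i 0 = fun t => \sum_j entry F i j t * entry f j 0 t); last first.
  by apply/funext => t; rewrite /entry mxE.
by apply: cL2_sum => j; exact: sbnd_mulL2.
Qed.

Lemma L2_scale k (c : R -> C) (f : matfun R k 1) : sbnd c -> L2 f ->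
  L2 (fun t => c t *: f t).
Proof.
move=> hc /L2_col hf; apply/L2_col => i.
rewrite (_ : entry _ i 0 = fun t => c t * entry f i 0 t); first exact: sbnd_mulL2.
by apply/funext => t; rewrite /entry mxE.
Qed.

Lemma entry_scale k (c : R -> C) (f : matfun R k 1) i :
  entry (fun t => c t *: f t) i 0 = fun t => c t * entry f i 0 t.
Proof. by apply/funext => t; rewrite /entry mxE. Qed.

Lemma entry_lin k (a : C) (f g : matfun R k 1) i :
  entry (a *: f + g : matfun R k 1) i 0 = fun t => a * entry f i 0 t + entry g i 0 t.
Proof. by apply/funext => t; rewrite /entry [in LHS]mxE [in LHS]mxE. Qed.

Lemma sqnorm_col k (A : 'M[C]_(k, 1)) : sqnorm A = \sum_i csq (A i 0).
Proof. by rewrite sqnormE; apply: eq_bigr => i _; rewrite big_ord1. Qed.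

Lemma sqnorm_scale k (c : C) (A : 'M[C]_(k, 1)) : sqnorm (c *: A) = csq c * sqnorm A.
Proof. by rewrite !sqnorm_col mulr_sumr; apply: eq_bigr => i _; rewrite mxE csqM. Qed.

Lemma meas_sqnorm k (F : matfun R k 1) : (forall i, measc (entry F i 0)) ->
  measurable_fun (@circle R) (fun t => sqnorm (F t)).
Proof.
move=> h; under eq_fun do rewrite sqnorm_col.
by apply: measurable_sum => i; apply: meas_csq; exact: h.
Qed.

Lemma n2_ae k l (F : matfun R k 1) (G : matfun R l 1) :
  (forall i, measc (entry F i 0)) -> (forall i, measc (entry G i 0)) ->
  ae_circle (fun t => sqnorm (F t) = sqnorm (G t)) -> n2 (l2i k) F = n2 (l2i l) G.
Proof.
move=> hF hG h; rewrite !n2_sqnorm; congr (_ * _); apply: RI_ae => //; exact: meas_sqnorm.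
Qed.

Lemma sip_unimod (c u v : R -> C) : measc c -> measc u -> measc v ->
  ae_circle (fun t => csq (c t) = 1) ->
  sip (fun t => c t * u t) (fun t => c t * v t) = sip u v.
Proof.
move=> mc mu mv c1; apply: cint_ae.
- by apply: measM; [exact: measM|apply: measJ; exact: measM].
- by apply: measM => //; exact: measJ.
apply: aeS c1 => t _ h; rewrite cJM.
have -> : c t * u t * (Num.conj (c t) * Num.conj (v t)) =
  c t * Num.conj (c t) * (u t * Num.conj (v t)) by ring.
by rewrite mulJ h mul1r.
Qed.

Lemma sip_ae0 (f g : R -> C) : measc f -> measc g -> ae_circle (fun t => f t = 0) -> sip f g = 0.
Proof.
move=> mf mg f0; transitivity (sip (fun=> 0) g).
  by apply: sip_ae => //; first [exact: (meas_cst 0)|exact: aeT].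
by rewrite /sip; under eq_fun do rewrite mul0r; exact: cint_cst.
Qed.

End ColumnFunctions.

Section SingularPairs.
Variable R : realType.
Local Notation C := R[i].
Local Notation sn2 := (@n2 R (R -> C^o) (@sip R)).
Local Notation l2i k := (@l2inner R k 1).
Variables (k1 k2 l1 l2 : nat).
Local Notation VD := (matfun R (l1 + l2) 1).
Local Notation VE := (matfun R (k1 + k2) 1).
Local Notation D := (@H2_L2 R l1 l2).
Local Notation E := (@H2minus_L2 R k1 k2).
Local Notation nD := (@nrm R VD (l2i (l1 + l2))).
Local Notation nE := (@nrm R VE (l2i (k1 + k2))).
Local Notation n2D := (@n2 R VD (l2i (l1 + l2))).
Local Notation n2E := (@n2 R VE (l2i (k1 + k2))).
Let H := sip_semi_inner R.
Let HLD : @semi_inner R VD (@L2 R _ 1) (l2i (l1 + l2)) := L2_semi_inner R (l1 + l2) 1.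
Let HLE : @semi_inner R VE (@L2 R _ 1) (l2i (k1 + k2)) := L2_semi_inner R (k1 + k2) 1.

Lemma H2_L2P (f : VD) : D f <-> (forall i, sH2 (entry f (lshift l2 i) 0)) /\
  (forall i, cL2 (entry f (rshift l1 i) 0)).
Proof.
split=> [[/H2P h1 /L2P h2]|[h1 h2]].
  split=> i; [have := h1 i 0|have := h2 i 0]; congr (_ _);
  by apply/funext => t; rewrite /entry mxE.
split; [apply/H2P|apply/L2P] => i j; rewrite ord1.
- have := h1 i; congr sH2; by apply/funext => t; rewrite /entry mxE.
- have := h2 i; congr cL2; by apply/funext => t; rewrite /entry mxE.
Qed.

Lemma H2minus_L2P (g : VE) : E g <-> (forall i, sH2m (entry g (lshift k2 i) 0)) /\
  (forall i, cL2 (entry g (rshift k1 i) 0)).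
Proof.
split=> [[/H2minusP h1 /L2P h2]|[h1 h2]].
  split=> i; [have := h1 i|have := h2 i 0]; congr (_ _);
  by apply/funext => t; rewrite /entry mxE.
split; [apply/H2minusP => i|apply/L2P => i j; rewrite ord1].
- have := h1 i; congr sH2m; by apply/funext => t; rewrite /entry mxE.
- have := h2 i; congr cL2; by apply/funext => t; rewrite /entry mxE.
Qed.

Lemma cL2_split k l (F : matfun R (k + l) 1) : (forall i, cL2 (entry F (lshift l i) 0)) ->
  (forall i, cL2 (entry F (rshift k i) 0)) -> L2 F.
Proof.
move=> h1 h2; apply/L2_col => i.
by case: (splitP i) => j ij; [rewrite (_ : i = lshift l j)|rewrite (_ : i = rshift k j)] => //; exact: val_inj.
Qed.

Lemma D_L2 f : D f -> L2 f.
Proof. move=> /H2_L2P[h1 h2]; apply: cL2_split => // i; exact: sH2_cL2. Qed.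

Lemma E_L2 f : E f -> L2 f.
Proof. move=> /H2minus_L2P[h1 h2]; apply: cL2_split => // i; exact: (h1 i).1. Qed.

Lemma sH2m_lin (a : C) (f g : R -> C) : sH2m f -> sH2m g -> sH2m (fun t => a * f t + g t).
Proof.
move=> [f2 fo] [g2 go]; split; first by apply: cL2D => //; exact: cL2Z.
move=> r hr; have := @si_lin _ _ _ _ H a f g r f2 g2 (sH2_cL2 hr).
by rewrite fo// go// mulr0 addr0.
Qed.

Lemma D_semi_inner : @semi_inner R VD D (l2i (l1 + l2)).
Proof.
apply: (semi_inner_sub HLD).
- exact: D_L2.
- apply/H2_L2P; split=> i; rewrite (_ : entry _ _ 0 = fun=> 0).
  + exact: sH2_0.
  + by apply/funext => t; rewrite /entry mxE.
  + exact: cL2_cst.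
  + by apply/funext => t; rewrite /entry mxE.
move=> a f g /H2_L2P[f1 f2] /H2_L2P[g1 g2]; apply/H2_L2P; split=> i; rewrite entry_lin.
- exact: sH2_lin.
- by apply: cL2D => //; exact: cL2Z.
Qed.

Lemma E_semi_inner : @semi_inner R VE E (l2i (k1 + k2)).
Proof.
apply: (semi_inner_sub HLE).
- exact: E_L2.
- apply/H2minus_L2P; split=> i; rewrite (_ : entry _ _ 0 = fun=> 0).
  + split; first exact: cL2_cst.
    by move=> r _; rewrite /sip; under eq_fun do rewrite mul0r; exact: cint_cst.
  + by apply/funext => t; rewrite /entry mxE.
  + exact: cL2_cst.
  + by apply/funext => t; rewrite /entry mxE.
move=> a f g /H2minus_L2P[f1 f2] /H2minus_L2P[g1 g2]; apply/H2minus_L2P.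
split=> i; rewrite entry_lin.
- exact: sH2m_lin.
- by apply: cL2D => //; exact: cL2Z.
Qed.

Let HD := D_semi_inner.
Let HE := E_semi_inner.

Variables (Phi : matfun R (k1 + k2) (l1 + l2)) (t0 : R).
Hypothesis Phi_bnd : Linf Phi.
Hypothesis t0_gt0 : 0 < t0.

Definition bform (r : VD) (s : VE) : C := l2i (k1 + k2) (fun t => Phi t *m r t) s.

Lemma PhiL2 (r : VD) : L2 r -> L2 (fun t => Phi t *m r t).
Proof. exact: L2_mul. Qed.

Lemma bform_linl a r r' s : L2 r -> L2 r' -> L2 s ->
  bform (a *: r + r') s = a * bform r s + bform r' s.
Proof.
move=> hr hr' hs; rewrite /bform.
have := @si_lin _ _ _ _ HLE a (fun t => Phi t *m r t) (fun t => Phi t *m r' t) s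
  (PhiL2 hr) (PhiL2 hr') hs.
move=> <-; congr (l2i _ _ s); apply/funext => t.
by rewrite -[RHS]/(a *: _ + _) mulmxDr -scalemxAr.
Qed.

Lemma bform_linr a r s s' : L2 r -> L2 s -> L2 s' ->
  bform r (a *: s + s') = Num.conj a * bform r s + bform r s'.
Proof.
move=> hr hs hs'; have h := PhiL2 hr; rewrite /bform (ipDr HLE)//; last exact: (siZ HLE).
by rewrite (ipZr HLE).
Qed.

Hypothesis bform_le : forall r s, D r -> E s ->
  complex.Re (bform r s) <= t0 * (nD r * nE s).

(* Nonnegativity of this form is the bound [t0]; its null vectors are the
   singular pairs. *)
Definition gap (v w : VD * VE) : C := Complex t0 0 * (l2i _ v.1 w.1 + l2i _ v.2 w.2) -
  (bform v.1 w.2 + Num.conj (bform w.1 v.2)).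

Lemma gap_diag x y : D x -> E y -> n2 gap (x, y) =
  t0 * (n2D x + n2E y) - 2 * complex.Re (bform x y).
Proof.
move=> hx hy; have -> : n2 gap (x, y) = complex.Re (Complex t0 0 *
    (l2i _ x x + l2i _ y y) - (bform x y + Num.conj (bform x y))) by [].
rewrite cReD cReN cReZ !cReD cReJ -!/(n2 _ _) mulr_natl mulr2n; ring.
Qed.

Lemma gap_semi_inner :
  @semi_inner R (VD * VE)%type [set v | D v.1 /\ E v.2] gap.
Proof.
split.
- by split; [exact: (si0 HD)|exact: (si0 HE)].
- by move=> a v w [v1 v2] [w1 w2]; split; [exact: (siL HD)|exact: (siL HE)].
- move=> a [x y] [x' y'] [p q] /= [hx hy] [hx' hy'] [hp hq]; rewrite /gap /=.
  rewrite (si_lin HD a hx hx' hp) (si_lin HE a hy hy' hq).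
  rewrite bform_linl; [|exact: D_L2|exact: D_L2|exact: E_L2].
  rewrite bform_linr; [|exact: D_L2|exact: E_L2|exact: E_L2].
  rewrite cJD cJM cJK; ring.
- move=> [x y] [p q] /= [hx hy] [hp hq]; rewrite /gap /=.
  rewrite (si_conj HD hx hp) (si_conj HE hy hq) cJB cJM !cJD cJK.
  have -> : Num.conj (Complex t0 0 : C) = Complex t0 0.
    by apply/complexP => //=; rewrite oppr0.
  by rewrite [X in _ - X]addrC.
move=> [x y] [hx hy]; rewrite -[complex.Re _]/(n2 gap (x, y)) gap_diag//.
have h := bform_le hx hy.
have a0 : nD x ^+ 2 = n2D x := nrm_sqr HD hx.
have b0 : nE y ^+ 2 = n2E y := nrm_sqr HE hy.
rewrite -a0 -b0; move: h; set b := complex.Re _; set u := nD x; set v := nE y => h.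
(* By the form bound, the gap of a pair is at least [t0] times the squared difference of the two
   norms. *)
have : 0 <= t0 * (u - v) ^+ 2 by rewrite mulr_ge0 ?sqr_ge0// ltW.
nra.
Qed.

Let HG := gap_semi_inner.

(** The equality case of [bform_le] with equal norms. *)
Definition singular (f : VD) (g : VE) : Prop :=
  [/\ D f, E g, n2E g = n2D f & complex.Re (bform f g) = t0 * n2D f].

(** The pair is a null vector of the semi-inner product [gap], hence in its kernel; testing with
    [(r, 0)] and [(0, s)] gives the two identities. *)
Lemma singular_rel f g : singular f g ->
  (forall r, D r -> bform r g = Complex t0 0 * l2i _ r f) /\
  (forall s, E s -> bform f s = Complex t0 0 * l2i _ g s).
Proof.
move=> [hf hg gf afg].
have n0 : n2 gap (f, g) = 0 by rewrite gap_diag// gf afg mulr_natl mulr2n; ring.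
have key x y (hx : D x) (hy : E y) : gap (x, y) (f, g) = 0.
  by apply: (ip_null HG).
have D0 := si0 HD; have E0 := si0 HE.
split=> [r hr|s hs].
  have := key r 0 hr E0; rewrite /gap /= (ip0l HE hg) addr0.
  have -> : bform f 0 = 0.
    have L0 := E_L2 E0; have LP := PhiL2 (D_L2 hf).
    by rewrite /bform (si_conj HLE L0 LP) (ip0l HLE LP) cJ0.
  by rewrite cJ0 addr0 => /eqP; rewrite subr_eq0 => /eqP.
have := key 0 s D0 hs; rewrite /gap /= (ip0l HD hf) add0r.
have -> : bform 0 g = 0.
  have -> : bform 0 g = l2i _ 0 g.
    by congr (l2i _ _ g); apply/funext => t; rewrite mulmx0.
  exact: (ip0l HE hg).
rewrite add0r => /eqP; rewrite subr_eq0 => /eqP /(congr1 Num.conj).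
rewrite cJK => <-; rewrite cJM (si_conj HE hg hs) cJK; congr (_ * _).
by apply/complexP => //=; rewrite oppr0.
Qed.

Definition resid (f : VD) (g : VE) : VE := fun t => Phi t *m f t - Complex t0 0 *: g t.

Lemma resid_L2 f g : L2 f -> L2 g -> L2 (resid f g).
Proof.
move=> hf hg; have := siB HLE (PhiL2 hf) (siZ HLE (Complex t0 0) hg).
by [].
Qed.

Definition single k (i : 'I_k) (w : R -> C) : matfun R k 1 := fun t => w t *: delta_mx i 0.

Lemma entry_single k (i j : 'I_k) w : entry (single i w) j 0 = if j == i then w else fun=> 0.
Proof.
apply/funext => t; rewrite /entry /single !mxE eqxx andbT.
by case: eqP => _; rewrite ?mulr1 ?mulr0.
Qed.

Lemma l2i_single k (q : matfun R k 1) i w : L2 q -> cL2 w ->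
  l2i k q (single i w) = sip (entry q i 0) w.
Proof.
move=> hq hw; rewrite l2i_sip//; last first.
  by apply/L2_col => j; rewrite entry_single; case: eqP => // _; exact: cL2_cst.
rewrite (bigD1 i)//= entry_single eqxx big1 ?addr0// => j ji.
rewrite entry_single (negPf ji) /sip; under eq_fun do rewrite cJ0 mulr0.
exact: cint_cst.
Qed.

Lemma E_single_l i w : sH2m w -> E (single (lshift k2 i) w).
Proof.
move=> hw; apply/H2minus_L2P; split=> j; rewrite entry_single.
  case: eqP => // _; split; first exact: cL2_cst.
  by move=> r _; rewrite /sip; under eq_fun do rewrite mul0r; exact: cint_cst.
case: eqP => // _; [exact: hw.1|exact: cL2_cst].
Qed.

Lemma E_single_r i w : cL2 w -> E (single (rshift k1 i) w).
Proof.
move=> hw; apply/H2minus_L2P; split=> j; rewrite entry_single.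
  rewrite eq_lrshift; split; first exact: cL2_cst.
  by move=> r _; rewrite /sip; under eq_fun do rewrite mul0r; exact: cint_cst.
by case: eqP => // _; exact: cL2_cst.
Qed.

(** The residual is orthogonal to [E]. An upper entry is tested against its own component outside
    [H^2], a lower entry against itself. *)
Lemma singular_resid f g : singular f g ->
  (forall i, sH2 (entry (resid f g) (lshift k2 i) 0)) /\
  (forall i, ae_circle (fun t => resid f g t (rshift k1 i) 0 = 0)).
Proof.
move=> fg; have [hf hg _ _] := fg; have [_ fs] := singular_rel fg.
have Lf := D_L2 hf; have Lg := E_L2 hg; have Lq := resid_L2 Lf Lg.
have orth s : E s -> l2i _ (resid f g) s = 0.
  move=> hs; have := ipBl HLE (PhiL2 Lf) (siZ HLE (Complex t0 0) Lg) (E_L2 hs).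
  rewrite (ipZl HLE _ Lg (E_L2 hs)) -/(bform f s) fs// subrr; exact.
split=> i; [pose q := entry (resid f g) (lshift k2 i) 0|pose q := entry (resid f g) (rshift k1 i) 0].
  have q2 : cL2 q by exact: ((L2_col _).1 Lq).
  have hP := Pp_H2 q2; have hm := Pp_H2m q2.
  have := orth _ (E_single_l i hm); rewrite l2i_single//; last exact: hm.1.
  move=> qm; have dm : sip (fun t => q t - Pp q t) (fun t => q t - Pp q t) = 0.
    have := ipBl H q2 (sH2_cL2 hP) hm.1; move=> ->.
    by rewrite qm (si_conj H hm.1 (sH2_cL2 hP)) hm.2// cJ0 subrr.
  have : ae_circle (fun t => q t - Pp q t = 0) by apply: (sn2_eq0 hm.1); rewrite /n2 dm.
  move=> h; apply: sH2_ae (hP) => //; first by case: q2.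
  by apply: aeS h => t _ /eqP; rewrite subr_eq0 => /eqP E; exact: esym.
have q2 : cL2 q by exact: ((L2_col _).1 Lq).
have := orth _ (E_single_r i q2); rewrite l2i_single// => qq.
by apply: (sn2_eq0 q2); rewrite /n2 qq.
Qed.

Lemma D_scale (c : R -> C) f : sHinf c -> D f -> D (fun t => c t *: f t).
Proof.
move=> hc /H2_L2P[h1 h2]; apply/H2_L2P; split=> i; rewrite entry_scale.
- exact: sHinf_mulH2.
- by apply: sbnd_mulL2 => //; exact: sHinf_bnd.
Qed.

Lemma l2i_scalel k (c : R -> C) (f g : matfun R k 1) : sbnd c -> L2 f -> L2 g ->
  l2i k (fun t => c t *: f t) g = circle_int (fun t => c t * \sum_i (f t i 0 * Num.conj (g t i 0))).
Proof.
move=> hc hf hg; congr circle_int; apply/funext => t; rewrite mulr_sumr.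
by apply: eq_bigr => i _; rewrite big_ord1 mxE mulrA.
Qed.

(* Compare Fourier coefficients of [|f|^2] and [|g|^2]: for [n >= 0],
   [t0 <z^n f, f> = a(z^n f, g) = <z^n (t0 g + resid), g> = t0 <z^n g, g>]. *)
Lemma singular_norm f g : singular f g ->
  ae_circle (fun t => sqnorm (f t) = sqnorm (g t)).
Proof.
move=> fg; have [hf hg _ _] := fg; have [rg _] := singular_rel fg.
have Lf := D_L2 hf; have Lg := E_L2 hg; have Lq := resid_L2 Lf Lg.
have [q1 q2] := singular_resid fg.
have hz (n : nat) : sHinf (fun t => zfun t ^ (n : int) : C).
  apply: (sH2_sHinf (M := 1)); first exact: sH2_zX.
  by apply: aeT => t _; rewrite csq_zX.
have t0c : Complex t0 0 != 0 :> C by apply/eqP => -[] h; move: t0_gt0; rewrite h ltxx.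
have key (n : nat) : l2i _ (fun t => zfun t ^ (n : int) *: f t) f =
    l2i _ (fun t => zfun t ^ (n : int) *: g t) g.
  have zb := sHinf_bnd (hz n).
  apply: (mulfI t0c); rewrite -rg; last exact: D_scale.
  rewrite /bform (_ : (fun t => Phi t *m (zfun t ^ n *: f t)) =
      Complex t0 0 *: (fun t => zfun t ^ (n : int) *: g t : 'cV[C]_(k1 + k2)) +
      (fun t => zfun t ^ (n : int) *: resid f g t)); last first.
    apply/funext => t; rewrite -[RHS]/(_ *: _ + _) -scalemxAr /resid scalerBr !scalerA.
    by rewrite [Complex _ _ * _]mulrC addrC subrK.
  have Lzg := L2_scale zb Lg; have Lzq := L2_scale zb Lq.
  rewrite (@si_lin _ _ _ _ HLE _ _ _ _ Lzg Lzq Lg) -[RHS]addr0; congr (_ + _).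
  rewrite l2i_sip// big_split_ord /= !big1 ?addr0// => i _; rewrite entry_scale; last first.
    have /H2minus_L2P[g1 _] := hg.
    have zq := sH2_zXM n (q1 i).
    by rewrite (si_conj H (g1 i).1 (sH2_cL2 zq)) (g1 i).2// cJ0.
  have /L2_col Lq' := Lq; have /L2_col Lg' := Lg.
  apply: sip_ae0; [by apply: measM; [exact: meas_zX|have [] := Lq' (rshift k1 i)]|
                   by have [] := Lg' (rshift k1 i)|].
  by apply: aeS (q2 i) => t _ h; rewrite /entry h mulr0.
pose w t : C := Complex (sqnorm (f t)) 0 - Complex (sqnorm (g t)) 0.
have cf k (F : matfun R k 1) : L2 F -> cL1 (fun t => Complex (sqnorm (F t)) 0).
  by move=> [_ h]; split => /=; [exact: h|exact: rint_cst].
have ww : cL1 w by apply: cL1B; exact: cf.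
have coefE k (F : matfun R k 1) (n : nat) : L2 F ->
    circle_int (fun t => Complex (sqnorm (F t)) 0 * zfun t ^ (n : int)) =
    l2i _ (fun t => zfun t ^ (n : int) *: F t) F.
  move=> hF; rewrite l2i_scalel//; last exact: sHinf_bnd.
  congr circle_int; apply/funext => t; rewrite mulrC; congr (_ * _).
  rewrite sqnorm_col; apply/complexP; rewrite ?Re_sum /=.
    by apply: eq_bigr => i _; rewrite mulJ.
  apply: esym; elim/big_ind: _ => // [x y hx hy|i _]; last by rewrite mulJ.
  by rewrite cImD hx hy addr0.
have w0 (n : nat) : circle_int (fun t => w t * zfun t ^ (n : int)) = 0.
  rewrite (_ : (fun t => _) = fun t => Complex (sqnorm (f t)) 0 * zfun t ^ (n : int) -
    Complex (sqnorm (g t)) 0 * zfun t ^ (n : int)); last by apply/funext => t; rewrite mulrBl.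
  rewrite cintB; [|by apply: cL1_zX; exact: cf|by apply: cL1_zX; exact: cf].
  by rewrite !coefE// key subrr.
have : ae_circle (fun t => w t = 0).
  apply: fourier_unique => // -[n|n]; first exact: w0.
  rewrite -[RHS]cJ0 -(w0 n.+1) -cintJ; last exact: cL1_zX.
  congr circle_int; apply/funext => t; rewrite cJM zXJ NegzE; congr (_ * _).
  by rewrite /w; apply/complexP; rewrite /= ?subr0 ?oppr0.
by apply: aeS => t _ /eqP; rewrite subr_eq0 => /eqP[].
Qed.

(** Multiplication by [conj(th)] keeps the upper block of [f] analytic by divisibility and keeps
    that of [g] in the complement of [H^2]; being unimodular, it changes neither norms nor the
    form. *)
Lemma singular_conj_scale f g (th : R -> C) : singular f g -> sinner th ->
  (forall i, sdiv th (entry f (lshift l2 i) 0)) ->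
  singular (fun t => Num.conj (th t) *: f t) (fun t => Num.conj (th t) *: g t).
Proof.
move=> [hf hg gf afg] [hth th1] hd.
have mth : measc th by case: hth.
have cb : sbnd (fun t => Num.conj (th t)) by apply: sbndJ; exact: sHinf_bnd.
have c1 : ae_circle (fun t => csq (Num.conj (th t)) = 1) by apply: aeS th1 => t _; rewrite csqJ.
have Lf := D_L2 hf; have Lg := E_L2 hg.
have /L2_col ef := Lf; have /L2_col eg := Lg.
have n2s k (F : matfun R k 1) : L2 F ->
    n2 (l2i k) (fun t => Num.conj (th t) *: F t) = n2 (l2i k) F.
  move=> /L2_col hF; apply: n2_ae.
  - by move=> i; rewrite entry_scale; apply: measM; [exact: measJ|have [] := hF i].
  - by move=> i; have [] := hF i.
  - by apply: aeS c1 => t _ h; rewrite sqnorm_scale h mul1r.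
split.
- have /H2_L2P[f1 f2] := hf.
  apply/H2_L2P; split=> i; rewrite entry_scale; last exact: sbnd_mulL2.
  have [f' hf' ff'] := hd i; apply: sH2_ae hf'.
    by apply: measM; [exact: measJ|exact: sH2_meas].
  by apply: aeS2 th1 ff' => t _ h1 h2; rewrite h2 mulrCA mulrA mulJ h1 mul1r.
- have /H2minus_L2P[g1 g2] := hg.
  apply/H2minus_L2P; split=> i; rewrite entry_scale; last exact: sbnd_mulL2.
  split; first by apply: sbnd_mulL2 => //; exact: (g1 i).1.
  move=> p hp; rewrite -((g1 i).2 _ (sHinf_mulH2 hth hp)); congr circle_int.
  by apply/funext => t; rewrite cJM; ring.
- by rewrite !n2s.
rewrite n2s// -afg; congr complex.Re; rewrite /bform.
rewrite (_ : (fun t => Phi t *m _) = fun t => Num.conj (th t) *: (Phi t *m f t)); last first.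
  by apply/funext => t; rewrite -scalemxAr.
have LPf := PhiL2 Lf; have /L2_col eP := LPf.
rewrite !l2i_sip//; try exact: L2_scale.
apply: eq_bigr => i _; rewrite !entry_scale sip_unimod//.
- exact: measJ.
- by have [] := eP i.
- by have [] := eg i.
Qed.

End SingularPairs.

(** * Lower bounds for co-analytic Toeplitz operators *)
Section ToeplitzForms.
Variable R : realType.
Local Notation C := R[i].
Local Notation Fn := (R -> C^o).
Local Notation snrm := (@nrm R (R -> C^o) (@sip R)).
Local Notation sn2 := (@n2 R (R -> C^o) (@sip R)).
Local Notation L2s := (@cL2 R).
Let H := sip_semi_inner R.

Lemma sip_Pp_lin (v : R -> C) (a : C) (f g r : R -> C) : sbnd v -> cL2 f -> cL2 g -> sH2 r ->
  sip (Pp (fun t => v t * (a * f t + g t))) r =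
  a * sip (Pp (fun t => v t * f t)) r + sip (Pp (fun t => v t * g t)) r.
Proof.
move=> hv hf hg hr; have vf := sbnd_mulL2 hv hf; have vg := sbnd_mulL2 hv hg.
have vfg : cL2 (fun t => v t * (a * f t + g t)).
  by apply: sbnd_mulL2 => //; apply: cL2D => //; exact: cL2Z.
rewrite !Pp_sip//.
have := @si_lin _ _ _ _ H a (fun t => v t * f t) (fun t => v t * g t) r vf vg (sH2_cL2 hr).
by move=> <-; congr circle_int; apply/funext => t; congr (_ * _); rewrite mulrDr mulrCA.
Qed.

(** Makes the root of the sum of [|P_+(v_i p)|^2] a seminorm in [p], with its triangle inequality,
    although [Pp] is linear only almost everywhere. *)
Definition toep k (v : 'I_k -> R -> C) (p q : Fn) : C :=
  \sum_i sip (Pp (fun t => v i t * p t)) (Pp (fun t => v i t * q t)).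

Lemma toep_semi_inner k (v : 'I_k -> R -> C) : (forall i, sbnd (v i)) ->
  @semi_inner R Fn L2s (toep v).
Proof.
move=> hv; have hP i f : cL2 f -> sH2 (Pp (fun t => v i t * f t)).
  by move=> hf; apply: Pp_H2; exact: sbnd_mulL2.
split.
- exact: (si0 H).
- exact: (siL H).
- move=> a f g r hf hg hr; rewrite /toep mulr_sumr -big_split; apply: eq_bigr => i _.
  exact: (sip_Pp_lin a (hv i) hf hg (hP i r hr)).
- move=> f g hf hg; rewrite /toep cJ_sum; apply: eq_bigr => i _.
  exact: (si_conj H (sH2_cL2 (hP i f hf)) (sH2_cL2 (hP i g hg))).
- move=> f hf; rewrite /toep Re_sum sumr_ge0// => i _.
  exact: (si_ge0 H (sH2_cL2 (hP i f hf))).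
Qed.

Lemma n2_toep k (v : 'I_k -> R -> C) (p : Fn) :
  n2 (toep v) p = \sum_i sn2 (Pp (fun t => v i t * p t)).
Proof. by rewrite /n2 /toep Re_sum. Qed.

Lemma sn2_contr (v f : R -> C) : measc v -> ae_circle (fun t => csq (v t) <= 1) -> cL2 f ->
  sn2 (Pp (fun t => v t * f t)) <= sn2 f.
Proof.
move=> mv v1 hf; apply: le_trans (sn2_Pp_le (cL2_bnd hf mv v1)) _.
by have := sn2_mul_le mv v1 hf; rewrite mul1r.
Qed.

Lemma n2_toep_le k (v : 'I_k -> R -> C) (p : Fn) : (forall i, measc (v i)) ->
  (forall i, ae_circle (fun t => csq (v i t) <= 1)) -> cL2 p ->
  n2 (toep v) p <= k%:R * sn2 p.
Proof.
move=> mv v1 hp; rewrite n2_toep.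
apply: le_trans (_ : \sum_(i < k) sn2 p <= _); last by rewrite sumr_const card_ord mulr_natl.
by apply: ler_sum => i _; exact: sn2_contr.
Qed.

Lemma sH2_test (f g : R -> C) : sH2 f -> sH2 g -> (forall r, sH2 r -> sip f r = sip g r) ->
  ae_circle (fun t => f t = g t).
Proof.
move=> hf hg h; have hd := sH2B hf hg.
have e : sip (fun t => f t - g t) (fun t => f t - g t) = 0.
  have := ipBl H (sH2_cL2 hf) (sH2_cL2 hg) (sH2_cL2 hd); move=> ->.
  by rewrite h// subrr.
have : ae_circle (fun t => f t - g t = 0) by apply: (sn2_eq0 (sH2_cL2 hd)); rewrite /n2 e.
by apply: aeS => t _ /eqP; rewrite subr_eq0 => /eqP.
Qed.

(* Co-analytic multipliers preserve the complement of [H^2]. *)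
Lemma Pp_conj_Pp (x f : R -> C) : sHinf x -> cL2 f ->
  ae_circle (fun t => Pp (fun t => Num.conj (x t) * f t) t =
                      Pp (fun t => Num.conj (x t) * Pp f t) t).
Proof.
move=> hx hf; have hc := sbndJ (sHinf_bnd hx).
have hP := Pp_H2 hf.
have xf := sbnd_mulL2 hc hf; have xP := sbnd_mulL2 hc (sH2_cL2 hP).
apply: sH2_test; [exact: Pp_H2|exact: Pp_H2|move=> r hr].
rewrite !Pp_sip//; have xr := sHinf_mulH2 hx hr.
transitivity (sip f (fun t => x t * r t)).
  by congr circle_int; apply/funext => t; rewrite cJM; ring.
rewrite -Pp_sip//.
by congr circle_int; apply/funext => t; rewrite cJM; ring.
Qed.

Lemma sn2_Pp_ae (f g : R -> C) : cL2 f -> cL2 g -> ae_circle (fun t => f t = g t) ->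
  sn2 (Pp f) = sn2 (Pp g).
Proof.
move=> hf hg fg.
have : ae_circle (fun t => Pp f t = Pp g t).
  apply: sH2_test; [exact: Pp_H2|exact: Pp_H2|move=> r hr].
  rewrite !Pp_sip//; have mr := sH2_meas hr.
  by apply: sip_ae => //; [case: hf|case: hg|exact: aeT].
move=> h; apply: sn2_ae; [exact: sH2_meas (Pp_H2 hf)|exact: sH2_meas (Pp_H2 hg)|].
by apply: aeS h => t _ ->.
Qed.

(** Here [T] approximates a vector within [e], with difference [D]: the letters [s] are values of
    the seminorm [Sx] at [T], at the vector and at [D], and [nT], [np] are norms. *)
Lemma seminorm_perturb (a b e sT sp sD nT np : R) : 0 <= a -> a * nT <= sT ->
  sT <= sp + sD -> sD <= b * e -> np <= nT + e -> a * np <= sp + e * (a + b).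
Proof. by move=> a0 h1 h2 h3 h4; have := ler_wpM2l a0 h4; lra. Qed.

Section LowerBound.
Variables (k : nat) (x : 'I_k -> R -> C) (u : R -> C).
Hypothesis hx : forall i, sHinf (x i).
Hypothesis x1 : forall i, ae_circle (fun t => csq (x i t) <= 1).
Hypothesis mu_ : measc u.
Hypothesis u1 : ae_circle (fun t => csq (u t) = 1).

Let cx i t := Num.conj (x i t).
Let cxu i t := Num.conj (x i t) * u t.
Let uu (i : 'I_1) := u.
Let Su := toep cxu.
Let Tu := toep uu.
Let Sx := toep cx.

Lemma u_bnd : sbnd u.
Proof. by split => //; exists 1; apply: aeS u1 => t _ ->. Qed.

Lemma cx_bnd i : sbnd (cx i).
Proof. by apply: sbndJ; exact: sHinf_bnd. Qed.

Let HSu : semi_inner L2s Su := toep_semi_inner (fun i => sbndM (cx_bnd i) u_bnd).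
Let HTu : semi_inner L2s Tu := toep_semi_inner (fun=> u_bnd).
Let HSx : semi_inner L2s Sx := toep_semi_inner cx_bnd.

Lemma Tu_n2 (p : Fn) : n2 Tu p = sn2 (Pp (fun t => u t * p t)).
Proof. by rewrite n2_toep big_ord1. Qed.

Lemma Tu_le (p : Fn) : cL2 p -> n2 Tu p <= sn2 p.
Proof.
by move=> hp; rewrite Tu_n2; apply: sn2_contr => //; apply: aeS u1 => t _ ->.
Qed.

Lemma cx1 i : ae_circle (fun t => csq (cx i t) <= 1).
Proof. by apply: aeS (x1 i) => t _; rewrite csqJ. Qed.

Lemma Sx_le (p : Fn) : cL2 p -> n2 Sx p <= k%:R * sn2 p.
Proof.
move=> hp; apply: n2_toep_le => // i; [by case: (cx_bnd i)|exact: cx1].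
Qed.

(** Since [conj(x i)] is co-analytic, the Toeplitz operator of [conj(x i) u] factors through that of
    [u]. *)
Lemma Su_Sx (p : Fn) : cL2 p -> n2 Su p = n2 Sx (Pp (fun t => u t * p t)).
Proof.
move=> hp; rewrite !n2_toep; apply: eq_bigr => i _.
have up := sbnd_mulL2 u_bnd hp.
have E : (fun t => cxu i t * p t) = fun t => Num.conj (x i t) * (u t * p t).
  by apply/funext => t; rewrite mulrA.
have h1 := Pp_conj_Pp (hx i) up.
rewrite E; apply: sn2_ae.
- by apply: sH2_meas; apply: Pp_H2; apply: sbnd_mulL2 => //; exact: cx_bnd.
- apply: sH2_meas; apply: Pp_H2; apply: sbnd_mulL2; first exact: cx_bnd.
  by apply: sH2_cL2; exact: Pp_H2.
- by apply: aeS h1 => t _ ->.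
Qed.

Lemma Su_le (p : Fn) : cL2 p -> n2 Su p <= k%:R * n2 Tu p.
Proof.
move=> hp; rewrite Su_Sx// Tu_n2; apply: Sx_le; apply: sH2_cL2; apply: Pp_H2.
exact: sbnd_mulL2 u_bnd hp.
Qed.

Let N : set Fn := [set p | sH2 p /\ n2 Tu p = 0].

Lemma null_lin (V : lmodType C) (E0 : set V) (ip : V -> V -> C) (HI : semi_inner E0 ip)
  (a : C) p q : E0 p -> E0 q -> n2 ip p = 0 -> n2 ip q = 0 -> n2 ip (a *: p + q) = 0.
Proof.
move=> hp hq p0 q0; have hap := siZ HI a hp.
have := ip_null HI (siD HI hap hq) hq q0.
have := ip_null HI (siD HI hap hq) hp p0.
move=> h1 h2; rewrite /n2 (ipDr HI)//; last exact: (siD HI).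
by rewrite (ipZr HI)// ?h1 ?h2 ?mulr0 ?addr0//; exact: (siD HI).
Qed.

Hypothesis injective : forall psi, sH2 psi ->
  (forall i p, sH2 p -> sip psi (fun t => x i t * p t) = 0) -> ae_circle (fun t => psi t = 0).

Hypothesis compactness : forall w : nat -> Fn, (forall j, sH2 (w j)) ->
  (forall j, sn2 (w j) = 1) ->
  (forall e, 0 < e -> exists N, forall j, (N <= j)%N -> n2 Su (w j) < e) ->
  exists phi : nat -> nat, (forall i j, (i < j)%N -> (phi i < phi j)%N) /\
    cauchy_seq (@sip R) (w \o phi).

Lemma Su_null p : sH2 p -> n2 Su p = 0 -> n2 Tu p = 0.
Proof.
move=> hp; have up := sbnd_mulL2 u_bnd (sH2_cL2 hp); have hT := Pp_H2 up.
rewrite Su_Sx; last exact: sH2_cL2.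
rewrite n2_toep => S0.
have hPx i := Pp_H2 (sbnd_mulL2 (cx_bnd i) (sH2_cL2 hT)).
have P0 i : sn2 (Pp (fun t => cx i t * Pp (fun t => u t * p t) t)) = 0.
  move: S0 => /eqP; rewrite psumr_eq0; last first.
    by move=> j _; apply: (n2_ge0 H); exact: sH2_cL2.
  by move=> /allP /(_ i); rewrite mem_index_enum => /(_ isT) /eqP.
rewrite Tu_n2; have T0 : ae_circle (fun t => Pp (fun t => u t * p t) t = 0).
  apply: injective => // i r hr.
  have := ip_null H (sH2_cL2 hr) (sH2_cL2 (hPx i)) (P0 i).
  rewrite (si_conj H (sH2_cL2 (hPx i)) (sH2_cL2 hr)) Pp_sip//; last first.
    by apply: sbnd_mulL2; [exact: cx_bnd|exact: sH2_cL2].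
  move/(congr1 Num.conj); rewrite cJK cJ0 => <-.
  by congr circle_int; apply/funext => t; rewrite cJM /cx; ring.
have := @sn2_ae R _ (fun=> 0) (sH2_meas hT) (meas_cst 0) _ => ->.
  by rewrite sn2E; under eq_fun do rewrite csq0; rewrite RI_cst mul0r mulr0.
by apply: aeS T0 => t _ ->.
Qed.

Let HH := sH2_semi_inner R.

Lemma N0 : N 0.
Proof. by split; [exact: sH2_0|rewrite /n2 (ip0l HTu)//; exact: cL2_cst]. Qed.

Lemma NL a p q : N p -> N q -> N (a *: p + q).
Proof.
move=> [hp p0] [hq q0]; split; first exact: (siL HH).
by apply: (null_lin HTu) => //; exact: sH2_cL2.
Qed.

Lemma cls_null p : cls (@sH2 R) (@sip R) N p -> n2 Tu p = 0.
Proof.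
move=> [hp happ]; have p2 := sH2_cL2 hp.
suff : nrm Tu p = 0 by move=> h; rewrite -(nrm_sqr HTu p2) h expr0n.
apply/eqP; rewrite eq_le nrm_ge0 andbT; apply/ler_addgt0Pr => e /happ[s [hs s0] ps].
rewrite add0r; apply: le_trans (ltW ps).
have s2 := sH2_cL2 hs; have d2 : L2s (p - s) by exact: (siB H).
have := nrmD HTu d2 s2; rewrite subrK => /le_trans; apply.
rewrite [X in _ + X](_ : _ = 0) ?addr0; last by rewrite /nrm s0 sqrtr0.
by rewrite /nrm ler_wsqrtr//; exact: Tu_le.
Qed.

Lemma nrm_null_sub (ip : Fn -> Fn -> C) (HI : semi_inner L2s ip) (p n : Fn) :
  cL2 p -> cL2 n -> n2 ip n = 0 -> n2 ip (p - n) = n2 ip p.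
Proof.
move=> hp hn n0; have d := siB HI hp hn.
rewrite (n2B HI hp hn) n0 /rip (ip_null HI hp hn n0) /= mulr0 subr0 addr0.
by [].
Qed.

(** Otherwise the constants [1 / (j + 1)] fail at some vectors. Made orthogonal to the kernel of
    [Tu] and normalized, these have [Su] tending to 0, and a limit would be a unit vector that is
    both in this kernel and orthogonal to it. *)
Lemma lower_bound : exists2 d, 0 < d &
  forall p, sH2 p -> d * n2 Tu p <= n2 Su p.
Proof.
apply: contrapT => hno.
have bad (j : nat) : exists w, [/\ sH2 w, sn2 w = 1, n2 Su w < j.+1%:R^-1 &
    forall n, N n -> sip w n = 0].
  have [p hp] : exists p, ~ (sH2 p -> j.+1%:R^-1 * n2 Tu p <= n2 Su p).
    apply/existsNP => h; apply: hno; exists (j.+1%:R^-1) => //; by rewrite invr_gt0.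
  move: hp => /not_implyP[hp /negP]; rewrite -ltNge => lt.
  have NH : N `<=` @sH2 R by move=> ? [].
  (* Subtracting the component in the kernel changes neither [Tu] nor [Su], as the latter is
     dominated by a multiple of the former. *)
  have [n cn orth] := cls_proj HH (@sH2_complete R) NH N0 NL hp.
  have hn : sH2 n by case: cn.
  have T0 := cls_null cn.
  have S0 : n2 Su n = 0.
    apply/eqP; rewrite eq_le (n2_ge0 HSu (sH2_cL2 hn)) andbT.
    by apply: le_trans (Su_le (sH2_cL2 hn)) _; rewrite T0 mulr0.
  have p2 := sH2_cL2 hp; have n2' := sH2_cL2 hn.
  have hm : sH2 (p - n) by exact: (siB HH).
  have m2 := sH2_cL2 hm.
  have lt' : n2 Su (p - n) < j.+1%:R^-1 * sn2 (p - n).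
    rewrite (nrm_null_sub HSu)//; apply: lt_le_trans lt _.
    rewrite ler_pM2l ?invr_gt0// -(nrm_null_sub HTu p2 n2' T0); exact: Tu_le.
  have m0 : 0 < sn2 (p - n).
    have := le_lt_trans (n2_ge0 HSu m2) lt'; by rewrite pmulr_rgt0 ?invr_gt0.
  pose a : C := Complex (Num.sqrt (sn2 (p - n)))^-1 0.
  have ac : complex.Re a ^+ 2 + complex.Im a ^+ 2 = (sn2 (p - n))^-1.
    by rewrite /= expr0n addr0 exprVn sqr_sqrtr// ltW.
  exists (a *: (p - n)); split.
  - exact: (siZ HH).
  - by rewrite (n2Z H)// ac mulVf// gt_eqF.
  - by rewrite (n2Z HSu)// ac mulrC ltr_pdivrMr// mulrC.
  - move=> q hq; have q2 : cL2 q by apply: sH2_cL2; case: hq.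
    have E := orth _ (sub_cls HH NH hq).
    by rewrite (ipZl H a m2 q2) E mulr0.
have [w hw] := choice bad.
have [|||phi [phim wC]] := compactness (w := w).
- by move=> j; case: (hw j).
- by move=> j; case: (hw j).
- move=> e e0; have [M hM] := inv_natS_lt e0; exists M => j /hM; apply: lt_trans.
  by case: (hw j).
have hwp j : sH2 ((w \o phi) j) by case: (hw (phi j)).
have [l hl lim] := sH2_complete hwp wC; have l2 := sH2_cL2 hl.
have phige j : (j <= phi j)%N.
  by elim: j => // j ih; exact: leq_ltn_trans ih (phim j j.+1 (leqnn _)).
have wl2 j : L2s ((w \o phi) j - l) by apply: (siB H) => //; exact: sH2_cL2.
have nl : snrm l = 1.
  apply/eqP; rewrite eq_le; apply/andP; split; apply/ler_addgt0Pr => e e0;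
    have [M /(_ M (leqnn M)) hM] := lim _ e0;
    have := nrm_dist H (sH2_cL2 (hwp M)) l2;
    (have -> : snrm ((w \o phi) M) = 1 by rewrite /nrm; case: (hw (phi M)) => _ -> _ _; exact: sqrtr1);
    move=> /le_trans /(_ (ltW hM)); rewrite ler_norml => /andP[]; lra.
have Sl : n2 Su l = 0.
  suff : nrm Su l = 0 by move=> h; rewrite -(nrm_sqr HSu l2) h expr0n.
  apply/eqP; rewrite eq_le nrm_ge0 andbT; apply/ler_addgt0Pr => e e0.
  pose c := Num.sqrt (k%:R : R) + 1.
  have c0 : 0 < c by rewrite ltr_wpDl// sqrtr_ge0.
  have e2 : 0 < e / 2 by rewrite divr_gt0.
  have [M hM] := lim (e / 2 / c) (divr_gt0 e2 c0).
  have [M' hM'] := inv_natS_lt (exprn_gt0 2 e2).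
  pose j := maxn M M'.
  have h1 := hM j (leq_maxl _ _); have h2 := hM' (phi j) (leq_trans (leq_maxr M M') (phige j)).
  have wj2 := sH2_cL2 (hwp j).
  rewrite add0r; apply: le_trans (_ : nrm Su ((w \o phi) j - l) + nrm Su ((w \o phi) j) <= _).
    have := nrm_tri HSu l2 wj2 (cL2_cst 0); rewrite !subr0 (nrm_sub HSu l2 wj2); exact.
  have h3 : nrm Su ((w \o phi) j) <= e / 2.
    rewrite -[leRHS]ger0_norm ?(ltW e2)// -sqrtr_sqr /nrm ler_wsqrtr//.
    by case: (hw (phi j)) => _ _ h _; apply: ltW; exact: lt_trans h h2.
  have h4 : nrm Su ((w \o phi) j - l) <= e / 2.
    apply: le_trans (_ : c * snrm ((w \o phi) j - l) <= _).
      apply: le_trans (_ : Num.sqrt k%:R * snrm ((w \o phi) j - l) <= _).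
        rewrite /nrm -sqrtrM// ler_wsqrtr//; apply: le_trans (Su_le (wl2 j)) _.
        by apply: ler_wpM2l => //; exact: Tu_le.
      by rewrite ler_wpM2r ?nrm_ge0// lerDl.
    by rewrite mulrC -ler_pdivlMr// ltW.
  by apply: le_trans (lerD h4 h3) _; rewrite -splitr.
(* Injectivity puts the limit into the kernel [N], to which all the [w j] are orthogonal; so [l] is
   orthogonal to itself, against its norm 1. *)
have lN : N l by split => //; exact: Su_null.
have ll : sip l l = 0.
  have ortho j : sip ((w \o phi) j) l = 0 by case: (hw (phi j)) => _ _ _; apply.
  apply: (approx_ip0 l2 l2) => e /lim[M /(_ M (leqnn M)) hM].
  exists ((w \o phi) M); split => //; first exact: sH2_cL2.
  by rewrite (nrm_sub H l2 (sH2_cL2 (hwp M))).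
have := nl; rewrite /nrm /n2 ll sqrtr0 => /esym/eqP; by rewrite oner_eq0.
Qed.

Hypothesis dense_range : forall r, sH2 r ->
  (forall p, sH2 p -> sip (Pp (fun t => u t * p t)) r = 0) -> ae_circle (fun t => r t = 0).

(** The difference between [psi] and its projection onto the closure of the range is orthogonal to
    the range, so [dense_range] makes it 0 almost everywhere. *)
Lemma range_approx psi : sH2 psi -> forall e, 0 < e ->
  exists2 p, sH2 p & snrm (fun t => psi t - Pp (fun t => u t * p t) t) < e.
Proof.
move=> hpsi e e0.
pose S : set Fn := [set g | sH2 g /\ exists2 p, sH2 p &
  ae_circle (fun t => g t = Pp (fun t => u t * p t) t)].
have hP p : sH2 p -> sH2 (Pp (fun t => u t * p t)).
  by move=> hp; apply: Pp_H2; apply: sbnd_mulL2; [exact: u_bnd|exact: sH2_cL2].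
have S0 : S 0.
  split; first exact: sH2_0.
  exists (fun=> 0); first exact: sH2_0.
  apply: sH2_test; [exact: sH2_0|by apply: hP; exact: sH2_0|move=> r hr].
  rewrite Pp_sip//; last by apply: sbnd_mulL2; [exact: u_bnd|exact: cL2_cst].
  by congr circle_int; apply/funext => t; rewrite mulr0.
have SL a f g : S f -> S g -> S (a *: f + g).
  move=> [hf [p hp fp]] [hg [q hq gq]]; split; first exact: (siL HH).
  exists (fun t => a * p t + q t); first exact: sH2_lin.
  have hlin : sH2 (fun t => a * Pp (fun t => u t * p t) t + Pp (fun t => u t * q t) t).
    by apply: sH2_lin; exact: hP.
  have : ae_circle (fun t => a * Pp (fun t => u t * p t) t + Pp (fun t => u t * q t) t =
      Pp (fun t => u t * (a * p t + q t)) t).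
    apply: sH2_test => //; first by apply: hP; exact: sH2_lin.
    move=> r hr; rewrite (sip_Pp_lin a u_bnd (sH2_cL2 hp) (sH2_cL2 hq) hr).
    exact: (@si_lin _ _ _ _ H a _ _ r (sH2_cL2 (hP p hp)) (sH2_cL2 (hP q hq)) (sH2_cL2 hr)).
  by apply: aeS3 fp gq => t _ h1 h2 <-; rewrite -[LHS]/(a * _ + _) h1 h2.
have SH : S `<=` @sH2 R by move=> ? [].
have [q clq orth] := cls_proj HH (@sH2_complete R) SH S0 SL hpsi.
have hq : sH2 q by case: clq.
have hd : sH2 (psi - q) by exact: (siB HH).
have d0 : ae_circle (fun t => (psi - q) t = 0).
  apply: dense_range => // p hp.
  have SP : S (Pp (fun t => u t * p t)) by split; [exact: hP|exists p => //; exact: aeT].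
  have E := orth _ (sub_cls HH SH SP).
  by have := si_conj H (sH2_cL2 hd) (sH2_cL2 (hP p hp)); rewrite E cJ0.
have [_ /(_ e e0)[g [hg [p hp gp]] qg]] := clq.
exists p => //; apply: le_lt_trans qg; rewrite le_eqVlt; apply/orP; left; apply/eqP.
apply: snrm_ae.
- by apply: measB; apply: sH2_meas => //; exact: hP.
- by apply: sH2_meas; exact: (siB HH).
apply: aeS2 d0 gp => t _ h1 h2; congr csq.
move: h1 => /eqP; rewrite -[(psi - q) t]/(psi t - q t) subr_eq0 => /eqP ->.
by rewrite -h2.
Qed.

(** On the range of [T_u] this is [lower_bound] read through [Su_Sx]. Density extends it to [H^2],
    as both the norm and the seminorm [Sx] are continuous. *)
Theorem toeplitz_bounded_below : exists2 d, 0 < d & forall p, sH2 p ->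
  d * sn2 p <= \sum_i sn2 (Pp (fun t => Num.conj (x i t) * p t)).
Proof.
have [d d0 hd] := lower_bound; exists d => // psi hpsi.
rewrite -[leRHS](n2_toep cx) -/Sx.
have psi2 := sH2_cL2 hpsi.
suff h : Num.sqrt d * snrm psi <= nrm Sx psi.
  rewrite -(nrm_sqr HSx psi2) -(nrm_sqr H psi2) -[X in X * _](sqr_sqrtr (ltW d0)) -exprMn.
  by rewrite ler_pXn2r// nnegrE ?mulr_ge0 ?sqrtr_ge0 ?nrm_ge0.
apply: (@le_addeps _ _ _ (Num.sqrt d + Num.sqrt k%:R)); first by rewrite addr_ge0 ?sqrtr_ge0.
move=> e e0; have [p hp pe] := range_approx hpsi e0.
pose T := Pp (fun t => u t * p t).
have hT : sH2 T by apply: Pp_H2; apply: sbnd_mulL2; [exact: u_bnd|exact: sH2_cL2].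
have T2 := sH2_cL2 hT; have d2 : cL2 (fun t => psi t - T t) by exact: cL2B.
have h1 : Num.sqrt d * snrm T <= nrm Sx T.
  have := hd _ hp; rewrite Tu_n2 Su_Sx; last exact: sH2_cL2.
  by move=> h; rewrite /nrm -sqrtrM ?(ltW d0)// ler_wsqrtr.
rewrite -/T in pe; clearbody T.
pose D : Fn := fun t => psi t - T t.
have h2 : nrm Sx T <= nrm Sx psi + nrm Sx D.
  have DE : (psi : Fn) - D = T by apply/funext => t; exact: (subKr (psi t) (T t)).
  by rewrite -[X in nrm _ X <= _]DE; exact: (nrmB HSx psi2 d2).
have h3 : nrm Sx D <= Num.sqrt k%:R * e.
  apply: le_trans (_ : Num.sqrt k%:R * snrm D <= _).
    by rewrite /nrm -sqrtrM// ler_wsqrtr//; exact: Sx_le.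
  by rewrite ler_wpM2l ?sqrtr_ge0// ltW.
have h4 : snrm psi <= snrm T + e.
  have DE : (T : Fn) + D = psi by apply/funext => t; exact: (subrKC (T t) (psi t)).
  apply: le_trans (_ : snrm T + snrm D <= _); last by rewrite lerD2l ltW.
  by rewrite -[X in snrm X <= _]DE; exact: (nrmD H T2 d2).
exact: (seminorm_perturb (sqrtr_ge0 d) h1 h2 h3 h4).
Qed.

End LowerBound.
End ToeplitzForms.

(** * Left invertibility of one complement *)
Section OneSide.
Variable R : realType.
Local Notation C := R[i].
Local Notation Fn := (R -> C^o).
Local Notation snrm := (@nrm R (R -> C^o) (@sip R)).
Local Notation sn2 := (@n2 R (R -> C^o) (@sip R)).
Local Notation L2s := (@cL2 R).
Local Notation l2i k := (@l2inner R k 1).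
Let H := sip_semi_inner R.

(** The form in which the essential norm enters: almost maximizing pairs have convergent
    subsequences. Stated through the sesquilinear form and for both components, it is symmetric
    under the flip. *)
Definition singular_compact k1 k2 l1 l2 (Phi : matfun R (k1 + k2) (l1 + l2)) (t0 : R) : Prop :=
  forall (r : nat -> matfun R (l1 + l2) 1) (s : nat -> matfun R (k1 + k2) 1),
  (forall j, @H2_L2 R l1 l2 (r j)) -> (forall j, @H2minus_L2 R k1 k2 (s j)) ->
  (forall j, n2 (l2i _) (r j) <= 1) -> (forall j, n2 (l2i _) (s j) <= 1) ->
  (forall e, 0 < e -> exists N, forall j, (N <= j)%N ->
    t0 - e < complex.Re (bform Phi (r j) (s j))) ->
  exists phi : nat -> nat, [/\ forall i j, (i < j)%N -> (phi i < phi j)%N,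
    cauchy_seq (l2i _) (r \o phi) & cauchy_seq (l2i _) (s \o phi)].

Section Quotient.
Variable h : R -> C.
Hypothesis oh : outers h.

Lemma quot_le (a : R -> C) : measc a -> ae_circle (fun t => csq (a t) <= csq (h t)) ->
  measc (fun t => a t / h t) /\ ae_circle (fun t => csq (a t / h t) <= 1).
Proof.
move=> ma ah; split; first by apply: measM => //; apply: measV; exact: sH2_meas oh.1.
apply: aeS2 ah (outers_neq0 oh) => t _ h1 h0.
have c0 : 0 < csq (h t).
  by rewrite lt_neqAle csq_ge0 andbT eq_sym; apply: contra_neq h0; exact: csq_eq0.
by rewrite csqM csqV// ler_pdivrMr// mul1r.
Qed.

Lemma quot_sHinf (a : R -> C) : sH2 a -> sbnd (fun t => a t / h t) ->
  sHinf (fun t => a t / h t).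
Proof.
move=> ha [ma [M hM]]; apply: (sH2_sHinf _ hM).
apply: (outer_div oh ha (sH2_cst 1)); first exact: (cL2_ae_bnd (M := M)).
by apply: aeS (outers_neq0 oh) => t _ h0; rewrite mulfVK// mulr1.
Qed.

End Quotient.

Variables (k k2 l1 l2 : nat).
Local Notation VD := (matfun R (l1 + l2) 1).
Local Notation VE := (matfun R (k.+1 + k2) 1).
Local Notation D := (@H2_L2 R l1 l2).
Local Notation E := (@H2minus_L2 R k.+1 k2).
Local Notation n2D := (@n2 R VD (l2i (l1 + l2))).
Local Notation n2E := (@n2 R VE (l2i (k.+1 + k2))).
Let HLD : @semi_inner R VD (@L2 R _ 1) (l2i (l1 + l2)) := L2_semi_inner R (l1 + l2) 1.
Let HLE : @semi_inner R VE (@L2 R _ 1) (l2i (k.+1 + k2)) := L2_semi_inner R (k.+1 + k2) 1.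

Variables (Phi : matfun R (k.+1 + k2) (l1 + l2)) (t0 : R).
Hypothesis Phi_bnd : Linf Phi.
Hypothesis t0_gt0 : 0 < t0.
Hypothesis bform_le : forall r s, D r -> E s ->
  complex.Re (bform Phi r s) <= t0 * (nrm (l2i _) r * nrm (l2i _) s).
Hypothesis compact : singular_compact Phi t0.

Section Lift.
Variables (F : VD) (G : VE) (h : R -> C).
Hypothesis FG : singular Phi t0 F G.
Hypothesis oh : outers h.
Hypothesis Fh : ae_circle (fun t => sqnorm (F t) = csq (h t)).

Let LF : L2 F. Proof. by have [/D_L2] := FG. Qed.
Let LG : L2 G. Proof. by have [_ /E_L2] := FG. Qed.
Let mF i : measc (entry F i 0). Proof. by have [] := (L2_col _).1 LF i. Qed.
Let mG i : measc (entry G i 0). Proof. by have [] := (L2_col _).1 LG i. Qed.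

Lemma Gh : ae_circle (fun t => sqnorm (G t) = csq (h t)).
Proof. by apply: aeS2 Fh (singular_norm Phi_bnd t0_gt0 bform_le FG) => t _ <- ->. Qed.

Lemma F_quot i : measc (fun t => entry F i 0 t / h t) /\
  ae_circle (fun t => csq (entry F i 0 t / h t) <= 1).
Proof. apply: quot_le => //; apply: aeS Fh => t _ <-; exact: csq_sqnorm. Qed.

Lemma G_quot i : measc (fun t => entry G i 0 t / h t) /\
  ae_circle (fun t => csq (entry G i 0 t / h t) <= 1).
Proof. apply: quot_le => //; apply: aeS Gh => t _ <-; exact: csq_sqnorm. Qed.

Let F_bnd i : sbnd (fun t => entry F i 0 t / h t).
Proof. by have [m b] := F_quot i; split => //; exists 1. Qed.
Let G_bnd i : sbnd (fun t => entry G i 0 t / h t).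
Proof. by have [m b] := G_quot i; split => //; exists 1. Qed.

Local Notation q := (resid Phi t0 F G).

Lemma q_bnd i : sbnd (fun t => entry q i 0 t / h t).
Proof.
have -> : (fun t => entry q i 0 t / h t) = fun t =>
    (\sum_j entry Phi i j t * (entry F j 0 t / h t)) - Complex t0 0 * (entry G i 0 t / h t).
  apply/funext => t; rewrite /entry /resid !mxE mulrBl mulr_suml mulrA; congr (_ - _).
  by apply: eq_bigr => j _; rewrite mulrA.
apply: sbndB; last by apply: sbndM => //; exact: sbnd_cst.
by apply: sbnd_sum => j; apply: sbndM => //; exact: ((Linf_bnd _).1 Phi_bnd).
Qed.

Lemma q_sHinf i : sHinf (fun t => entry q (lshift k2 i) 0 t / h t).
Proof.
by apply: quot_sHinf => //; [exact: (singular_resid Phi_bnd t0_gt0 bform_le FG).1|exact: q_bnd].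
Qed.

(** As [F] and [G] have pointwise norm [|h|], the factor [phi / h] gives both multiples the norm of
    [phi]. The multiple [liftE0] of [G] need not stay in [E]; [liftE] removes the analytic part of
    its upper block. *)
Definition liftD (phi : R -> C) : VD := fun t => (phi t / h t) *: F t.
Definition liftE0 (phi : R -> C) : VE := fun t => (phi t / h t) *: G t.
Definition liftE (phi : R -> C) : VE := fun t =>
  liftE0 phi t - col_mx (\col_i Pp (entry (liftE0 phi) (lshift k2 i) 0) t) 0.

Lemma entry_liftD phi i : entry (liftD phi) i 0 = fun t => entry F i 0 t / h t * phi t.
Proof. by apply/funext => t; rewrite /entry mxE; ring. Qed.

Lemma entry_liftE0 phi i : entry (liftE0 phi) i 0 = fun t => entry G i 0 t / h t * phi t.
Proof. by apply/funext => t; rewrite /entry mxE; ring. Qed.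

Lemma entry_liftE_l phi i : entry (liftE phi) (lshift k2 i) 0 = fun t =>
  entry (liftE0 phi) (lshift k2 i) 0 t - Pp (entry (liftE0 phi) (lshift k2 i) 0) t.
Proof.
apply/funext => t; rewrite {1}/entry /liftE mxE [X in _ + X]mxE col_mxEu [X in _ - X]mxE.
by [].
Qed.

Lemma entry_liftE_r phi i : entry (liftE phi) (rshift k.+1 i) 0 =
  entry (liftE0 phi) (rshift k.+1 i) 0.
Proof.
apply/funext => t; rewrite {1}/entry /liftE mxE [X in _ + X]mxE col_mxEd [X in _ - X]mxE.
by rewrite subr0.
Qed.

Lemma D_liftD phi : sH2 phi -> D (liftD phi).
Proof.
move=> hp; have [/H2_L2P[F1 F2] _ _ _] := FG.
apply/H2_L2P; split=> i; rewrite entry_liftD.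
- by apply: sHinf_mulH2 => //; exact: quot_sHinf.
- by apply: sbnd_mulL2 => //; exact: sH2_cL2.
Qed.

Lemma cL2_liftE0 phi i : cL2 phi -> cL2 (entry (liftE0 phi) i 0).
Proof. by move=> hp; rewrite entry_liftE0; exact: sbnd_mulL2. Qed.

Lemma E_liftE phi : sH2 phi -> E (liftE phi).
Proof.
move=> hp; have p2 := sH2_cL2 hp; apply/H2minus_L2P; split=> i.
  by rewrite entry_liftE_l; apply: Pp_H2m; exact: cL2_liftE0.
by rewrite entry_liftE_r; exact: cL2_liftE0.
Qed.

Lemma n2_scale_quot j (A : matfun R j 1) phi : (forall i, measc (entry A i 0)) ->
  ae_circle (fun t => sqnorm (A t) = csq (h t)) -> measc phi ->
  n2 (l2i j) (fun t => (phi t / h t) *: A t) = sn2 phi.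
Proof.
move=> mA Ah mp; rewrite n2_sqnorm sn2E; congr (_ * _).
have mh := sH2_meas oh.1.
apply: RI_ae.
- apply: meas_sqnorm => i; rewrite entry_scale; apply: measM => //.
  by apply: measM => //; exact: measV.
- exact: meas_csq.
apply: aeS2 Ah (outers_neq0 oh) => t _ e h0.
have c0 : csq (h t) != 0 by apply: contra_neq h0; exact: csq_eq0.
by rewrite sqnorm_scale e csqM csqV// mulfVK.
Qed.

Lemma n2_liftD phi : sH2 phi -> n2D (liftD phi) = sn2 phi.
Proof. by move=> hp; apply: n2_scale_quot => //; exact: sH2_meas. Qed.

Lemma n2_liftE phi : sH2 phi -> n2E (liftE phi) =
  sn2 phi - \sum_i sn2 (Pp (entry (liftE0 phi) (lshift k2 i) 0)).
Proof.
move=> hp; have p2 := sH2_cL2 hp.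
have L0 : L2 (liftE0 phi) by apply/L2_col => i; exact: cL2_liftE0.
have L1 : L2 (liftE phi) by apply: E_L2; exact: E_liftE.
have <- : n2E (liftE0 phi) = sn2 phi.
  by apply: n2_scale_quot => //; [exact: Gh|exact: sH2_meas].
rewrite !n2_col// !big_split_ord /= addrAC; congr (_ + _); last first.
  by apply: eq_bigr => i _; rewrite entry_liftE_r.
rewrite -sumrB; apply: eq_bigr => i _; rewrite entry_liftE_l.
by rewrite [in RHS](sn2_Pp (cL2_liftE0 (lshift k2 i) p2)) [RHS]addrC addKr.
Qed.

(** [Phi] maps [liftD phi] to [t0] times [liftE0 phi] plus [phi / h] times the residual. In the
    upper block the projected part and the residual term are analytic, so orthogonal to [liftE phi];
    in the lower block the residual is 0. *)
Lemma bform_lift phi : sH2 phi ->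
  bform Phi (liftD phi) (liftE phi) = Complex t0 0 * l2i _ (liftE phi) (liftE phi).
Proof.
move=> hp; have p2 := sH2_cL2 hp; have [q1 q2] := singular_resid Phi_bnd t0_gt0 bform_le FG.
have L1 : L2 (liftE phi) by apply: E_L2; exact: E_liftE.
have LD : L2 (liftD phi) by apply: D_L2; exact: D_liftD.
have eP i : entry (fun t => Phi t *m liftD phi t) i 0 = fun t =>
    Complex t0 0 * entry (liftE0 phi) i 0 t + entry q i 0 t / h t * phi t.
  apply/funext => t.
  have PE : Phi t *m liftD phi t = Complex t0 0 *: liftE0 phi t + (phi t / h t) *: q t.
    rewrite /liftD /liftE0 /resid -scalemxAr scalerBr !scalerA [_ * Complex t0 0]mulrC addrC.
    by rewrite subrK.
  have addE (A B : 'cV[C]_(k.+1 + k2)) : (A + B) i 0 = A i 0 + B i 0 by rewrite mxE.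
  have scE c (A : 'cV[C]_(k.+1 + k2)) : (c *: A) i 0 = c * A i 0 by rewrite mxE.
  by rewrite {1}/entry PE addE (scE _ (liftE0 phi t)) (scE _ (q t)) /entry; congr (_ + _); ring.
rewrite /bform l2i_sip//; last exact: L2_mul.
rewrite l2i_sip// mulr_sumr !big_split_ord /=; congr (_ + _); apply: eq_bigr => i _; rewrite eP.
  have Em : sH2m (entry (liftE phi) (lshift k2 i) 0).
    by have /H2minus_L2P[h1 _] := E_liftE hp.
  have e2 := cL2_liftE0 (lshift k2 i) p2.
  pose w t := Complex t0 0 * Pp (entry (liftE0 phi) (lshift k2 i) 0) t +
    entry q (lshift k2 i) 0 t / h t * phi t.
  have hw : sH2 w.
    apply: sH2_lin; first exact: Pp_H2.
    by apply: sHinf_mulH2 => //; exact: q_sHinf.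
  have W0 : sip w (entry (liftE phi) (lshift k2 i) 0) = 0.
    by rewrite (si_conj H Em.1 (sH2_cL2 hw)) Em.2// cJ0.
  have := @si_lin _ _ _ _ H (Complex t0 0) (entry (liftE phi) (lshift k2 i) 0) w
    (entry (liftE phi) (lshift k2 i) 0) Em.1 (sH2_cL2 hw) Em.1.
  rewrite W0 addr0 => <-; congr circle_int; apply/funext => t; congr (_ * _).
  rewrite -[RHS]/(_ * _ + _) /w addrA -mulrDr; congr (_ * _ + _).
  by rewrite entry_liftE_l subrK.
have e2 := cL2_liftE0 (rshift k.+1 i) p2.
rewrite entry_liftE_r -(ipZl H (Complex t0 0) e2 e2).
apply: sip_ae.
- apply: measD; first by apply: measM; [exact: meas_cst|case: e2].
  by apply: measM; [by have [] := q_bnd (rshift k.+1 i)|exact: sH2_meas].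
- by case: e2.
- by apply: measM; [exact: meas_cst|case: e2].
- by case: e2.
- by apply: aeS (q2 i) => t _ e; rewrite [entry q _ _ _]e mul0r mul0r addr0.
- exact: aeT.
Qed.

Lemma liftD_sub (a b : Fn) : liftD a - liftD b = liftD (a - b).
Proof.
by apply/funext => t; rewrite -[LHS]/(_ *: _ - _ *: _) -scalerBl -mulrBl.
Qed.

(** For a unit vector the lifted pair has form value [t0] times [1 - S j], which tends to [t0].
    Compactness gives a Cauchy subsequence of the first components, and [liftD] is linear and
    isometric. *)
Lemma lift_compact (w : nat -> Fn) : (forall j, sH2 (w j)) -> (forall j, sn2 (w j) = 1) ->
  (forall e, 0 < e -> exists N, forall j, (N <= j)%N ->
     \sum_i sn2 (Pp (entry (liftE0 (w j)) (lshift k2 i) 0)) < e) ->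
  exists phi : nat -> nat, (forall i j, (i < j)%N -> (phi i < phi j)%N) /\
    cauchy_seq (@sip R) (w \o phi).
Proof.
move=> hw w1 hS.
pose S j := \sum_i sn2 (Pp (entry (liftE0 (w j)) (lshift k2 i) 0)).
have S0 j : 0 <= S j.
  rewrite sumr_ge0// => i _; apply: (n2_ge0 H); apply: sH2_cL2; apply: Pp_H2.
  by apply: cL2_liftE0; exact: sH2_cL2.
have [||||e e0|phi [phim rC _]] := compact (r := fun j => liftD (w j)) (s := fun j => liftE (w j)).
- by move=> j; exact: D_liftD.
- by move=> j; exact: E_liftE.
- by move=> j; rewrite n2_liftD// w1.
- by move=> j; rewrite n2_liftE// w1 lerBlDr lerDl; exact: S0.
- have [N hN] := hS (e / t0) (divr_gt0 e0 t0_gt0); exists N => j /hN.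
  rewrite ltr_pdivlMr// bform_lift// cReZ -/(n2E _) n2_liftE// w1 -/(S j) => h1.
  by rewrite mulrBr mulr1 ltrD2l ltrN2 mulrC.
exists phi; split => // e /rC[N hN]; exists N => i j hi hj.
have := hN i j hi hj; rewrite /= liftD_sub /nrm n2_liftD//.
by apply: sH2B; exact: hw.
Qed.

End Lift.

(** The column [x] is [w_1]; a lower bound for its co-analytic Toeplitz operators feeds
    [toeplitz_corona]. The data enter through a singular pair and [singular_compact] only, so the
    flipped data qualify as well. *)
Theorem complement_of_dual_left_invertible (f : VD) (g : VE) (h th tau : R -> C)
    (Wc : matfun R k.+1 k) :
  singular Phi t0 f g -> outers h -> ae_circle (fun t => sqnorm (f t) = csq (h t)) ->
  sinner th -> (forall i, sdiv th (entry f (lshift l2 i) 0)) ->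
  sgcd (fun i => flip (entry g (lshift k2 i) 0)) tau ->
  completes (fun t => (Num.conj (tau t) / h t) *:
    (Num.conj (zfun t) *: conjmf (usubmx (g t)))) Wc ->
  left_invertible Wc.
Proof.
move=> fg oh fh hth hd hg [xo [xi [[hxo _] [hxi _] xE [[hWc _] oWc] hU]]].
pose F : VD := fun t => Num.conj (th t) *: f t.
pose G : VE := fun t => Num.conj (th t) *: g t.
have FG : singular Phi t0 F G by exact: singular_conj_scale.
have [hth0 th1] := hth; have [[htau0 tau1] taud _] := hg.
have Fh : ae_circle (fun t => sqnorm (F t) = csq (h t)).
  by apply: aeS2 fh th1 => t _ e1 e2; rewrite sqnorm_scale csqJ e2 mul1r.
have gh : ae_circle (fun t => sqnorm (g t) = csq (h t)).
  by apply: aeS2 fh (singular_norm Phi_bnd t0_gt0 bform_le fg) => t _ <- ->.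
have hh := oh.1; have mh := sH2_meas hh; have h0 := outers_neq0 oh.
have mtau : measc tau by case: htau0.
have mth : measc th by case: hth0.
have [_ hE _ _] := fg; have Lg := E_L2 hE; have /H2minus_L2P[g1 g2] := hE.
pose y i := flip (entry g (lshift k2 i) 0).
have hy i : sH2 (y i) by exact: flip_sH2m.
pose x i t := Num.conj (tau t) * y i t / h t.
have cty i : sH2 (fun t => Num.conj (tau t) * y i t).
  have [y' hy' yy] := taud i; apply: sH2_ae hy'.
    by apply: measM; [exact: measJ|exact: sH2_meas].
  by apply: aeS2 tau1 yy => t _ e1 e2; rewrite [y i t]e2 mulrCA mulrA mulJ e1 mul1r.
have [mx x1] : (forall i, measc (x i)) /\ (forall i, ae_circle (fun t => csq (x i t) <= 1)).
  have key i : measc (x i) /\ ae_circle (fun t => csq (x i t) <= 1).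
    apply: quot_le => //; first exact: sH2_meas (cty i).
    apply: aeS2 gh tau1 => t _ e1 e2.
    rewrite csqM csqJ e2 mul1r csq_flip -e1; exact: csq_sqnorm.
  by split=> i; case: (key i).
have hx i : sHinf (x i).
  by apply: (quot_sHinf oh (cty i)); split; [exact: mx|exists 1; exact: x1].
(* Chosen so that [conj(x i) u w] is the upper entry of [liftE0 G h w]: the factors [tau], [z] and
   [1 / conj(h)] of [conj(x i)] cancel, and what remains is the entry of [G] divided by [h]. *)
pose u t := Num.conj (tau t) * (Num.conj (zfun t) * (Num.conj (th t) * (Num.conj (h t) / h t))).
have mu_ : measc u.
  apply: measM; first exact: measJ.
  apply: measM; first by apply: measJ; exact: meas_z.
  apply: measM; first exact: measJ.
  by apply: measM; [exact: measJ|exact: measV].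
have u1 : ae_circle (fun t => csq (u t) = 1).
  apply: aeS3 tau1 th1 h0 => t _ e1 e2 e3.
  have c0 : csq (h t) != 0 by apply: contra_neq e3; exact: csq_eq0.
  by rewrite /u !csqM !csqJ e1 e2 csq_z !mul1r csqV// divff.
have ubnd : sbnd u by split => //; exists 1; apply: aeS u1 => t _ ->.
have xu i (w : R -> C) : ae_circle (fun t => Num.conj (x i t) * u t * w t =
    entry (liftE0 G h w) (lshift k2 i) 0 t).
  apply: aeS2 tau1 h0 => t _ e1 e2.
  have e3 : Num.conj (h t) != 0.
    by apply: contra_neq e2 => e; rewrite -[LHS]cJK e cJ0.
  rewrite entry_liftE0 /x /y /flip /u entry_scale !cJM fmorphV !cJK.
  have := mulJ (tau t); rewrite e1 => e4; have := zJ t => e5.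
  set A := tau t in e4 *; set A' := Num.conj A in e4 *.
  set Z := zfun t in e5 *; set Z' := Num.conj Z in e5 *.
  have -> : A * (Z * entry g (lshift k2 i) 0 t) / Num.conj (h t) *
      (A' * (Z' * (Num.conj (th t) * (Num.conj (h t) / h t)))) * w t =
      (A * A') * (Z' * Z) * (Num.conj (th t) * entry g (lshift k2 i) 0 t / h t * w t) *
      (Num.conj (h t) / Num.conj (h t)) by ring.
  by rewrite e4 e5 divff// -[Complex 1 0]/(1 : C) !mul1r mulr1.
have [d d0 hlow] : exists2 d, 0 < d & forall p, sH2 p ->
    d * sn2 p <= \sum_i sn2 (Pp (fun t => Num.conj (x i t) * p t)).
  apply: (toeplitz_bounded_below hx x1 mu_ u1).
  - move=> psi hpsi; apply: (sgcd_injective hy hg hh hx) => // i.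
    by apply: aeS h0 => t _ e; rewrite /x mulfVK.
  - move=> w hw w1 hS; apply: (lift_compact FG oh Fh hw w1) => e /hS[N hN].
    exists N => j /hN; rewrite n2_toep; congr (_ < _); apply: eq_bigr => i _.
    have wj := sH2_cL2 (hw j).
    apply: sn2_Pp_ae; last exact: xu.
      by apply: sbnd_mulL2 => //; apply: sbndM => //; apply: sbndJ; exact: sHinf_bnd.
    exact: (cL2_liftE0 FG oh Fh (lshift k2 i) wj).
  (* Dense range: [conj(u) r] lies in [H^2_-], so its flip is in [H^2]. Multiplying by [conj(h)]
     clears the denominator of [conj(u)] and leads to the situation of [H1_conj_zero]. *)
  move=> r hr horth.
  pose v t := Num.conj (u t) * r t.
  have hv : cL2 v by apply: sbnd_mulL2; [exact: sbndJ|exact: sH2_cL2].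
  have vm : sH2m v.
    split => // p hp; have p2 := sH2_cL2 hp.
    rewrite (si_conj H p2 hv) (_ : sip p v = 0) ?cJ0//.
    rewrite -(horth p hp) Pp_sip//; last exact: sbnd_mulL2.
    by congr circle_int; apply/funext => t; rewrite /v cJM cJK; ring.
  have hfv := flip_sH2m vm.
  have hthh : sH2 (fun t => zfun t ^ (1 : int) * (tau t * (th t * h t))).
    by apply: (sH2_zXM 1); apply: sHinf_mulH2 => //; exact: sHinf_mulH2.
  have := H1_conj_zero hthh hr hh hfv.
  have E : ae_circle (fun t => zfun t ^ (1 : int) * (tau t * (th t * h t)) * r t =
      Num.conj (zfun t * (h t * flip v t))).
    apply: aeS h0 => t _ e; rewrite -[zfun t ^ 1]/(zfun t) /flip /v /u !cJM !cJK.
    have e3 : Num.conj (h t) != 0.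
      by apply: contra_neq e => e'; rewrite -[LHS]cJK e' cJ0.
    rewrite fmorphV; have e5 := zJ t.
    set Z := zfun t in e5 *; set Z' := Num.conj Z in e5 *.
    transitivity ((Z' * Z) * (Num.conj (h t) / Num.conj (h t)) *
      (Z * (tau t * (th t * h t)) * r t)); last by ring.
    by rewrite e5 divff// !mul1r.
  move=> /(_ E) prod0.
  have nz : ae_circle (fun t => tau t * (th t * h t) != 0).
    apply: aeS3 tau1 th1 h0 => t _ e1 e2 e3.
    have nz1 (c : C) : csq c = 1 -> c != 0.
      move=> ec; apply/eqP => c0; move: ec; rewrite c0 csq0 => /eqP.
      by rewrite eq_sym oner_eq0.
    by apply: mulf_neq0; [exact: nz1|apply: mulf_neq0 => //; exact: nz1].
  apply: aeS2 nz prod0 => t _ e1 /eqP.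
  by rewrite mulf_eq0 mulf_eq0 (negPf e1) (negPf (expfz_neq0 _ (zfun_neq0 t))) => /eqP.
have [b [hb bx]] := toeplitz_corona hx d0 hlow.
apply: (complement_left_invertible (b := fun i t => b i t * xo t) hxi hWc oWc hU).
  by move=> i; apply: sHinfM => //; exact/Hinf_smx.
apply: aeS2 bx xE => t _ <- e; apply: eq_bigr => i _.
have E : Num.conj (tau t) / h t * (Num.conj (zfun t) * Num.conj (g t (lshift k2 i) 0)) =
    xo t * xi t i 0.
  by have := congr1 (fun A : 'cV[C]_k.+1 => A i 0) e; rewrite !mxE.
by rewrite -mulrA -E /x /y /flip /entry; ring.
Qed.

End OneSide.

(** * Transposition *)
Section Duality.
Variable R : realType.
Local Notation C := R[i].
Local Notation l2i k := (@l2inner R k 1).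

Definition flipv k (F : matfun R k 1) : matfun R k 1 := fun t =>
  Num.conj (zfun t) *: conjmf (F t).

Lemma entry_flipv k (F : matfun R k 1) i : entry (flipv F) i 0 = flip (entry F i 0).
Proof. by apply/funext => t; rewrite /entry !mxE. Qed.

Lemma flipvK k (F : matfun R k 1) : flipv (flipv F) = F.
Proof.
apply/funext => t; apply/matrixP => i j; rewrite !mxE cJM !cJK mulrA.
by rewrite [_ * zfun t]zJ mul1r.
Qed.

Lemma flipv_sub k (F G : matfun R k 1) : flipv F - flipv G = flipv (F - G).
Proof.
apply/funext => t; apply/matrixP => i j.
by rewrite [LHS]mxE [X in _ + X]mxE !mxE cJB mulrBr.
Qed.

Lemma sqnorm_flipv k (F : matfun R k 1) t : sqnorm (flipv F t) = sqnorm (F t).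
Proof.
rewrite !sqnorm_col; apply: eq_bigr => i _.
by rewrite -[flipv F t i 0]/(entry (flipv F) i 0 t) entry_flipv csq_flip.
Qed.

Lemma n2_flipv k (F : matfun R k 1) : n2 (l2i k) (flipv F) = n2 (l2i k) F.
Proof. by rewrite !n2_sqnorm; under eq_Rintegral do rewrite sqnorm_flipv. Qed.

Lemma nrm_flipv k (F : matfun R k 1) : nrm (l2i k) (flipv F) = nrm (l2i k) F.
Proof. by rewrite /nrm n2_flipv. Qed.

Lemma H2_L2_flipv k l (F : matfun R (k + l) 1) : @H2_L2 R k l F ->
  @H2minus_L2 R k l (flipv F).
Proof.
move=> /H2_L2P[h1 h2]; apply/H2minus_L2P; split=> i; rewrite entry_flipv.
- exact: flip_sH2.
- exact: cL2_flip.
Qed.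

Lemma H2minus_L2_flipv k l (F : matfun R (k + l) 1) : @H2minus_L2 R k l F ->
  @H2_L2 R k l (flipv F).
Proof.
move=> /H2minus_L2P[h1 h2]; apply/H2_L2P; split=> i; rewrite entry_flipv.
- exact: flip_sH2m.
- exact: cL2_flip.
Qed.

Variables (k1 k2 l1 l2 : nat) (Phi : matfun R (k1 + k2) (l1 + l2)) (t0 : R).

Definition trmf : matfun R (l1 + l2) (k1 + k2) := fun t => (Phi t)^T.

(** The two factors [z] and [conj(z)] cancel, and the conjugations of the flips exchange the roles
    of the two arguments, so the value is the same without conjugation. *)
Lemma bform_flipv r s : bform trmf (flipv s) (flipv r) = bform Phi r s.
Proof.
congr circle_int; apply/funext => t.
transitivity (\sum_i \sum_j Phi t j i * r t i 0 * Num.conj (s t j 0)).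
  apply: eq_bigr => i _; rewrite big_ord1 !mxE mulr_suml; apply: eq_bigr => j _.
  rewrite !mxE cJM !cJK.
  have -> : Phi t j i * (Num.conj (zfun t) * Num.conj (s t j 0)) * (zfun t * r t i 0) =
    (Num.conj (zfun t) * zfun t) * (Phi t j i * r t i 0 * Num.conj (s t j 0)) by ring.
  by rewrite zJ mul1r.
rewrite exchange_big; apply: eq_bigr => j _; rewrite big_ord1 mxE mulr_suml.
by apply: eq_bigr.
Qed.

Lemma Linf_trmf : Linf Phi -> Linf trmf.
Proof.
move=> /Linf_bnd h; apply/Linf_bnd => i j; rewrite (_ : entry _ i j = entry Phi j i)//.
by apply/funext => t; rewrite /entry mxE.
Qed.

Lemma bform_le_flipv :
  (forall r s, @H2_L2 R l1 l2 r -> @H2minus_L2 R k1 k2 s ->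
    complex.Re (bform Phi r s) <= t0 * (nrm (l2i _) r * nrm (l2i _) s)) ->
  forall r s, @H2_L2 R k1 k2 r -> @H2minus_L2 R l1 l2 s ->
    complex.Re (bform trmf r s) <= t0 * (nrm (l2i _) r * nrm (l2i _) s).
Proof.
move=> h r s hr hs; rewrite -(flipvK r) -(flipvK s) bform_flipv.
apply: le_trans (h _ _ (H2minus_L2_flipv hs) (H2_L2_flipv hr)) _.
by rewrite !nrm_flipv [X in _ * X]mulrC.
Qed.

Lemma singular_flipv f g : singular Phi t0 f g -> singular trmf t0 (flipv g) (flipv f).
Proof.
move=> [hf hg e1 e2]; split.
- exact: H2minus_L2_flipv.
- exact: H2_L2_flipv.
- by rewrite !n2_flipv.
- by rewrite bform_flipv n2_flipv e1.
Qed.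

Lemma singular_compact_flipv : singular_compact Phi t0 -> singular_compact trmf t0.
Proof.
move=> h r s hr hs r1 s1 lim.
have [||||e e0|phi [phim sC rC]] := h (fun j => flipv (s j)) (fun j => flipv (r j)).
- by move=> j; exact: H2minus_L2_flipv.
- by move=> j; exact: H2_L2_flipv.
- by move=> j; rewrite n2_flipv.
- by move=> j; rewrite n2_flipv.
- have [N hN] := lim e e0; exists N => j /hN.
  by rewrite -{1}(flipvK (r j)) -{1}(flipvK (s j)) bform_flipv.
exists phi; split; [exact: phim| |] => e e0.
  have [N hN] := rC e e0; exists N => i j hi hj.
  by have := hN i j hi hj; rewrite /= flipv_sub nrm_flipv.
have [N hN] := sC e e0; exists N => i j hi hj.
by have := hN i j hi hj; rewrite /= flipv_sub nrm_flipv.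
Qed.

End Duality.

(** * The four block operator *)
Section FourBlockOperator.
Variable R : realType.
Local Notation C := R[i].
Local Notation l2i k := (@l2inner R k 1).
Variables (k1 k2 l1 l2 : nat) (Phi : matfun R (k1 + k2) (l1 + l2)).
Hypothesis Phi_bnd : Linf Phi.
Local Notation VD := (matfun R (l1 + l2) 1).
Local Notation VE := (matfun R (k1 + k2) 1).
Local Notation D := (@H2_L2 R l1 l2).
Local Notation E := (@H2minus_L2 R k1 k2).
Local Notation nD := (@nrm R VD (l2i (l1 + l2))).
Local Notation nE := (@nrm R VE (l2i (k1 + k2))).
Let H := sip_semi_inner R.
Let HLE : @semi_inner R VE (@L2 R _ 1) (l2i (k1 + k2)) := L2_semi_inner R (k1 + k2) 1.
Let HLD : @semi_inner R VD (@L2 R _ 1) (l2i (l1 + l2)) := L2_semi_inner R (l1 + l2) 1.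
Let HD := D_semi_inner R l1 l2.
Let HE := E_semi_inner R k1 k2.

(** Existence keeps [xget] from returning its default. The witness subtracts the Riesz projection of
    each entry of the upper block. *)
Lemma orth_proj_spec (p : VE) : L2 p -> E (orth_proj E p) /\
  forall r, E r -> l2i _ (fun t => p t - orth_proj E p t) r = 0.
Proof.
move=> hp; have /L2_col ep := hp.
apply: (@xgetPex _ (fun=> 0) [set q | E q /\
    forall r, E r -> l2inner (fun t => p t - q t) r = 0]).
pose w : VE := fun t => col_mx (\col_i Pp (entry p (lshift k2 i) 0) t) 0.
pose q : VE := fun t => p t - w t.
have wl i : entry w (lshift k2 i) 0 = Pp (entry p (lshift k2 i) 0).
  by apply/funext => t; rewrite {1}/entry /w col_mxEu mxE.
have wr i : entry w (rshift k1 i) 0 = fun=> 0.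
  by apply/funext => t; rewrite {1}/entry /w col_mxEd mxE.
have qE i : entry q i 0 = fun t => entry p i 0 t - entry w i 0 t.
  by apply/funext => t; rewrite {1}/entry /q mxE [X in _ + X]mxE.
have Lw : L2 w.
  apply: cL2_split => i; first by rewrite wl; apply: sH2_cL2; exact: Pp_H2.
  by rewrite wr; exact: cL2_cst.
exists q; split.
  apply/H2minus_L2P; split=> i; rewrite qE.
    by rewrite wl; exact: Pp_H2m.
  by rewrite wr; apply: cL2B => //; exact: cL2_cst.
move=> r hr; rewrite (_ : (fun t => p t - q t) = w); last first.
  by apply/funext => t; rewrite /q opprB addrC subrK.
have /H2minus_L2P[r1 r2] := hr.
rewrite l2i_sip//; last exact: E_L2.
rewrite big_split_ord /= !big1 ?addr0// => i _.
  by rewrite wr /sip; under eq_fun do rewrite mul0r; exact: cint_cst.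
have hP := Pp_H2 (ep (lshift k2 i)).
by rewrite wl (si_conj H (r1 i).1 (sH2_cL2 hP)) (r1 i).2// cJ0.
Qed.

Lemma Gamma_E r : D r -> E (Gamma Phi r).
Proof. by move=> hr; apply: (orth_proj_spec _).1; apply: L2_mul => //; exact: D_L2. Qed.

Lemma Gamma_bform r s : D r -> E s -> l2i _ (Gamma Phi r) s = bform Phi r s.
Proof.
move=> hr hs; have hP : L2 (fun t => Phi t *m r t) by apply: L2_mul => //; exact: D_L2.
have [h1 h2] := orth_proj_spec hP.
have := ipBl HLE hP (E_L2 h1) (E_L2 hs).
rewrite [X in X = _ -> _](h2 s hs) => /esym/eqP; rewrite subr_eq0 => /eqP E1.
exact: esym.
Qed.

Lemma scale_ball (r : VD) c : D r -> nD r < c ->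
  D (Complex c^-1 0 *: r) /\ l2norm (Complex c^-1 0 *: r : VD) <= 1.
Proof.
move=> hr rc; have c0 : 0 < c := le_lt_trans (nrm_ge0 _ _) rc.
split; first exact: (siZ HD).
rewrite l2norm_nrm (nrmZ HD)//= expr0n addr0 sqrtr_sqr ger0_norm ?invr_ge0 ?(ltW c0)//.
by rewrite mulrC ler_pdivrMr// mul1r ltW.
Qed.

Lemma bform_scale (r : VD) (s : VE) c : D r -> E s -> 0 < c ->
  complex.Re (bform Phi r s) = c * complex.Re (bform Phi (Complex c^-1 0 *: r) s).
Proof.
move=> hr hs c0; have D0 := si0 HD.
have := bform_linl Phi_bnd (Complex c^-1 0) (D_L2 hr) (D_L2 D0) (E_L2 hs).
rewrite addr0 => ->; have -> : bform Phi 0 s = 0.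
  have -> : bform Phi 0 s = l2i _ 0 s.
    by congr (l2i _ _ s); apply/funext => t; rewrite mulmx0.
  exact: (ip0l HE hs).
by rewrite addr0 cReZ mulrA divff ?mul1r// gt_eqF.
Qed.

Variables (t0 : R).
Hypothesis t0_norm : Gamma_norm Phi = t0%:E.

Lemma Gamma_ball r : D r -> l2norm r <= 1 -> l2norm (Gamma Phi r) <= t0.
Proof.
move=> hr r1; rewrite -lee_fin -t0_norm; apply: ereal_sup_ubound.
by exists r.
Qed.

Lemma t0_ge0 : 0 <= t0.
Proof.
apply: le_trans (Gamma_ball (si0 HD) _); first by rewrite l2norm_nrm; exact: nrm_ge0.
rewrite l2norm_nrm /nrm /n2 (ip0l HD (si0 HD)) sqrtr0; exact: ler01.
Qed.

(** The operator norm is a supremum over the unit ball, and [r] may have norm 0; so [r] is divided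
    by its norm plus [e], and [e] tends to 0. *)
Lemma bform_le_norm r s : D r -> E s ->
  complex.Re (bform Phi r s) <= t0 * (nD r * nE s).
Proof.
move=> hr hs; apply: (@le_addeps _ _ _ (t0 * nE s)).
  by rewrite mulr_ge0 ?nrm_ge0// t0_ge0.
move=> e e0; have c0 : 0 < nD r + e by rewrite ltr_wpDl ?nrm_ge0.
have rc : nD r < nD r + e by rewrite ltrDl.
have [hD h1] := scale_ball hr rc.
rewrite (bform_scale hr hs c0) -Gamma_bform//.
have h2 := Gamma_ball hD h1; rewrite l2norm_nrm in h2.
have h3 := le_trans (ler_norm _) (rip_le HE (Gamma_E hD) hs); rewrite /rip in h3.
apply: le_trans (_ : (nD r + e) * (t0 * nE s) <= _); last first.
  by rewrite le_eqVlt; apply/orP; left; apply/eqP; ring.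
rewrite ler_pM2l//; apply: le_trans h3 _.
by rewrite ler_wpM2r ?nrm_ge0.
Qed.

(** An infimum below [t0] is beaten by some compact [K]. The operator norm of the difference is
    finite, being below [t0] and nonnegative by its value at the zero vector. *)
Lemma ess_norm_compact : (Gamma_ess_norm Phi < Gamma_norm Phi)%E ->
  exists K kap, [/\ compact_op D E K, 0 <= kap < t0 &
    forall r, D r -> l2norm r <= 1 -> l2norm (fun t => Gamma Phi r t - K r t) <= kap].
Proof.
move=> /ereal_inf_lt[_ [K hK <-]]; rewrite t0_norm => lt.
have le_op r : D r -> l2norm r <= 1 ->
    ((l2norm (fun t => Gamma Phi r t - K r t))%:E <=
      opnorm D (fun f t => (Gamma Phi f t - K f t)%R))%E.
  by move=> hr r1; apply: ereal_sup_ubound; exists r.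
move: lt le_op; case: (opnorm D _) => [x| |] lt le_op.
- exists K, x; split; [exact: hK| |by move=> r hr r1; have := le_op r hr r1; rewrite lee_fin].
  rewrite -lte_fin lt andbT -lee_fin.
  apply: le_trans (le_op 0 (si0 HD) _); first by rewrite lee_fin l2norm_nrm nrm_ge0.
  by rewrite l2norm_nrm /nrm /n2 (ip0l HD (si0 HD)) sqrtr0; exact: ler01.
- by [].
- have := le_op 0 (si0 HD); rewrite leeNy_eq => h; suff : false by [].
  have := h _; rewrite l2norm_nrm /nrm /n2 (ip0l HD (si0 HD)) sqrtr0; apply; exact: ler01.
Qed.

Lemma linear_op_null K : @linear_op R _ _ D E K -> ae_circle (fun t => K 0 t = 0).
Proof.
move=> [_ KL]; have := KL 1 0 0 (si0 HD) (si0 HD).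
apply: aeS => t _; rewrite (_ : (fun s => _) = 0 :> VD); last first.
  by apply/funext => s; rewrite scaler0 addr0.
by rewrite scale1r => /eqP; rewrite -subr_eq0 opprD addNKr oppr_eq0 => /eqP.
Qed.

(** [Gamma] is split into [Gamma - K], of norm at most [kap], and [K]; [r] is scaled into the unit
    ball as in [bform_le_norm], and [K] is homogeneous only almost everywhere. *)
Lemma bform_le_compact K kap r s : @linear_op R _ _ D E K -> 0 <= kap ->
  (forall r, D r -> l2norm r <= 1 -> l2norm (fun t => Gamma Phi r t - K r t) <= kap) ->
  D r -> E s -> complex.Re (bform Phi r s) <= kap * (nD r * nE s) + nE (K r) * nE s.
Proof.
move=> KL k0 hk hr hs; apply: (@le_addeps _ _ _ (kap * nE s)).
  by rewrite mulr_ge0 ?nrm_ge0.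
move=> e e0; pose c := nD r + e; have c0 : 0 < c by rewrite ltr_wpDl ?nrm_ge0.
have rc : nD r < c by rewrite ltrDl.
have [hD h1] := scale_ball hr rc.
pose r' : VD := Complex c^-1 0 *: r; rewrite -/r' in hD h1.
have GE := Gamma_E hD; have KE := KL.1 _ hD; have KrE := KL.1 _ hr.
have Kr : ae_circle (fun t => K r' t = Complex c^-1 0 *: K r t).
  have := KL.2 (Complex c^-1 0) r 0 hr (si0 HD).
  rewrite (_ : (fun s => _ + _) = r'); last first.
    by apply/funext => t; rewrite [X in _ + X](_ : _ = 0) ?addr0.
  apply: aeS2 (linear_op_null KL) => t _ -> ->; by rewrite addr0.
have split1 : complex.Re (l2i _ (Gamma Phi r') s) =
    complex.Re (l2i _ (Gamma Phi r' - K r') s) + complex.Re (l2i _ (K r') s).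
  by rewrite (ipBl HE GE KE hs) cReD cReN subrK.
have KK : l2i _ (K r') s = Complex c^-1 0 * l2i _ (K r) s.
  have ZE := siZ HE (Complex c^-1 0) KrE.
  rewrite -(ipZl HE _ KrE hs) !l2i_sip//; try exact: E_L2.
  have /L2_col m1 := E_L2 KE; have /L2_col m2 := E_L2 ZE; have /L2_col m3 := E_L2 hs.
  apply: eq_bigr => i _; apply: sip_ae.
  - by case: (m1 i).
  - by case: (m3 i).
  - by case: (m2 i).
  - by case: (m3 i).
  - by apply: aeS Kr => t _ h; rewrite /entry h.
  - exact: aeT.
rewrite (bform_scale hr hs c0) -Gamma_bform// split1 KK cReZ mulrDr (mulrA c c^-1) divff ?gt_eqF// mul1r.
have h2 := hk _ hD h1; rewrite l2norm_nrm in h2.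
have h3 := le_trans (ler_norm _) (rip_le HE (siB HE GE KE) hs); rewrite /rip in h3.
have h4 := le_trans (ler_norm _) (rip_le HE KrE hs); rewrite /rip in h4.
have h5 : c * complex.Re (l2i _ (Gamma Phi r' - K r') s) <= c * (kap * nE s).
  rewrite ler_pM2l//; apply: le_trans h3 _; by rewrite ler_wpM2r ?nrm_ge0.
have -> : kap * (nD r * nE s) + nE (K r) * nE s + e * (kap * nE s) =
  c * (kap * nE s) + nE (K r) * nE s by rewrite /c; ring.
exact: lerD.
Qed.

Lemma n2_sub_le (V : lmodType C) (E0 : set V) ip (HI : semi_inner E0 ip) x y :
  E0 x -> E0 y -> n2 ip (x - y) <= 2 * n2 ip x + 2 * n2 ip y.
Proof.
move=> hx hy; have := n2B HI hx hy; have := n2D HI hx hy.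
have := n2_ge0 HI (siD HI hx hy); lra.
Qed.

Lemma double_arith (x y eta : R) : x <= 2 * eta -> y <= 2 * eta -> 2 * x + 2 * y <= 8 * eta.
Proof. by move=> h1 h2; lra. Qed.

Lemma gap_arith (t eta n m b : R) : 0 < t -> t - eta < b -> n <= 1 -> m <= 1 ->
  t * (n + m) - 2 * b <= 2 * eta.
Proof.
move=> t_gt0 hb hn hm; have := lerD hn hm; rewrite -(ler_pM2l t_gt0).
rewrite -mulr2n; lra.
Qed.

(** For a difference [(rho, sig)] of two pairs, [a] and [b] are the norms, [c] is that of [K rho]
    and [w] the form value. The gap bound gives at most [8 eta], the compact part at most another
    [8 eta], so [(t - kap) (a^2 + b^2) <= 16 eta], half of the allowed [32 eta]. *)
Lemma cauchy_arith (kap t eta e a b c w : R) : 0 <= kap -> kap < t ->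
  32 * eta = (t - kap) * e ^+ 2 -> 0 < eta ->
  w <= kap * (a * b) + c * b -> t * (a ^+ 2 + b ^+ 2) - 2 * w <= 8 * eta ->
  0 <= c -> 0 <= b -> c <= 2 * eta -> b <= 2 -> a ^+ 2 + b ^+ 2 < e ^+ 2.
Proof.
move=> k0 kt e32 eta0 hw hgap c0 b0 ceta b2.
have tk : 0 < t - kap by rewrite subr_gt0.
have h1 : c * b <= 2 * eta * 2 by apply: ler_pM.
have h2 : kap * (2 * (a * b)) <= kap * (a ^+ 2 + b ^+ 2).
  by apply: ler_wpM2l => //; have := sqr_ge0 (a - b); rewrite sqrrB -mulr_natl; lra.
rewrite -(ltr_pM2l tk) -e32 mulrBl; lra.
Qed.

(** Almost maximizing pairs have a small [gap], hence so have their differences. Along a subsequence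
    on which [K] converges, a difference obeys the form bound with [kap < t0] up to a small error,
    and a small [gap] then forces both of its components to be small in norm. *)
Theorem ess_norm_singular_compact : (Gamma_ess_norm Phi < Gamma_norm Phi)%E ->
  singular_compact Phi t0.
Proof.
move=> /ess_norm_compact[K [kap [hK /andP[kap0 kapt] hk]]].
have t0_gt0 : 0 < t0 by exact: le_lt_trans kap0 kapt.
have HG := gap_semi_inner Phi_bnd t0_gt0 bform_le_norm.
have [KL KC] := hK.
move=> r s hr hs r1 s1 lim.
have nr j : nD (r j) <= 1 by rewrite /nrm -[leRHS]sqrtr1 ler_wsqrtr.
have ns j : nE (s j) <= 1 by rewrite /nrm -[leRHS]sqrtr1 ler_wsqrtr.
have [|phi [g [phim hg Kg]]] := KC r.
  by move=> j; split => //; rewrite l2norm_nrm.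
exists phi.
have phige j : (j <= phi j)%N.
  by elim: j => // j ih; exact: leq_ltn_trans ih (phim j j.+1 (leqnn _)).
have main e : 0 < e -> exists N, forall i j, (N <= i)%N -> (N <= j)%N ->
    n2 (l2i _) (r (phi i) - r (phi j)) + n2 (l2i _) (s (phi i) - s (phi j)) < e ^+ 2.
  move=> e0; have tk : 0 < t0 - kap by rewrite subr_gt0.
  pose eta := (t0 - kap) * e ^+ 2 / 32.
  have eta0 : 0 < eta by rewrite divr_gt0// mulr_gt0// exprn_gt0.
  have [N1 hN1] := lim eta eta0.
  have [N2 hN2] : exists N, forall j, (N <= j)%N -> nE (K (r (phi j)) - g) < eta.
    move: Kg => /cvgrPdist_lt /(_ eta eta0)[N _ hN]; exists N => j /hN /=.
    by rewrite sub0r normrN l2norm_nrm ger0_norm ?nrm_ge0.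
  exists (maxn N1 N2) => i j; rewrite !geq_max => /andP[i1 i2] /andP[j1 j2].
  pose rho := r (phi i) - r (phi j); pose sig := s (phi i) - s (phi j).
  have hrho : D rho by exact: (siB HD).
  have hsig : E sig by exact: (siB HE).
  have gapj m : (N1 <= m)%N -> n2 (gap Phi t0) (r (phi m), s (phi m)) <= 2 * eta.
    move=> hm; have := hN1 _ (leq_trans hm (phige m)).
    by move=> hb; rewrite gap_diag//; exact: (gap_arith t0_gt0 hb (r1 _) (s1 _)).
  (* Twice [2 eta] for each of the two pairs, by [n2_sub_le] in the form [gap]. *)
  have gd : n2 (gap Phi t0) (rho, sig) <= 8 * eta.
    apply: le_trans (n2_sub_le HG (x := (r (phi i), s (phi i))) (y := (r (phi j), s (phi j)))
      (conj (hr _) (hs _)) (conj (hr _) (hs _))) _.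
    exact: (double_arith (gapj i i1) (gapj j j1)).
  have Krho : nE (K rho) <= 2 * eta.
    have Ei := KL.1 _ (hr (phi i)); have Ej := KL.1 _ (hr (phi j)).
    have EK := KL.1 _ hrho.
    have ae1 : ae_circle (fun t => K rho t = (K (r (phi i)) - K (r (phi j))) t).
      have := KL.2 (-1) _ _ (hr (phi j)) (hr (phi i)).
      rewrite (_ : (fun s => _ + _) = rho); last first.
        by apply/funext => t; rewrite scaleN1r addrC.
      by apply: aeS => t _ ->; rewrite scaleN1r addrC.
    have -> : nE (K rho) = nE (K (r (phi i)) - K (r (phi j))).
      have /L2_col m1 := E_L2 EK; have /L2_col m2 := E_L2 (siB HE Ei Ej).
      rewrite /nrm; congr Num.sqrt; apply: n2_ae.
      - by move=> a; case: (m1 a).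
      - by move=> a; case: (m2 a).
      - by apply: aeS ae1 => t _ ->.
    apply: le_trans (nrm_tri HE Ei hg Ej) _; rewrite (nrm_sub HE hg Ej).
    apply: le_trans (lerD (ltW (hN2 i i2)) (ltW (hN2 j j2))) _.
    by rewrite -mulr2n mulr_natl.
  have nsig : nE sig <= 2.
    apply: le_trans (nrmB HE (hs _) (hs _)) _.
    by apply: le_trans (lerD (ns _) (ns _)) _; rewrite -mulr2n.
  have := bform_le_compact KL kap0 hk hrho hsig => hb.
  move: gd; rewrite gap_diag// -/rho -/sig -(nrm_sqr HD hrho) -(nrm_sqr HE hsig).
  move=> hgap; apply: (cauchy_arith kap0 kapt _ eta0 hb hgap) => //; try exact: nrm_ge0.
  by rewrite /eta mulrC divfK.
have fin (u v : R) e : 0 < e -> 0 <= v -> u + v < e ^+ 2 -> Num.sqrt u < e.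
  move=> e0 v0 h; rewrite -[ltRHS]ger0_norm ?(ltW e0)// -sqrtr_sqr ltr_sqrt ?exprn_gt0//.
  by apply: le_lt_trans h; rewrite lerDl.
split => // e e0; have [N hN] := main e e0; exists N => i j hi hj.
  by apply: fin e0 _ (hN i j hi hj); apply: (n2_ge0 HE); exact: (siB HE).
apply: (fin _ (n2 (l2i _) (r (phi i) - r (phi j))) e e0).
  by apply: (n2_ge0 HD); exact: (siB HD).
by rewrite addrC; exact: hN.
Qed.

End FourBlockOperator.

(** * Maximizing vectors as singular pairs, and the theorem *)

Section Assembly.
Variable R : realType.
Local Notation C := R[i].
Local Notation l2i k := (@l2inner R k 1).

(** The identity satisfied by a maximizing vector has a finite left-hand side and a positive factor
    [l2norm f], which rules out an infinite operator norm. *)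
Lemma maximizing_norm k1 k2 l1 l2 (Phi : matfun R (k1 + k2) (l1 + l2)) f :
  maximizing Phi f -> Gamma_norm Phi = (fine (Gamma_norm Phi))%:E.
Proof.
move=> [_ f0]; have fp : 0 < l2norm f by rewrite lt_neqAle eq_sym f0 l2norm_nrm nrm_ge0.
case: (Gamma_norm Phi) => [x| |]//; last by rewrite gt0_mulNye ?lte_fin.
by rewrite gt0_mulye ?lte_fin.
Qed.

(** The form [bform] represents [Gamma], so its value at the pair is [|Gamma f|^2 / t0], equal to
    [t0 |f|^2] by maximality. *)
Lemma maximizing_singular k1 k2 l1 l2 (Phi : matfun R (k1 + k2) (l1 + l2)) f :
  Linf Phi -> 0 < fine (Gamma_norm Phi) -> maximizing Phi f ->
  singular Phi (fine (Gamma_norm Phi)) f (dual_vector Phi f).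
Proof.
move=> hPhi; have := @maximizing_norm _ _ _ _ Phi f; set t0 := fine _ => hn t00 hm.
have hfin := hn hm; have [hf f0] := hm; rewrite hfin -EFinM => -[nE].
have HE := E_semi_inner R k1 k2; have HD := D_semi_inner R l1 l2.
have hG := Gamma_E hPhi hf.
have nG : n2 (l2i _) (Gamma Phi f) = t0 ^+ 2 * n2 (l2i _) f.
  by rewrite -(nrm_sqr HE hG) -(nrm_sqr HD hf) -!l2norm_nrm nE exprMn.
have t0n : t0 != 0 by rewrite gt_eqF.
have gE : dual_vector Phi f = Complex t0^-1 0 *: Gamma Phi f by [].
have hg : @H2minus_L2 R k1 k2 (dual_vector Phi f) by rewrite gE; exact: (siZ HE).
split => //.
  by rewrite gE (n2Z HE)//= expr0n addr0 nG mulrA exprVn mulVf ?mul1r// expf_neq0.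
rewrite -Gamma_bform// gE (ipZr HE)//.
have -> : Num.conj (Complex t0^-1 0 : C) = Complex t0^-1 0 by apply/complexP => //=; rewrite oppr0.
by rewrite cReZ -/(n2 _ _) nG expr2 !mulrA mulVf// mul1r.
Qed.

Lemma is_gcd_inner_sgcd k (F : matfun R k 1) th : is_gcd_inner F th ->
  sgcd (fun i => entry F i 0) th.
Proof.
have dE (a b : R -> C) : inner_divides a b <-> sdiv a b.
  by split=> -[g hg ae]; exists g => //; exact/H2_smx.
move=> [/inner_smx h1 h2 h3]; split => //.
- by move=> i; apply/dE; exact: h2.
- move=> e he ed; apply/dE; apply: h3; first exact/inner_smx.
  by move=> i; apply/dE; exact: ed.
Qed.

End Assembly.

Theorem theorem5p1 (R : realType) (m1 m2 n1 n2 : nat)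
  (Phi : matfun R (m1.+1 + m2) (n1.+1 + n2))
  (Phi_bounded : Linf Phi)
  (ess_lt : (Gamma_ess_norm Phi < Gamma_norm Phi)%E)
  (Vc : matfun R n1.+1 n1) (Wc : matfun R m1.+1 m1)
  (VWc : associated Phi Vc Wc) :
  left_invertible Vc /\ left_invertible Wc.
Proof.
have [f [h [th [tau]]]] := VWc; cbv zeta.
set g := dual_vector Phi f.
move=> [hmax [/outerH2_outers oh habs] [/is_gcd_inner_sgcd hth /is_gcd_inner_sgcd htau] cV cW].
have t0E := maximizing_norm hmax; set t0 := fine _ in t0E.
(* The norm strictly exceeds the nonnegative bound [kap] of some [Gamma - K] with [K] compact. *)
have t0_gt0 : 0 < t0.
  have [K [kap [_ /andP[k0 kt] _]]] := ess_norm_compact t0E ess_lt.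
  exact: le_lt_trans k0 kt.
have ble := bform_le_norm Phi_bounded t0E.
have comp := ess_norm_singular_compact Phi_bounded t0E ess_lt.
have fg : singular Phi t0 f g := maximizing_singular Phi_bounded t0_gt0 hmax.
have fh : ae_circle (fun t => sqnorm (f t) = csq (h t)).
  apply: aeS habs => t _ /(congr1 (fun z => z ^+ 2)); rewrite norm_csq.
  have -> : Complex (enorm (f t)) 0 ^+ 2 = Complex (sqnorm (f t)) 0 :> R[i].
    apply/complexP; rewrite expr2 ?cReM ?cImM /= ?mulr0 ?mul0r ?subr0 ?addr0//.
    by rewrite -expr2 sqr_sqrtr// sqnorm_ge0.
  by case=> ->.
clearbody g.
have ef i : entry (fun t => usubmx (f t)) i 0 = entry f (lshift n2 i) 0.
  by apply/funext => t; rewrite /entry mxE.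
have eg i : entry (fun t => Num.conj (zfun t) *: conjmf (usubmx (g t))) i 0 =
    flip (entry g (lshift m2 i) 0).
  by apply/funext => t; rewrite /entry !mxE.
have hth' : sgcd (fun i => entry f (lshift n2 i) 0) th.
  by move: hth; congr sgcd; apply/funext => i; exact: ef.
have htau' : sgcd (fun i => flip (entry g (lshift m2 i) 0)) tau.
  by move: htau; congr sgcd; apply/funext => i; exact: eg.
have [sth dth _] := hth'; have [stau dtau _] := htau'.
(* The pair [(f, g)] itself yields [Wc]. For [Vc] the same result is applied to the transposed
   symbol and the pair [(flipv g, flipv f)], with [tau] and [th] exchanged. *)
split; last exact: (complement_of_dual_left_invertible Phi_bounded t0_gt0 ble comp fg oh fh sth dth htau' cW).
have gh : ae_circle (fun t => sqnorm (flipv g t) = csq (h t)).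
  apply: aeS2 fh (singular_norm Phi_bounded t0_gt0 ble fg) => t _ <- ->.
  exact: sqnorm_flipv.
apply: (complement_of_dual_left_invertible (Linf_trmf Phi_bounded) t0_gt0
  (bform_le_flipv ble) (singular_compact_flipv comp) (singular_flipv fg) oh gh stau).
- by move=> i; rewrite entry_flipv; exact: dtau.
- by move: hth'; congr sgcd; apply/funext => i; rewrite entry_flipv flipK.
(* Flipping twice restores [f], so the column to be completed is the one of [Vc]. *)
move: cV; congr completes; apply/funext => t; congr (_ *: _).
apply/matrixP => i j; rewrite !mxE cJM !cJK mulrA.
by rewrite [_ * zfun t]zJ mul1r.
Qed.
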